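(* Let $n,k\ge 1$ be integers, let $0<\alpha\le k$ and let $T\subset\mathbb{R}^k$ be an Ahlfors--David $\alpha$-regular set. Let $B\subset T\times\mathbb{R}^n$ be a Borel set such that $\dim \mathrm{proj}_{\mathbb{R}^k}B=\alpha$. Then there exists a $\Gamma_\alpha$-null Borel set $G\subset B$ such that $$\dim(B\setminus G)=\alpha+\mathrm{ess}^{\alpha}\text{-}\sup(\dim B_t).$$
   Context: $\dim$ denotes Hausdorff dimension and $\mathcal{H}^s$ the $s$-dimensional Hausdorff measure. $\mathrm{proj}_{\mathbb{R}^k}$ is the projection of $\mathbb{R}^k\times\mathbb{R}^n$ to the first factor. For $B\subset\mathbb{R}^k\times\mathbb{R}^n$ and $t\in\mathbb{R}^k$, $B_t=\{x\in\mathbb{R}^n:(t,x)\in B\}$. Ahlfors--David regularity: a Borel set $T\subset\mathbb{R}^k$ is Ahlfors--David $\alpha$-regular if there are $c,c'>0$ such that $c\,r^\alpha\le\mathcal{H}^\alpha(T\cap B(t,r))\le c'\,r^\alpha$ for all $t\in T$ and $0<r\le 1$, where $B(t,r)$ is the open ball. $\Gamma_\alpha$-null: for $0<\alpha\le k$, a set $G\subset\mathbb{R}^k\times\mathbb{R}^n$ is $\Gamma_\alpha$-null if for every Lipschitz map $f:\mathbb{R}^k\to\mathbb{R}^n$ we have $\mathcal{H}^\alpha(\{t\in\mathbb{R}^k:(t,f(t))\in G\})=0$. Essential supremum: for a non-empty $B\subset\mathbb{R}^k\times\mathbb{R}^n$ let $A=\mathrm{proj}_{\mathbb{R}^k}B$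 and $\alpha=\dim A$. If $\mathcal{H}^\alpha(A)>0$, define $\mathrm{ess}^{\alpha}\text{-}\sup(\dim B_t)=\sup\{q\ge 0:\mathcal{H}^\alpha(\{t\in\mathbb{R}^k:\dim B_t>q\})>0\}$, with $\sup\emptyset=0$. If $\mathcal{H}^\alpha(A)=0$, define $\mathrm{ess}^{\alpha}\text{-}\sup(\dim B_t)=\lim_{\varepsilon\to0+}\mathrm{ess}^{\alpha-\varepsilon}\text{-}\sup(\dim B_t)$, where $\mathrm{ess}^{\alpha-\varepsilon}\text{-}\sup$ is given by the same supremum formula with $\mathcal{H}^{\alpha-\varepsilon}$ in place of $\mathcal{H}^\alpha$. *)

(* Defs.v *)
From HB Require Import structures.
From mathcomp Require Import all_boot all_order all_algebra.
From mathcomp Require Import all_classical all_reals all_analysis.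
Import Order.TTheory GRing.Theory Num.Theory.
Import numFieldNormedType.Exports.

Set Implicit Arguments.
Unset Strict Implicit.
Unset Printing Implicit Defensive.

Local Open Scope classical_set_scope.
Local Open Scope ring_scope.

(* The norm of the library on 'rV[R]_n and on products is the sup norm, so
   Euclidean distances are defined here. The topologies of the library on these
   types are the Euclidean ones. *)
Definition eucl_dist {R : realType} {n : nat} (x y : 'rV[R]_n) : R :=
  Num.sqrt (\sum_(i < n) (x 0 i - y 0 i) ^+ 2).

Definition eucl_dist_prod {R : realType} {k n : nat}
    (p q : 'rV[R]_k * 'rV[R]_n) : R :=
  Num.sqrt (eucl_dist p.1 q.1 ^+ 2 + eucl_dist p.2 q.2 ^+ 2).

Definition borel {T : topologicalType} (A : set T) : Prop := <<s open >> A.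

Section Hausdorff.
Context {R : realType} {T : Type}.
Variable d : T -> T -> R.

(* diam set0 = -oo *)
Definition diam (E : set T) : \bar R :=
  ereal_sup [set (d p.1 p.2)%:E | p in E `*` E].

(* diam(E)^s with the conventions 0^0 = 1 and diam(set0)^s = 0; it is only used
   for sets E of finite diameter. *)
Definition diam_pow (s : R) (E : set T) : \bar R :=
  if `[< E = set0 >] then 0%E else (fine (diam E) `^ s)%:E.

Definition hausdorff_premeasure (delta s : R) (A : set T) : \bar R :=
  ereal_inf [set (\sum_(0 <= i <oo) diam_pow s (E i))%E | E in
    [set E : (set T)^nat |
      (forall i, (diam (E i) <= delta%:E)%E) /\ A `<=` \bigcup_i E i]].

(* The premeasure is nonincreasing in delta, so that this supremum is its limit
   as delta tends to 0. *)
Definition hausdorff_measure (s : R) (A : set T) : \bar R :=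
  ereal_sup [set hausdorff_premeasure delta s A | delta in
    [set delta : R | 0 < delta]].

Definition hausdorff_dim (A : set T) : \bar R :=
  ereal_inf [set s%:E | s in
    [set s : R | 0 <= s /\ hausdorff_measure s A = 0%E]].

End Hausdorff.

Section Slices.
Context {R : realType} {k n : nat}.
Implicit Types (B G : set ('rV[R]_k * 'rV[R]_n)) (T : set 'rV[R]_k).

Definition eucl_ball (t : 'rV[R]_k) (r : R) : set 'rV[R]_k :=
  [set u | eucl_dist t u < r].

Definition ahlfors_david_regular (alpha : R) T : Prop :=
  borel T /\
  exists c c' : R, [/\ 0 < c, 0 < c' &
    forall (t : 'rV[R]_k) (r : R), T t -> 0 < r <= 1 ->
      ((c * r `^ alpha)%:E
        <= hausdorff_measure eucl_dist alpha (T `&` eucl_ball t r)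
        <= (c' * r `^ alpha)%:E)%E].

Definition eucl_lipschitz (f : 'rV[R]_k -> 'rV[R]_n) : Prop :=
  exists L : R, forall t u, eucl_dist (f t) (f u) <= L * eucl_dist t u.

Definition Gamma_null (alpha : R) G : Prop :=
  forall f : 'rV[R]_k -> 'rV[R]_n, eucl_lipschitz f ->
    hausdorff_measure eucl_dist alpha [set t | G (t, f t)] = 0%E.

Definition projRk B : set 'rV[R]_k := fst @` B.

Definition sliceRn B (t : 'rV[R]_k) : set 'rV[R]_n := [set x | B (t, x)].

(* The maximum with 0 gives the convention that the empty supremum is 0. *)
Definition ess_sup_dim_at (s : R) B : \bar R :=
  maxe 0%E (ereal_sup [set q%:E | q in [set q : R | 0 <= q /\
    (0 < hausdorff_measure eucl_dist s
           [set t | (q%:E < hausdorff_dim eucl_dist (sliceRn B t))%E])%E]]).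

Definition ess_sup_dim B : \bar R :=
  let alpha := fine (hausdorff_dim eucl_dist (projRk B)) in
  if (0 < hausdorff_measure eucl_dist alpha (projRk B))%E
  then ess_sup_dim_at alpha B
  else lim (ess_sup_dim_at (alpha - eps) B @[eps --> 0^'+]).

End Slices.

(* Main.v *)
Require Import Defs.
From HB Require Import structures.
From mathcomp Require Import all_boot all_order all_algebra.
From mathcomp Require Import all_classical all_reals all_analysis.
From mathcomp Require Import ring lra measurable_realfun.
Import Order.TTheory GRing.Theory Num.Theory.
Import numFieldNormedType.Exports.

(** Code cells of [R^k] and [R^n] by infinite dyadic paths, and let [q] exceed almost
    every [dim B_t]. Slices of null [q]-content can be covered measurably in [t] by
    cells [Q], each used for [t] in a set [A_Q], with the sum of [|Q|^q mu(A_Q)]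
    arbitrarily small: the integrated net content of the slices is continuous along
    increasing sequences by strong subadditivity, so Choquet's capacitability argument
    reduces a Borel (hence Suslin) set to compact slices.

    Keep the products [P x Q] of cells of common side [2^-j] for which the part of [A_Q]
    in [P] has measure at least [2^-(j eta) 2^-(j alpha)]: their [(alpha + q + eta)]-sum
    is small, so the points lying in kept cells for each of a sequence of finer and finer
    coverings form a set of dimension at most [alpha + q + eta]. On a Lipschitz graph the
    discarded parts are summably small, since over each [P] the graph meets boundedly many
    [Q] and regularity bounds the number of [P] meeting [T] by [O(2^(j alpha))]; so the
    rest of [B] is null for [Gamma_alpha].

    Conversely [dim B >= alpha + ess sup dim B_t]: from a covering of [B] with small sums,
    a weighted covering of the base is obtained, with weights the sums over the slices, and
    averaging over its level sets turns it into a genuine covering; no measure on the base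
    is needed. To get equality, put back a Borel subset of [B] of dimension exactly
    [alpha + ess sup dim B_t], extracted by trimming as in Besicovitch's theorem. *)


Set Implicit Arguments.
Unset Strict Implicit.
Unset Printing Implicit Defensive.

Local Open Scope classical_set_scope.
Local Open Scope ring_scope.

(** * Path spaces and net content *)

(** Everything is moved to spaces of infinite words because there a covering by cells is a set of
    finite words: it can be cut along prefixes, which makes contents additive over cylinders and
    cylinders Carathéodory measurable, and compactness becomes König's lemma. The coding may fail to
    be injective, since it only serves to pull sets back and to push closed sets of words forward.
    The obstacle is that a null slice has a cheap covering for each [t] separately, with no reason
    to depend measurably on [t]. For a compact slice a finite covering still works for all
    parameters sharing a long prefix with [t], and a choice that depends on a prefix only is
    measurable. The loss [eta] makes the discarded measures decay geometrically; it disappears at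
    the end by intersecting over [eta = 2^-i]. *)

Lemma esum_ge_term (R : realType) (I : choiceType) (A : set I) (a : I -> \bar R) i :
  A i -> (a i <= \esum_(j in A) a j)%E.
Proof.
by move=> Ai; apply: esum_ge; exists [set i]; [split=> // _ ->|rewrite fsbig_set1].
Qed.

Section EsumComplements.
Context {R : realType} {I : choiceType}.
Local Open Scope ereal_scope.
Implicit Types (A B : set I) (a : I -> \bar R).

Lemma esum_le_subset A B a : A `<=` B -> \esum_(i in A) a i <= \esum_(i in B) a i.
Proof.
move=> AB; apply: ereal_sup_le => x [X [finX XA] <-].
by exists X => //; split=> // i /XA /AB.
Qed.

Lemma esum_bigcup_le (J : nat -> set I) a : (forall i, 0 <= a i) ->
  \esum_(i in \bigcup_k J k) a i <= \sum_(k <oo) \esum_(i in J k) a i.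
Proof.
move=> a0; rewrite nneseries_esumT; last by move=> k; apply: esum_ge0.
rewrite esum_mkcond.
under [leRHS]eq_esum do rewrite esum_mkcond.
rewrite (esum_esum (J := fun=> setT)); last by move=> *; case: ifP.
have -> : [set: nat] `*`` (fun=> [set: I]) =
    (fun p => (p.2, p.1)) @` ([set: I] `*`` (fun=> [set: nat])).
  by apply/seteqP; split=> [[i j] _|[i j] _]//=; exists (j, i).
rewrite (@esum_image R _ _ _ _ (fun k : nat * I => if k.2 \in J k.1 then a k.2 else 0));
  last by move=> [i j] [i' j'] _ _ /= [-> ->].
rewrite -(esum_esum (J := fun=> setT) (a := fun i j => if i \in J j then a i else 0));
  last by move=> *; case: ifP.
apply: le_esum => i _; case: ifPn => [|_]; last by apply: esum_ge0 => *; case: ifP.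
rewrite inE => -[k _ Jk].
have := @esum_ge_term _ _ [set: nat] (fun j => if i \in J j then a i else 0) k Logic.I.
by rewrite mem_set.
Qed.

Lemma esumU_le A B a : (forall i, 0 <= a i) ->
  \esum_(i in A `|` B) a i <= \esum_(i in A) a i + \esum_(i in B) a i.
Proof.
move=> a0; rewrite (esumID A)//; apply: leeD; apply: esum_le_subset => i []//.
by case.
Qed.

Lemma esum_seq_le (s : seq I) a : (forall i, 0 <= a i) ->
  \esum_(i in [set` s]) a i <= \sum_(i <- s) a i.
Proof.
move=> a0; elim: s => [|x s IH].
  by rewrite big_nil [X in esum X _](_ : _ = set0) ?esum_set0// -subset0 => y.
rewrite big_cons; apply: le_trans (leeD (lexx _) IH).
rewrite -(@esum_set1 _ _ x a)//; apply: le_trans (esumU_le _ _ a0).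
by apply: esum_le_subset => y /=; rewrite inE => /orP[/eqP ->|?]; [left|right].
Qed.

Lemma esumZl A (c : R) a : (0 <= c)%R -> (forall i, 0 <= a i) ->
  \esum_(i in A) (c%:E * a i) = c%:E * \esum_(i in A) a i.
Proof.
rewrite le_eqVlt => /orP[/eqP <-|c0] a0.
  by rewrite mul0e esum1// => i _; rewrite mul0e.
rewrite /esum -ereal_sup_pZl//; congr (ereal_sup _).
apply/seteqP; split=> z /=.
  by move=> [X XA <-]; exists (\sum_(i \in X) a i); [exists X|rewrite ge0_mule_fsumr].
by move=> [_ [X XA <-] <-]; exists X; rewrite // ge0_mule_fsumr.
Qed.

Lemma esum_seq_in_le (P : set I) (s : seq I) a : (forall i, 0 <= a i) ->
  (forall i, P i -> i \in s) -> \esum_(i in P) a i <= \sum_(i <- s) a i.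
Proof.
by move=> a0 Ps; apply: le_trans (esum_seq_le _ a0); apply: esum_le_subset => i /Ps.
Qed.

Lemma esum_cond_le (P : pred I) (s : seq I) a : (forall i, 0 <= a i) ->
  (forall i, P i -> i \in s) ->
  \esum_(i in [set: I]) (if P i then a i else 0) <= \sum_(i <- s) a i.
Proof.
move=> a0 Ps; apply: le_trans (esum_seq_in_le (P := [set` P]) a0 Ps).
rewrite [leRHS]esum_mkcond; apply: le_esum => i _.
by case: ifPn => [Pi|_]; [rewrite mem_set|case: ifP].
Qed.

End EsumComplements.

Lemma esum_fibers (R : realType) (I J : choiceType) (f : I -> J) (D : set I)
    (a : I -> \bar R) : (forall i, 0 <= a i)%E ->
  (\esum_(p in [set: J]) \esum_(i in D `&` [set i | f i = p]) a i =
   \esum_(i in D) a i)%E.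
Proof.
move=> a0; rewrite esum_esum//.
rewrite (_ : _ `*`` _ = (fun i => (f i, i)) @` D); last first.
  apply/seteqP; split=> [[p i] /= [_ [Di fi]]|_ [i Di <-]] //=.
  by exists i; rewrite ?fi.
by rewrite esum_image//; move=> i j _ _ [].
Qed.

Lemma fin_approx_le (R : realType) (a b : \bar R) :
  (forall e : R, 0 < e -> (a <= b + e%:E)%E) -> (a <= b)%E.
Proof. by move=> h; apply/lee_addgt0Pr. Qed.

Section Paths.
Context {A : Type}.
Implicit Types (y : nat -> A) (u : seq A).

Definition pre (m : nat) y : seq A := mkseq y m.

Lemma size_pre m y : size (pre m y) = m.
Proof. exact: size_mkseq. Qed.

Lemma preS m y : pre m.+1 y = rcons (pre m y) (y m).
Proof. by rewrite /pre /mkseq -addn1 iotaD map_cat cats1. Qed.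

Lemma take_pre l m y : (l <= m)%N -> take l (pre m y) = pre l y.
Proof.
move=> lm; rewrite /pre /mkseq -map_take; congr (map _ _).
by rewrite take_iota; congr iota; apply/minn_idPl.
Qed.

Lemma pre_eqP m y y' : pre m y = pre m y' <-> forall i, (i < m)%N -> y i = y' i.
Proof.
split=> [e i im|e]; last first.
  by apply/eq_in_map => i; rewrite mem_iota add0n => /andP[_ /e].
by have := congr1 (fun s => nth (y i) s i) e; rewrite !nth_mkseq.
Qed.

Lemma pre_eq_le l m y y' : (l <= m)%N -> pre m y = pre m y' -> pre l y = pre l y'.
Proof. by move=> lm e; rewrite -(take_pre y lm) -(take_pre y' lm) e. Qed.

(** Dependent choice in tree form: it yields the limit word in König's lemma, the integer bounds in
    Choquet's argument and the binary digits of a point. *)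
Lemma path_builder (P : seq A -> Prop) : P [::] ->
  (forall l, P l -> exists v, P (rcons l v)) ->
  exists b : nat -> A, forall m, P (pre m b).
Proof.
move=> P0 PS.
have [g gP] : exists g : seq A -> A, forall l, P l -> P (rcons l (g l)).
  have [v0 _] := PS _ P0.
  have [g gP] := @choice _ _ (fun l v => P l -> P (rcons l v)) (fun l =>
    match pselect (P l) with
    | left Pl => let: ex_intro v Pv := PS l Pl in ex_intro _ v (fun=> Pv)
    | right nPl => ex_intro _ v0 (fun Pl => False_ind _ (nPl Pl)) end).
  by exists g.
pose l m := iter m (fun l => rcons l (g l)) [::].
exists (fun i => g (l i)) => m.
have -> : pre m (fun i => g (l i)) = l m by elim: m => // m IH; rewrite preS IH.
by elim: m => // m IH; apply: gP.
Qed.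

End Paths.

(** The prefixes shared by infinitely many [x m] form a tree, and finiteness of [L i] lets one of
    them always be prolonged. The alphabet depends on the level because the auxiliary integer
    sequences are only bounded coordinatewise. *)
Lemma konig (A : eqType) (x : nat -> nat -> A) (L : nat -> seq A) :
  (forall m i, (i < m)%N -> x m i \in L i) ->
  exists y, (forall i, y i \in L i) /\
    forall l M, exists2 m, (M <= m)%N & pre l (x m) = pre l y.
Proof.
move=> xL.
have [||y yP] := @path_builder A
    (fun u => forall M, exists2 m, (M <= m)%N & pre (size u) (x m) = u).
- by move=> M; exists M.
- move=> u Pu; apply: contrapT => H.
  have {}H (v : A) : exists M, forall m, (M <= m)%N -> pre (size u).+1 (x m) <> rcons u v.
    apply: contrapT => H'; apply: H; exists v => M; rewrite size_rcons.
    apply: contrapT => H''; apply: H'; exists M => m Mm e.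
    by apply: H''; exists m.
  have [M MP] := choice H.
  have [m + e] := Pu (maxn (size u).+1 (\max_(v <- L (size u)) M v)).
  rewrite geq_max => /andP[um Mm].
  apply: (MP (x m (size u)) m); last by rewrite preS e.
  by apply: leq_trans Mm; apply: (@leq_bigmax_seq _ _ xpredT M) => //; apply: xL.
exists y; split=> [i|l M].
  have [m im] := yP i.+1 i.+1; rewrite size_pre => /pre_eqP e.
  by rewrite -e//; apply: xL.
by have [m Mm e] := yP l M; exists m; rewrite // -[RHS]e size_pre.
Qed.

Definition covers (A : Type) (D : set (seq A)) (E : set (nat -> A)) :=
  forall y, E y -> exists m, D (pre m y).

Definition cyl (A : Type) (u : seq A) : set (nat -> A) :=
  [set y | pre (size u) y = u].

(* For [r = 2^-s], the [s]-dimensional dyadic net content by cylinders of level at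
   least [j]. *)
Definition content (R : realType) (A : choiceType) (r : R) (j : nat)
    (E : set (nat -> A)) : \bar R :=
  ereal_inf [set \esum_(u in D) (r ^+ size u)%:E | D in
    [set D : set (seq A) | (forall u, D u -> (j <= size u)%N) /\ covers D E]].

Section Content.
Context {R : realType} {A : choiceType}.
Variable r : R.
Hypothesis r0 : 0 <= r.
Local Open Scope ereal_scope.
Implicit Types (E F : set (nat -> A)) (D : set (seq A)) (u v : seq A).
Local Notation w u := ((r ^+ size u)%:E).

Let w0 u : 0 <= w u. Proof. by rewrite lee_fin exprn_ge0. Qed.

Lemma content_ge0 j E : 0 <= content r j E.
Proof. by apply: le_ereal_inf_tmp => _ [D _ <-]; apply: esum_ge0. Qed.

Lemma content_le j E D : (forall u, D u -> (j <= size u)%N) -> covers D E ->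
  content r j E <= \esum_(u in D) w u.
Proof. by move=> Dj DE; apply: ereal_inf_lbound; exists D. Qed.

Lemma content_lt j E x : content r j E < x -> exists D,
  [/\ forall u, D u -> (j <= size u)%N, covers D E & \esum_(u in D) w u < x].
Proof. by move=> /ereal_inf_lt[_ [D [Dj DE] <-] Dx]; exists D. Qed.

Lemma le_content j E F : E `<=` F -> content r j E <= content r j F.
Proof.
move=> EF; apply: le_ereal_inf_tmp => _ [D [Dj DF] <-].
by apply: content_le => // y /EF /DF.
Qed.

Lemma content_level i j E : (i <= j)%N -> content r i E <= content r j E.
Proof.
move=> ij; apply: le_ereal_inf_tmp => _ [D [Dj DF] <-].
by apply: content_le => // u /Dj; apply: leq_trans.
Qed.

Lemma content_set0 j : content r j (set0 : set (nat -> A)) = 0.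
Proof.
apply/eqP; rewrite eq_le content_ge0 andbT.
by apply: le_trans (@content_le j _ set0 _ _) _; rewrite ?esum_set0// => y [].
Qed.

Lemma content_bigcup j E (F : nat -> set (nat -> A)) : E `<=` \bigcup_k F k ->
  content r j E <= \sum_(k <oo) content r j (F k).
Proof.
move=> EF; apply: fin_approx_le => e e0.
have Foo0 k : 0 <= content r j (F k) by exact: content_ge0.
have [[k koo]|H] := pselect (exists k, content r j (F k) = +oo).
  rewrite (_ : \sum_(k <oo) _ = +oo) ?addye ?leey//.
  apply/eqP; rewrite -leye_eq -koo nneseries_esumT//.
  exact: (@esum_ge_term _ _ setT (fun k => content r j (F k)) k Logic.I).
apply: le_trans (epsilon_trick xpredT Foo0 (ltW e0)).
have /choice[D DP] (k : nat) : exists D : set (seq A),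
    [/\ forall u, D u -> (j <= size u)%N, covers D (F k) &
      \esum_(u in D) w u < content r j (F k) + (e / (2 ^ k.+1)%:R)%:E].
  apply: content_lt; rewrite lteDl ?lte_fin ?divr_gt0 ?ltr0n ?expn_gt0//.
  by rewrite ge0_fin_numE// ltey; apply/eqP => koo; apply: H; exists k.
apply: le_trans (@content_le _ _ (\bigcup_k D k) _ _) _.
- by move=> u [k _]; case: (DP k) => + _ _; apply.
- by move=> y /EF[k _ Fy]; have [_ /(_ _ Fy)[m Dm] _] := DP k; exists m, k.
apply: le_trans (esum_bigcup_le _ w0) _.
apply: lee_nneseries => [k _ _|k _]; first exact: esum_ge0.
by have [_ _ /ltW] := DP k.
Qed.

Lemma contentU j E F : content r j (E `|` F) <= content r j E + content r j F.
Proof.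
apply: le_trans (@content_bigcup j _
    (fun k => if k == 0 then E else if k == 1 then F else set0)%N _) _.
  by move=> y [Ey|Fy]; [exists 0%N|exists 1%N].
rewrite (@nneseries_split _ _ 0%N 2)//; last by move=> k _; exact: content_ge0.
rewrite eseries0 ?adde0; last first.
  by move=> [|[|k]]// _ _; rewrite content_set0.
by rewrite /index_iota/= !big_cons big_nil adde0.
Qed.

Lemma content_cyl j u E : E `<=` cyl u -> (j <= size u)%N -> content r j E <= w u.
Proof.
move=> Eu ju; rewrite -(@esum_set1 _ _ u (fun u => w u))//.
by apply: content_le => [v ->//|y /Eu yu]; exists (size u).
Qed.

(** A word of length at least [j] already decides its prefix of length [l], so any covering splits
    into two disjoint ones. This reverses subadditivity across cylinders of level at most [j]. *)
Lemma content_split l j E (P : set (seq A)) : (l <= j)%N ->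
  content r j (E `&` [set y | P (pre l y)]) + content r j (E `\` [set y | P (pre l y)])
  <= content r j E.
Proof.
move=> lj; apply: le_ereal_inf_tmp => _ [D [Dj DE] <-].
rewrite (esumID [set v | P (take l v)])//; apply: leeD; apply: content_le.
- by move=> u [/Dj].
- move=> y [/DE[m Dm] /= Py]; exists m; split=> //=.
  by rewrite take_pre// (leq_trans lj)// -(size_pre m y) Dj.
- by move=> u [/Dj].
- move=> y [/DE[m Dm] /= Py]; exists m; split=> //=.
  by rewrite take_pre// (leq_trans lj)// -(size_pre m y) Dj.
Qed.

Lemma content_sum_le l j E (s : seq (seq A)) : (l <= j)%N -> uniq s ->
  all (fun u => size u == l) s ->
  \sum_(u <- s) content r j (E `&` cyl u) <= content r j E.
Proof.
move=> lj; elim: s E => [|u s IH] E; first by rewrite big_nil content_ge0.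
rewrite big_cons /= => /andP[us us'] /andP[/eqP ul sl].
apply: le_trans (content_split E (fun v => v = u) lj).
apply: leeD; first by rewrite /cyl ul.
apply: le_trans (IH _ us' sl); rewrite big_seq [leRHS]big_seq.
apply: lee_sum => v vs; apply: le_content => y [Ey yv]; split => //; split=> //.
move: (allP sl _ vs) yv => /eqP vl; rewrite /cyl/= vl => yv yu.
by move: us; rewrite -yu yv vs.
Qed.

(** A covering either uses [u] itself, and pays its whole weight, or can do with strictly longer
    words. *)
Lemma content_step u E : E `<=` cyl u ->
  mine (w u) (content r (size u).+1 E) <= content r (size u) E.
Proof.
move=> Eu; apply: le_ereal_inf_tmp => _ [D [Dj DE] <-].
have [Du|Du] := pselect (D u).
  by rewrite ge_min (esum_ge_term (fun u => w u) Du).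
rewrite ge_min; apply/orP; right.
apply: le_trans (@content_le _ _ (D `&` [set v | (size u < size v)%N]) _ _) _.
- by move=> v [].
- move=> y Ey; have [m Dm] := DE _ Ey; exists m; split=> //=.
  rewrite size_pre ltn_neqAle -{2}(size_pre m y) Dj// andbT; apply/eqP => um.
  by apply: Du; rewrite -(Eu _ Ey) um.
- by apply: esum_le_subset => v [].
Qed.

(** A covering of cost below [r ^+ j] cannot contain a word shorter than [j]. *)
Lemma content_null_level j E : (0 < r)%R -> (r < 1)%R ->
  content r 0 E = 0 -> content r j E = 0.
Proof.
move=> rp r1 E0; apply/eqP; rewrite eq_le content_ge0 andbT.
apply: fin_approx_le => e e0; rewrite add0e.
have [D [_ DE De]] : exists D, [/\ forall u, D u -> (0 <= size u)%N, covers D E &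
    \esum_(u in D) w u < (Num.min e (r ^+ j))%:E].
  by apply: content_lt; rewrite E0 lte_fin lt_min e0 exprn_gt0.
have Dj u : D u -> (j <= size u)%N.
  move=> Du; rewrite leqNgt; apply/negP => uj.
  have := le_lt_trans (esum_ge_term (fun u => w u) Du) De.
  rewrite lte_fin lt_min => /andP[_]; apply/negP; rewrite -leNgt.
  by apply: ler_wiXn2l; [exact: ltW|exact: ltW|exact: ltnW].
apply: le_trans (content_le Dj DE) _; apply: le_trans (ltW De) _.
by rewrite lee_fin ge_min lexx.
Qed.

End Content.

(** * Coverings depending measurably on a parameter *)

Section FamilyContent.
Context {R : realType} {d : measure_display} {X : measurableType d} {A : choiceType}.
Variables (mu : {measure set X -> \bar R}) (r : R).
Hypothesis r0 : 0 <= r.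
Local Open Scope ereal_scope.
Implicit Types (F : seq A -> set X) (E : X -> set (nat -> A)).

(* A family [F] encodes a covering depending on a parameter [x]: the cylinder of [u] is
   used exactly when [F u x]. The cost is the integral over [x] of the sums. *)
Definition cost F : \bar R := \esum_(u in [set: seq A]) ((r ^+ size u)%:E * mu (F u)).

Definition is_family (j : nat) F :=
  (forall u, measurable (F u)) /\ (forall u, (size u < j)%N -> F u = set0).

Definition fcovers F E := forall x y, E x y -> exists m, F (pre m y) x.

Definition fcontent j E : \bar R :=
  ereal_inf [set cost F | F in [set F | is_family j F /\ fcovers F E]].

Let term_ge0 F u : 0 <= (r ^+ size u)%:E * mu (F u).
Proof. by rewrite mule_ge0// lee_fin exprn_ge0. Qed.

Lemma cost_ge0 F : 0 <= cost F.
Proof. by apply: esum_ge0. Qed.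

Lemma fcontent_ge0 j E : 0 <= fcontent j E.
Proof. by apply: le_ereal_inf_tmp => _ [F _ <-]; exact: cost_ge0. Qed.

Lemma fcontent_le j E F : is_family j F -> fcovers F E -> fcontent j E <= cost F.
Proof. by move=> Fj FE; apply: ereal_inf_lbound; exists F. Qed.

Lemma fcontent_lt j E x : fcontent j E < x ->
  exists F, [/\ is_family j F, fcovers F E & cost F < x].
Proof. by move=> /ereal_inf_lt[_ [F [Fj FE] <-] Fx]; exists F. Qed.

Lemma le_fcontent j E E' : (forall x, E x `<=` E' x) -> fcontent j E <= fcontent j E'.
Proof.
move=> EE'; apply: le_ereal_inf_tmp => _ [F [Fj FE] <-].
by apply: fcontent_le => // x y /EE' /FE.
Qed.

Definition above F u := \bigcup_(i in [set i | (i < size u)%N]) F (take i u).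

Definition reduced F := forall u x, F u x -> ~ above F u x.

(** For a fixed [x], [join] keeps the outermost cylinders of the two coverings, and [meet] the
    cylinders of each that lie inside, or coincide with, one of the other. For reduced families
    these describe the union and the intersection of the covered sets of paths. *)
Definition join F G u := (F u `|` G u) `\` (above F u `|` above G u).

Definition meet F G u :=
  (F u `&` above G u) `|` (G u `&` above F u) `|`
  ((F u `\` above G u) `&` (G u `\` above F u)).

Lemma above_measurable F u : (forall u, measurable (F u)) -> measurable (above F u).
Proof. by move=> mF; apply: bigcup_measurable. Qed.

Lemma join_family j F G : is_family j F -> is_family j G -> is_family j (join F G).
Proof.
move=> [mF F0] [mG G0]; split=> u; last by move=> uj; rewrite /join F0// G0// setU0 set0D.
by apply: measurableD; apply: measurableU => //; apply: above_measurable.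
Qed.

Lemma meet_family j F G : is_family j F -> is_family j G -> is_family j (meet F G).
Proof.
move=> [mF F0] [mG G0]; split=> u; last first.
  by move=> uj; rewrite /meet F0// G0// !set0I !set0D !setI0 !setU0.
have mFa := above_measurable u mF; have mGa := above_measurable u mG.
apply: measurableU; first by apply: measurableU; apply: measurableI.
by apply: measurableI; apply: measurableD.
Qed.

Lemma join_reduced F G : reduced (join F G).
Proof.
move=> u x [_ H] [i /= iu [FG _]]; apply: H.
by case: FG => [Fx|Gx]; [left|right]; exists i.
Qed.

(* The join contains the shortest prefix at which one of the families is entered. *)
Lemma join_first F G x y m : (F (pre m y) `|` G (pre m y)) x ->
  exists2 m', (m' <= m)%N & join F G (pre m' y) x.
Proof.
move=> FGm; pose P k := `[< (F (pre k y) `|` G (pre k y)) x >].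
have exP : exists k, P k by exists m; apply/asboolP.
case: (ex_minnP exP) => k /asboolP Pk kmin; exists k.
  by apply: kmin; apply/asboolP.
have no i : (i < k)%N -> ~ (F (take i (pre k y)) `|` G (take i (pre k y))) x.
  move=> ik; rewrite take_pre 1?ltnW// => H.
  by have := kmin i; rewrite /P (asboolT H) leqNgt ik => /(_ isT).
split=> //; rewrite /above /= size_pre => -[] [i /= ik H]; apply: (no i) => //.
  by left.
by right.
Qed.

Lemma join_covers F G E E' : fcovers F E -> fcovers G E' ->
  fcovers (join F G) (fun x => E x `|` E' x).
Proof.
move=> FE GE x y [/FE|/GE] [m Fm].
  by have [m' _ ?] := @join_first F G x y m (or_introl Fm); exists m'.
by have [m' _ ?] := @join_first F G x y m (or_intror Fm); exists m'.
Qed.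

Lemma meet_covers F G E : reduced F -> reduced G -> fcovers F E -> fcovers G E ->
  fcovers (meet F G) E.
Proof.
move=> rF rG FE GE x y Exy; have [m Fm] := FE _ _ Exy; have [m' Gm] := GE _ _ Exy.
have [mm|mm|mm] := ltngtP m m'.
- exists m'; left; right; split=> //; exists m; rewrite /= ?size_pre//.
  by rewrite take_pre// ltnW.
- exists m; left; left; split=> //; exists m'; rewrite /= ?size_pre//.
  by rewrite take_pre// ltnW.
- subst m'; have [aF|aF] := pselect (above F (pre m y) x); first by exists m; left; right.
  have [aG|aG] := pselect (above G (pre m y) x); first by exists m; left; left.
  by exists m; right.
Qed.

Lemma measure_strong_additive (P Q : set X) : measurable P -> measurable Q ->
  mu (P `|` Q) + mu (P `&` Q) = mu P + mu Q.
Proof.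
move=> mP mQ; have -> : P `|` Q = P `|` (Q `\` P) by rewrite setDE setUIr setUv setIT.
rewrite measureU//; [|exact: measurableD|by rewrite setDE setICA setICr setI0].
by rewrite -addeA; congr (_ + _); rewrite setIC -measureDI.
Qed.

(* Strong subadditivity, cube by cube. *)
Lemma measure_join_meet j F G u : is_family j F -> is_family j G ->
  reduced F -> reduced G ->
  mu (join F G u) + mu (meet F G u) <= mu (F u) + mu (G u).
Proof.
move=> [mF _] [mG _] rF rG.
have mFa := above_measurable u mF; have mGa := above_measurable u mG.
have -> : join F G u = (F u `\` above G u) `|` (G u `\` above F u).
  apply/seteqP; split=> x.
    by move=> [[Fx|Gx] H]; [left|right]; split=> // ?; apply: H; [right|left].
  move=> [[Fx aG]|[Gx aF]]; split; [by left| |by right|] => -[]//.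
    exact: rF Fx.
  exact: rG Gx.
apply: (@le_trans _ _ (mu (F u `\` above G u `|` G u `\` above F u) +
  ((mu (F u `&` above G u) + mu (G u `&` above F u)) +
  mu ((F u `\` above G u) `&` (G u `\` above F u))))).
  apply: leeD => //; apply: le_trans (measureU2 _ _ _) _; last apply: leeD => //.
  - by apply: measurableU; apply: measurableI.
  - by apply: measurableI; apply: measurableD.
  - by apply: measureU2; apply: measurableI.
rewrite [X in _ + X]addeC addeA measure_strong_additive; [|exact: measurableD..].
rewrite (measureDI mu (mF u) mGa) (measureDI mu (mG u) mFa).
by rewrite addeACA.
Qed.

Lemma cost_join_meet j F G : is_family j F -> is_family j G ->
  reduced F -> reduced G -> cost (join F G) + cost (meet F G) <= cost F + cost G.
Proof.
move=> fF fG rF rG; rewrite /cost -!esumD//; apply: le_esum => u _.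
rewrite -!ge0_muleDr//; apply: lee_wpmul2l; first by rewrite lee_fin exprn_ge0.
exact: measure_join_meet fF fG rF rG.
Qed.

Lemma cost_le F G : (forall u, mu (F u) <= mu (G u)) -> cost F <= cost G.
Proof.
move=> FG; apply: le_esum => u _; apply: lee_wpmul2l => //.
by rewrite lee_fin exprn_ge0.
Qed.

Lemma fcontent_lt_reduced j E x : fcontent j E < x ->
  exists F, [/\ is_family j F, reduced F, fcovers F E & cost F < x].
Proof.
(* Joining [F] with itself drops the words below an already used one, at no extra cost. *)
move=> /fcontent_lt[F [fF FE Fx]]; exists (join F F); split.
- exact: join_family.
- exact: join_reduced.
- by move=> z y Ezy; apply: (join_covers FE FE); left.
- apply: le_lt_trans Fx; apply: cost_le => u.
  have mu_ := above_measurable u fF.1.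
  rewrite /join !setUid; apply: le_measure; rewrite ?inE; last exact: subDsetl.
    by apply: measurableD => //; exact: fF.1.
  exact: fF.1.
Qed.

End FamilyContent.

Section Increasing.
Context {R : realType} {d : measure_display} {X : measurableType d} {A : choiceType}.
Variables (mu : {measure set X -> \bar R}) (r : R).
Hypothesis r0 : 0 <= r.
Local Open Scope ereal_scope.
Implicit Types (F : seq A -> set X) (E : nat -> X -> set (nat -> A)).

(** Continuity from below of a strongly subadditive capacity: nearly optimal coverings of the [E i]
    are joined one after another, and the cost of the joins exceeds the optimum only by the
    accumulated errors. The limit covering [V] uses the words that are eventually always used. *)
Lemma fcontent_bigcup E j (a : R) : (forall i x, E i x `<=` E i.+1 x) ->
  (forall i, fcontent mu r j (E i) <= a%:E) ->
  fcontent mu r j (fun x => \bigcup_i E i x) <= a%:E.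
Proof.
move=> Einc Ea; apply: fin_approx_le => e e0.
pose c i := fcontent mu r j (E i).
have c0 i : 0 <= c i by exact: fcontent_ge0.
have cfin i : c i \is a fin_num by rewrite ge0_fin_numE// (le_lt_trans (Ea i))// ltry.
pose ei i : R := (e / (2 ^ i.+1)%:R)%R.
have ei0 i : (0 < ei i)%R by rewrite divr_gt0// ltr0n expn_gt0.
have /choice[F FP] (i : nat) : exists F : seq A -> set X,
    [/\ is_family j F, reduced F, fcovers F (E i) & cost mu r F < c i + (ei i)%:E].
  by apply: fcontent_lt_reduced => //; rewrite -/(c i) lteDl ?lte_fin.
pose W := fix W i := if i is i'.+1 then join (W i') (F i) else F 0%N.
have Wfam i : is_family j (W i).
  elim: i => [|i IH] /=; first by have [] := FP 0%N.
  by apply: join_family => //; have [] := FP i.+1.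
have Wred i : reduced (W i).
  case: i => [|i]; first by have [] := FP 0%N.
  exact: join_reduced.
have Wcov i : fcovers (W i) (E i).
  elim: i => [|i IH]; first by have [] := FP 0%N.
  have [_ _ Fc _] := FP i.+1 => x y Exy.
  by apply: (join_covers IH Fc); right.
(* The errors [ei l] for [l <= i] add up to [e - ei i]. The meet of [W i] with [F i.+1] covers
   [E i], so it costs at least [c i], which can be cancelled. *)
have Wcost i : cost mu r (W i) <= c i + (e - ei i)%:E.
  elim: i => [|i IH].
    have [_ _ _ /ltW F0] := FP 0%N; apply: le_trans F0 _; apply: leeD => //.
    have : (ei 0%N + ei 0%N = e)%R by rewrite /ei expn1; field.
    by rewrite lee_fin; lra.
  have [fF rF cF /ltW Fc] := FP i.+1.
  have := cost_join_meet mu r0 (Wfam i) fF (Wred i) rF.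
  have mc : fcovers (meet (W i) (F i.+1)) (E i).
    by apply: meet_covers => // x y /Einc; apply: cF.
  have cm := fcontent_le mu r (meet_family (Wfam i) fF) mc.
  move=> /(le_trans (leeD (lexx _) cm)) /le_trans/(_ (leeD IH Fc)) H.
  rewrite -(leeD2rE _ _ (cfin i)); apply: le_trans H _.
  rewrite -(fineK (cfin i)) -(fineK (cfin i.+1)) -!EFinD lee_fin.
  suff : (ei i = ei i.+1 + ei i.+1)%R by lra.
  by rewrite /ei (expnS 2 i.+1) natrM; field; rewrite pnatr_eq0 expn_eq0.
(* Along a path, the level at which the families are entered can only decrease. *)
pose V u := \bigcup_i \bigcap_(l in [set l | (i <= l)%N]) W l u.
have Vi_meas i u : measurable (\bigcap_(l in [set l | (i <= l)%N]) W l u).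
  by apply: bigcap_measurableType => l _; case: (Wfam l).
have Vfam : is_family j V.
  split=> u; first by apply: bigcup_measurable.
  move=> uj; rewrite -subset0 => x [i _ /(_ i (leqnn i))].
  by have [_ ->] := Wfam i.
have Vcov : fcovers V (fun x => \bigcup_i E i x).
  move=> x y [i _ Exy].
  have Einc' l : (i <= l)%N -> E l x y.
    elim: l => [|l IH]; first by rewrite leqn0 => /eqP i0; rewrite -i0.
    by rewrite leq_eqVlt => /orP[/eqP <-//|/IH]; exact: Einc.
  pose P m := `[< exists2 l, (i <= l)%N & W l (pre m y) x >].
  have exP : exists m, P m.
    by have [m Wm] := Wcov i _ _ Exy; exists m; apply/asboolP; exists i.
  case: (ex_minnP exP) => m /asboolP[l il Wl] mmin; exists m, l => //.
  elim=> [|k IH] /=; first by rewrite leqn0 => /eqP l0; move: Wl; rewrite l0.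
  rewrite leq_eqVlt => /orP[/eqP lk|lk]; first by move: Wl; rewrite lk.
  have Wk : W k (pre m y) x by apply: IH; rewrite /= -ltnS.
  have [m' mm' Wm'] := @join_first _ _ _ (W k) (F k.+1) x y m (or_introl Wk).
  have : (m <= m')%N.
    by apply: mmin; apply/asboolP; exists k.+1 => //; rewrite (leq_trans il)// ltnW.
  by move=> m'm; have -> : m = m' by apply/eqP; rewrite eqn_leq mm' m'm.
apply: le_trans (fcontent_le mu r Vfam Vcov) _.
(* The cost is a supremum over finite sets of words, on which the limit in [i] is taken term by
   term. *)
apply: ge_ereal_sup => _ [D [finD _] <-].
rewrite fsbig_finite//=; set s := finmap.enum_fset (fset_set D).
have cv : \sum_(u <- s) ((r ^+ size u)%:E *
    mu (\bigcap_(l in [set l | (i <= l)%N]) W l u)) @[i --> \oo] -->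
    \sum_(u <- s) ((r ^+ size u)%:E * mu (V u)).
  apply: cvg_nnesum => u _.
    by apply: nearW => i; rewrite mule_ge0// lee_fin exprn_ge0.
  apply: cvgeZl => //; apply: nondecreasing_cvg_mu.
  - by move=> i; exact: Vi_meas.
  - exact: (Vfam.1 u).
  move=> i i' ii'; apply/subsetPset => x H l /= i'l; apply: H => /=.
  exact: leq_trans i'l.
apply: cvge_le cv; apply: nearW => i.
apply: (@le_trans _ _ (cost mu r (W i))).
  apply: (@le_trans _ _ (\sum_(u <- s) ((r ^+ size u)%:E * mu (W i u)))).
    apply: lee_sum => u _; apply: lee_wpmul2l; first by rewrite lee_fin exprn_ge0.
    apply: le_measure; rewrite ?inE//; first by case: (Wfam i).
    by move=> x /(_ i (leqnn i)).
  apply: esum_ge; exists D; first by split.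
  by rewrite fsbig_finite.
apply: le_trans (Wcost i) _; apply: leeD; first exact: Ea.
by rewrite lee_fin; have := ei0 i; lra.
Qed.

End Increasing.

(** * Capacitability of Suslin sets *)

Definition closed_paths (A : Type) (K : set (nat -> A)) :=
  forall y, (forall m, exists2 y', K y' & pre m y' = pre m y) -> K y.

(** Closedness in the product of the paths with the Baire space of integer sequences, in terms of
    prefixes. *)
Definition closed_rel (A : Type) (C : (nat -> A) -> (nat -> nat) -> Prop) :=
  forall z s, (forall m, exists z' s', [/\ C z' s', pre m z' = pre m z &
    pre m s' = pre m s]) -> C z s.

Definition pairf (A B : Type) (f : nat -> A) (g : nat -> B) : nat -> A * B :=
  fun i => (f i, g i).

Lemma pre_pairf (A B : Type) m (f f' : nat -> A) (g g' : nat -> B) :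
  pre m (pairf f g) = pre m (pairf f' g') <->
  pre m f = pre m f' /\ pre m g = pre m g'.
Proof.
split=> [/pre_eqP e|[/pre_eqP ef /pre_eqP eg]]; last first.
  by apply/pre_eqP => i im; rewrite /pairf ef// eg.
by split; apply/pre_eqP => i /e[].
Qed.

Section Cylinders.
Context {d : measure_display} {X : measurableType d} {A : finType}.
Variable crd : X -> nat -> A.
Hypothesis mcrd : forall u, measurable [set x | pre (size u) (crd x) = u].

Lemma measurable_pre m (P : seq A -> Prop) : measurable [set x | P (pre m (crd x))].
Proof.
have -> : [set x | P (pre m (crd x))] =
    \bigcup_(t in [set t : m.-tuple A | P t]) [set x | pre m (crd x) = t].
  apply/seteqP; split=> x /=; last by move=> [t /= Pt ->].
  move=> Px; have sx : size (pre m (crd x)) == m by rewrite size_pre.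
  by exists (Tuple sx).
apply: fin_bigcup_measurable => // t _.
by have := mcrd t; rewrite size_tuple.
Qed.

Lemma sum_measure_pre (R : realType) (mu : {measure set X -> \bar R}) m :
  (\sum_(t : m.-tuple A) mu [set x | pre m (crd x) = t] = mu setT)%E.
Proof.
have -> : [set: X] = \bigcup_(t in [set: m.-tuple A]) [set x | pre m (crd x) = t].
  apply/seteqP; split=> x //= _.
  have sx : size (pre m (crd x)) == m by rewrite size_pre.
  by exists (Tuple sx).
rewrite measure_fin_bigcup; [|exact: finite_finset| |].
- by rewrite bigfs ?index_enum_uniq ?set_true// => i _; rewrite mem_index_enum.
- by move=> t t' _ _ [x [/= -> /val_inj]].
- by move=> t _; have := mcrd t; rewrite size_tuple.
Qed.

End Cylinders.

Section UniformCover.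
Context {R : realType} {d : measure_display} {X : measurableType d} {A B : finType}.
Variables (mu : {measure set X -> \bar R}) (r : R) (crd : X -> nat -> A).
Hypothesis r0 : 0 < r.
Hypothesis r1 : r < 1.
Hypothesis mufin : (mu setT < +oo)%E.
Hypothesis mcrd : forall u, measurable [set x | pre (size u) (crd x) = u].
Variable C : (nat -> A * B) -> (nat -> nat) -> Prop.
Hypothesis closedC : closed_rel C.
Local Open Scope ereal_scope.

Definition bounded_slice (b : nat -> nat) (x : X) : set (nat -> B) :=
  [set y | exists s, (forall i, (s i <= b i)%N) /\ C (pairf (crd x) y) s].

(** Only the first [size l] integers are bounded: the empty list gives the whole slice, and a
    growing further bound exhausts it. These are the increasing sequences of Choquet's argument,
    with the compact [bounded_slice] at the end. *)
Definition prefix_bounded_slice (l : seq nat) (x : X) : set (nat -> B) :=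
  [set y | exists s, (forall i, (i < size l)%N -> (s i <= nth 0 l i)%N) /\
    C (pairf (crd x) y) s].

Definition covered_slices j (e : R) (l : seq nat) (p : seq A) (s : seq (seq B)) :=
  [/\ all (fun u => j <= size u)%N s, (\sum_(u <- s) r ^+ size u <= e)%R &
    forall x y, pre (size p) (crd x) = p -> prefix_bounded_slice l x y ->
      exists2 u, u \in s & pre (size u) y = u].

(* Compactness of the bounded slices, in both variables. *)
Lemma covered_slices_exist j (e : R) b x : (0 < e)%R ->
  content r 0 (bounded_slice b x) = 0 ->
  exists m s, covered_slices j e (pre m b) (pre m (crd x)) s.
Proof.
move=> e0 /(content_null_level (ltW r0) j r0 r1) cj.
have [D [Dj DK De]] : exists D, [/\ forall u, D u -> (j <= size u)%N,
    covers D (bounded_slice b x) & \esum_(u in D) (r ^+ size u)%:E < e%:E].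
  by apply: content_lt; rewrite cj lte_fin.
(* The words of [D] with code below [m]: finite lists that exhaust [D]. Counterexamples for every
   [m] would accumulate at a path of the bounded slice covered by no word of [D]. *)
pose s m := [seq u <- pmap pickle_inv (iota 0 m) | `[< D u >]] : seq (seq B).
have us m : uniq (s m).
  by apply: filter_uniq; apply: (pmap_uniq (@pickle_invK _)); apply: iota_uniq.
have sD m u : u \in s m -> D u by rewrite mem_filter => /andP[/asboolP].
apply: contrapT => H.
have {}H m : exists z : X * (nat -> B), [/\ pre m (crd z.1) = pre m (crd x),
    prefix_bounded_slice (pre m b) z.1 z.2 &
    forall u, u \in s m -> pre (size u) z.2 <> u].
  apply: contrapT => H'; apply: H; exists m, (s m); split.
  - by apply/allP => u /sD /Dj.
  - rewrite -lee_fin; apply: le_trans (ltW De).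
    rewrite -sumEFin; apply: esum_ge; exists [set` s m].
      by split=> [|u /= /sD//]; exact: finite_seq.
    by rewrite -fsbig_seq.
  - move=> x' y; rewrite size_pre => xx' Hy; apply: contrapT => H''; apply: H'.
    by exists (x', y); split=> // u us' yu; apply: H''; exists u.
have [z zP] := choice H.
have /choice[sg sgP] (m : nat) : exists sg : nat -> nat,
    (forall i, (i < m)%N -> (sg i <= b i)%N) /\ C (pairf (crd (z m).1) (z m).2) sg.
  have [_ [sg [sgb Csg]] _] := zP m; exists sg; split=> // i im.
  by have := sgb i; rewrite size_pre nth_mkseq//; apply.
pose L i := [seq (a, v) | a <- enum B, v <- iota 0 (b i).+1].
have [|y [yL yP]] := @konig _ (fun m => pairf (z m).2 (sg m)) L.
  move=> m i im; apply/allpairsP; exists ((z m).2 i, sg m i); split; [by rewrite mem_enum| |by []].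
  by rewrite mem_iota add0n ltnS; apply: (sgP m).1.
pose y1 i := (y i).1; pose y2 i := (y i).2.
have yE : y = pairf y1 y2 by apply/funext => i; rewrite /pairf -surjective_pairing.
have Ky : bounded_slice b x y1.
  exists y2; split=> [i|].
    have /allpairsP[[a v] [_ + yi]] := yL i.
    by rewrite mem_iota add0n ltnS /y2 yi.
  apply: closedC => m; have [m' mm'] := yP m m; rewrite yE => /pre_pairf[e1 e2].
  exists (pairf (crd (z m').1) (z m').2), (sg m'); split=> //.
    exact: (sgP m').2.
  apply/pre_pairf; split=> //.
  by have [/(pre_eq_le mm')] := zP m'.
have [k Dk] := DK _ Ky.
have [m] := yP k (pickle (pre k y1)).+1; rewrite yE => mk /pre_pairf[e1 _].
have [_ _ /(_ (pre k y1))] := zP m; apply; last by rewrite size_pre.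
rewrite mem_filter asboolT//= mem_pmap; apply/mapP; exists (pickle (pre k y1)).
  by rewrite mem_iota.
by rewrite pickleK_inv.
Qed.

(** Parameters with a good prefix use the finite list attached to it, the others use all words of
    length [j]. *)
Lemma fcontent_covered_slices j (e : R) m l (Q : seq A -> Prop) :
  (0 <= e)%R -> (forall p, Q p -> exists s, covered_slices j e l p s) ->
  fcontent mu r j (prefix_bounded_slice l) <=
    e%:E * mu setT + mu [set x | ~ Q (pre m (crd x))] * (#|{: j.-tuple B}|%:R)%:E.
Proof.
move=> e0 Qs.
have /choice[G GP] (p : seq A) : exists s, Q p -> covered_slices j e l p s.
  by have [/Qs[s]|] := pselect (Q p); [exists s|exists [::]].
pose bad := [set x | ~ Q (pre m (crd x))].
have mbad : measurable bad by exact: (measurable_pre mcrd m (fun p => ~ Q p)).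
pose good u := [set x | Q (pre m (crd x)) /\ u \in G (pre m (crd x))].
have mgood u : measurable (good u).
  exact: (measurable_pre mcrd m (fun p => Q p /\ u \in G p)).
(* A word weighs at most 1, whence the factor [#|{: j.-tuple B}|]; it depends on [j] only and is
   beaten by a small measure of the bad set. *)
pose F u := good u `|` (if size u == j then bad else set0).
have FE : fcovers F (prefix_bounded_slice l).
  move=> x y Hy; have [Qx|Qx] := pselect (Q (pre m (crd x))).
    have [_ _ /(_ x y)] := GP _ Qx; rewrite size_pre => /(_ erefl Hy)[u uG yu].
    by exists (size u); left; split=> //; rewrite yu.
  by exists j; right; rewrite size_pre eqxx.
have Ffam : is_family j F.
  split=> u; first by apply: measurableU => //; case: ifP.
  move=> uj; rewrite -subset0 => x [[Qx]|]; last by rewrite (ltn_eqF uj).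
  by have [/allP H _ _] := GP _ Qx => /H; rewrite leqNgt uj.
apply: le_trans (fcontent_le mu r Ffam FE) _.
have w0 (u : seq B) : 0 <= (r ^+ size u)%:E :> \bar R by rewrite lee_fin exprn_ge0// ltW.
pose c (t : m.-tuple A) := mu [set x | pre m (crd x) = t].
have c0 t : 0 <= c t by exact: measure_ge0.
have bad0 : 0 <= mu bad by exact: measure_ge0.
pose g (t : m.-tuple A) := if `[< Q t >] then G t else [::].
apply: (@le_trans _ _ (\esum_(u in [set: seq B])
   (\sum_(t : m.-tuple A) (if u \in g t then (r ^+ size u)%:E * c t else 0) +
    (if size u == j then mu bad else 0)))).
  apply: le_esum => u _.
  apply: (@le_trans _ _ ((r ^+ size u)%:E * (mu (good u) +
      mu (if size u == j then bad else set0)))).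
    apply: lee_wpmul2l => //; apply: measureU2 => //.
    by case: ifP.
  rewrite ge0_muleDr//; apply: leeD; last first.
    case: ifP => _; last by rewrite measure0 mule0.
    by rewrite -[leRHS]mul1e; apply: lee_wpmul2r => //; rewrite lee_fin exprn_ile1// ltW.
  have -> : good u = \bigcup_(t in [set t : m.-tuple A | u \in g t])
      [set x | pre m (crd x) = t].
    apply/seteqP; split=> x /=.
      move=> [Qx Gx]; have sx : size (pre m (crd x)) == m by rewrite size_pre.
      by exists (Tuple sx); rewrite //= /g/= asboolT.
    by move=> [t /=]; rewrite /g; case: asboolP => // Qt Gt e'; rewrite /good/= e'.
  rewrite measure_fin_bigcup; [|exact: finite_finset| |].
  - rewrite ge0_mule_fsumr// fsbig_mkcond [leRHS]bigfs ?index_enum_uniq//; last first.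
      by move=> i _; rewrite mem_index_enum.
    rewrite set_true le_eqVlt; apply/orP; left;
    apply/eqP/eq_fsbigr => t _; rewrite /patch /=.
    by congr (if _ then _ else _); apply/idP/idP; rewrite inE.
  - by move=> t t' _ _ [x [/= -> /val_inj]].
  - by move=> t _; have := mcrd t; rewrite size_tuple.
rewrite esumD//; last 2 first.
- by move=> u _; apply: sume_ge0 => t _; case: ifP => // _; rewrite mule_ge0.
- by move=> u _; case: ifP.
apply: leeD.
  rewrite esum_sum; last by move=> u t _ _; case: ifP => // _; rewrite mule_ge0.
  rewrite -(sum_measure_pre mcrd mu m) ge0_sume_distrr//; apply: lee_sum => t _.
  have wc (u : seq B) : 0 <= (r ^+ size u)%:E * c t by rewrite mule_ge0.
  apply: le_trans (esum_cond_le (s := g t) wc _) _ => //.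
  rewrite -ge0_sume_distrl//; apply: lee_wpmul2r => //.
  rewrite sumEFin lee_fin /g; case: asboolP => [Qt|_]; last by rewrite big_nil.
  by have [] := GP _ Qt.
apply: le_trans (esum_cond_le (s := map val (enum {: j.-tuple B})) _ _) _.
- by move=> _; exact: measure_ge0.
- move=> u uj; apply/mapP; exists (Tuple uj) => //.
  by rewrite mem_enum.
- rewrite big_map big_enum /= -/bad.
  have badfin : mu bad \is a fin_num.
    by rewrite ge0_fin_numE// (le_lt_trans _ mufin)// le_measure ?inE.
  by rewrite -(fineK badfin) sumEFin sumr_const -EFinM mulr_natr.
Qed.

(** If the content exceeded [a], continuity along increasing sequences would give bounds [b] one
    integer at a time, keeping it above [a] at every stage. But the slices bounded by all of [b] are
    almost surely null, and by compactness all parameters outside a set of small measure are cheaply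
    covered at a finite stage. *)
Lemma fcontent_eq0 j :
  (forall b, mu.-negligible [set x | content r 0 (bounded_slice b x) <> 0]) ->
  fcontent mu r j (fun x => [set y | exists s, C (pairf (crd x) y) s]) = 0.
Proof.
move=> neg; apply/eqP; rewrite eq_le (fcontent_ge0 mu (ltW r0)) andbT.
have -> : (fun x => [set y | exists s, C (pairf (crd x) y) s]) = prefix_bounded_slice [::].
  apply/funext => x; apply/seteqP; split=> y [s]; first by exists s.
  by move=> [_]; exists s.
apply: fin_approx_le => a a0; rewrite add0e; apply: contrapT => Ha.
have [b bP] : exists b : nat -> nat, forall m,
    ~ (fcontent mu r j (prefix_bounded_slice (pre m b)) <= a%:E).
  apply: (@path_builder _ (fun l => ~ (fcontent mu r j (prefix_bounded_slice l) <= a%:E))) => // l Hl;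
    apply: contrapT => H; apply: Hl.
  have {}H v : fcontent mu r j (prefix_bounded_slice (rcons l v)) <= a%:E.
    by apply: contrapT => H'; apply: H; exists v.
  apply: le_trans (fcontent_bigcup (ltW r0)
    (E := fun v => prefix_bounded_slice (rcons l v)) _ H).
    apply: le_fcontent => x y [s [sl Cs]]; exists (s (size l)) => //.
    exists s; split=> // i; rewrite size_rcons ltnS leq_eqVlt => /orP[/eqP ->|il].
      by rewrite nth_rcons ltnn eqxx.
    by rewrite nth_rcons il; apply: sl.
  move=> v x y [s [sl Cs]]; exists s; split=> // i il.
  have := sl i; rewrite !size_rcons in il *; move=> /(_ il)/leq_trans; apply.
  by rewrite !nth_rcons; case: ifP => // _; case: ifP.
have mfin : mu setT \is a fin_num by rewrite ge0_fin_numE.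
pose M := fine (mu setT); have M0 : (0 <= M)%R by rewrite fine_ge0.
pose N : R := #|{: j.-tuple B}|%:R.
have N0 : (0 <= N)%R by rewrite ler0n.
(* Good and bad parameters get half of [a] each; the [+ 1] keeps the denominators positive. *)
pose e : R := (a / (2 * (M + 1)))%R.
have e0 : (0 < e)%R by rewrite divr_gt0// mulr_gt0// ltr_wpDl.
pose e' : R := (a / (2 * (N + 1)))%R.
have e'0 : (0 < e')%R by rewrite divr_gt0// mulr_gt0// ltr_wpDl.
pose Q m (p : seq A) := exists s, covered_slices j e (pre m b) p s.
pose bad m := [set x | ~ Q m (pre m (crd x))].
have mbad m : measurable (bad m) by exact: (measurable_pre mcrd m (fun p => ~ Q m p)).
have bad_dec : nonincreasing_seq bad.
  move=> m m' mm'; apply/subsetPset => x H [s [s1 s2 s3]]; apply: H.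
  exists s; split=> // x' y; rewrite size_pre => /(pre_eq_le mm') xx' [sg [sgb Csg]].
  apply: (s3 x' y); first by rewrite size_pre.
  exists sg; split=> // i; rewrite size_pre => im.
  have := sgb i; rewrite size_pre !nth_mkseq//; last exact: leq_trans mm'.
  by apply; apply: leq_trans mm'.
have bad0 : mu (\bigcap_m bad m) = 0.
  apply/negligibleP; first exact: bigcapT_measurable.
  apply: negligibleS (neg b) => x H /(covered_slices_exist j e0)[m [s ms]].
  by apply: (H m I); exists s.
have := nonincreasing_cvg_mu (mu := mu) _ mbad (bigcapT_measurable mbad) bad_dec.
rewrite bad0 => /(_ (le_lt_trans (le_measure mu _ _ (@subsetT _ _)) mufin)).
rewrite !inE => /(_ (mbad _) measurableT) cv.
have [m mlt] : exists m, mu (bad m) < e'%:E.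
  apply: contrapT => H; suff : e'%:E <= (0 : \bar R) by rewrite lee_fin leNgt e'0.
  apply: cvge_ge cv; apply: nearW => m; rewrite leNgt; apply/negP => me.
  by apply: H; exists m.
apply: (bP m); apply: le_trans (@fcontent_covered_slices j e m _ (Q m) (ltW e0) _) _.
  by move=> p.
apply: (@le_trans _ _ (e%:E * M%:E + e'%:E * N%:E)).
  apply: leeD; first by rewrite fineK.
  by apply: lee_wpmul2r; rewrite ?lee_fin// ltW.
rewrite -!EFinM -EFinD lee_fin /e /e'.
have : (a / (2 * (M + 1)) * M <= a / 2)%R.
  rewrite invfM mulrA -[leRHS]mulr1 -mulrA; apply: ler_wpM2l; first by rewrite divr_ge0// ltW.
  by rewrite mulrC ler_pdivrMr ?ltr_wpDl// mul1r lerDl.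
have : (a / (2 * (N + 1)) * N <= a / 2)%R.
  rewrite invfM mulrA -[leRHS]mulr1 -mulrA; apply: ler_wpM2l; first by rewrite divr_ge0// ltW.
  by rewrite mulrC ler_pdivrMr ?ltr_wpDl// mul1r lerDl.
lra.
Qed.

End UniformCover.

(** * Suslin sets as projections of closed sets along integer sequences *)

Definition suslin (A : Type) (E : set (nat -> A)) :=
  exists C, closed_rel C /\ E = [set z | exists s, C z s].

Section Suslin.
Context {A : Type}.
Implicit Types (E : set (nat -> A)) (K : set (nat -> A)).

Lemma closed_suslin K : closed_paths K -> suslin K.
Proof.
move=> cK; exists (fun z _ => K z); split; last first.
  by apply/seteqP; split=> [z Kz|z []//]; exists id.
by move=> z s H; apply: cK => m; have [z' [_ [Kz' e _]]] := H m; exists z'.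
Qed.

Lemma suslin_bigcup (E : nat -> set (nat -> A)) :
  (forall i, suslin (E i)) -> suslin (\bigcup_i E i).
Proof.
move=> /choice[C] /all_and2[cC CE].
(* The first integer names the set, the rest is its witness. *)
exists (fun z s => C (s 0%N) z (fun i => s i.+1)); split.
  move=> z s H; apply: cC => m; have [z' [s' [Cz' ez es]]] := H m.+1.
  have /pre_eqP es' := es; exists z', (fun i => s' i.+1); split.
  - by rewrite -es'.
  - exact: pre_eq_le ez.
  - by apply/pre_eqP => i im; rewrite es'.
apply/seteqP; split=> z.
  by move=> [i _]; rewrite CE => -[s Cs]; exists (fun j => if j is k.+1 then s k else i).
by move=> [s Cs]; exists (s 0%N) => //; rewrite CE; exists (fun i => s i.+1).
Qed.

Lemma suslin_bigcap (E : nat -> set (nat -> A)) :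
  (forall i, suslin (E i)) -> suslin (\bigcap_i E i).
Proof.
move=> /choice[C] /all_and2[cC CE].
(* One sequence stores the witnesses for all sets, interleaved by the coding of pairs. *)
exists (fun z s => forall i, C i z (fun j => s (pickle (i, j)))); split.
  move=> z s H i; apply: cC => m.
  have [z' [s' [Cz' ez es]]] := H (maxn m (\max_(j < m) (pickle (i, val j)).+1)).
  exists z', (fun j => s' (pickle (i, j))); split; first exact: Cz'.
    by apply: pre_eq_le ez; rewrite leq_maxl.
  apply/pre_eqP => j jm; have /pre_eqP := es; apply.
  rewrite leq_max; apply/orP; right.
  exact: (@leq_bigmax _ (fun j : 'I_m => (pickle (i, val j)).+1) (Ordinal jm)).
apply/seteqP; split=> z.
  move=> H; have /choice[s sP] i : exists s, C i z s by have := H i Logic.I; rewrite CE.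
  exists (fun k => if unpickle k is Some p then s p.1 p.2 else 0%N) => i.
  rewrite (_ : (fun j => _) = s i)//.
  by apply/funext => j; rewrite pickleK.
by move=> [s Cs] i _; rewrite CE; exists (fun j => s (pickle (i, j))).
Qed.

Lemma closed_cyl_pred m (P : seq A -> Prop) : closed_paths [set y | P (pre m y)].
Proof. by move=> y /(_ m)[y' /= Py' <-]. Qed.

End Suslin.

Section SuslinContent.
Context {R : realType} {A : finType}.
Variable r : R.
Hypothesis r0 : 0 < r.
Hypothesis r1 : r < 1.
Local Open Scope ereal_scope.

Lemma bounded_closed_rel (C : (nat -> A) -> (nat -> nat) -> Prop) b : closed_rel C ->
  closed_paths [set y | exists s, (forall i, (s i <= b i)%N) /\ C y s].
Proof.
move=> cC y H.
have /choice[z zP] (m : nat) : exists z : (nat -> A) * (nat -> nat),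
    [/\ forall i, (z.2 i <= b i)%N, C z.1 z.2 & pre m z.1 = pre m y].
  by have [y' [s [sb Cs] e]] := H m; exists (y', s).
have [|s [sL sP]] := @konig _ (fun m => (z m).2) (fun i => iota 0 (b i).+1).
  by move=> m i _; have [zb _ _] := zP m; rewrite mem_iota add0n ltnS; apply: zb.
exists s; split=> [i|]; first by have := sL i; rewrite mem_iota add0n ltnS.
apply: cC => m; have [m' mm' e] := sP m m; have [_ Cz e'] := zP m'.
by exists (z m').1, (z m').2; split=> //; apply: pre_eq_le e'.
Qed.

(** The case of a one-point parameter space with Dirac mass: if all bounded, hence compact, pieces
    of [E] were null, [fcontent_eq0] would make [E] null. *)
Lemma suslin_content (E : set (nat -> A)) : suslin E -> content r 0 E <> 0 ->
  exists K, [/\ closed_paths K, K `<=` E & content r 0 K <> 0].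
Proof.
move=> [C [cC CE]] E0; apply: contrapT => H; apply: E0.
pose C' (z : nat -> unit * A) s := C (fun i => (z i).2) s.
have cC' : closed_rel C'.
  move=> z s Hz; apply: cC => m; have [z' [s' [Cz' ez es]]] := Hz m.
  exists (fun i => (z' i).2), s'; split=> //.
  by apply/pre_eqP => i im; have /pre_eqP -> := ez.
pose crd (x : unit) (i : nat) := tt.
have mufin : (\d_tt : measure unit R) setT < +oo by rewrite /= diracT ltry.
have mcrd (u : seq unit) : measurable [set x | pre (size u) (crd x) = u] by [].
have Hf := fcontent_eq0 r0 r1 mufin mcrd cC' 0.
have {}Hf : fcontent (dirac tt) r 0 (fun=> E) = 0.
  rewrite CE; apply: Hf => // b; apply/negligibleP => //.
  rewrite /= diracE memNset// /bounded_slice /= => K0; apply: H.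
  exists [set y | exists s, (forall i, (s i <= b i)%N) /\ C y s]; split=> //.
    exact: bounded_closed_rel.
  by rewrite CE => y [s [_ Cs]]; exists s.
apply/eqP; rewrite eq_le (content_ge0 (ltW r0)) andbT.
rewrite -Hf; apply: le_ereal_inf_tmp => _ [F [Ff FE] <-].
have DE : covers [set u | F u tt] E by move=> y Ey; apply: (FE tt).
apply: le_trans (content_le _ _ DE) _ => //.
rewrite esum_mkcond; apply: le_esum => u _.
case: ifPn => [|_]; last by rewrite mule_ge0// lee_fin exprn_ge0// ltW.
by rewrite inE /= => Fu; rewrite diracE mem_set// mule1.
Qed.

End SuslinContent.

(** * Besicovitch trimming *)

Section Trimming.
Context {R : realType} {A : finType}.
Variable r : R.
Hypothesis r0 : 0 < r.
Hypothesis r1 : r < 1.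
Local Open Scope ereal_scope.
Implicit Types (E F K : set (nat -> A)) (u v : seq A).

Let r0' : (0 <= r)%R := ltW r0.

Lemma content_le_sum l j E (s : seq (seq A)) : (forall y, E y -> pre l y \in s) ->
  content r j E <= \sum_(u <- s) content r j (E `&` [set y | pre l y = u]).
Proof.
elim: s E => [|u s IH] E Es.
  rewrite big_nil (_ : E = set0) ?content_set0//.
  by rewrite -subset0 => y /Es.
rewrite big_cons; set Eu := E `&` _.
apply: (@le_trans _ _ (content r j (Eu `|` E `\` Eu))).
  by apply: le_content => y Ey; have [?|?] := pselect (Eu y); [left|right].
apply: le_trans (contentU r0' _ _ _) _; apply: leeD => //.
apply: le_trans (IH _ _) _.
  move=> y [/[dup] Ey /Es]; rewrite inE => /orP[/eqP yu|//] [].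
  by split.
by apply: lee_sum => v _; apply: le_content => y [[]].
Qed.

Definition words l : seq (seq A) := map val (enum {: l.-tuple A}).

Lemma mem_words l u : (u \in words l) = (size u == l).
Proof.
apply/mapP/idP => [[t _ ->]|ul]; first by rewrite size_tuple.
by exists (Tuple ul) => //; rewrite mem_enum.
Qed.

Lemma uniq_words l : uniq (words l).
Proof. by rewrite map_inj_uniq ?enum_uniq//; exact: val_inj. Qed.

Lemma content_sum_words l j E : (l <= j)%N ->
  content r j E = \sum_(u <- words l) content r j (E `&` cyl u).
Proof.
move=> lj; apply/eqP; rewrite eq_le; apply/andP; split.
  apply: (le_trans (@content_le_sum l j E (words l) _)).
    by move=> y _; rewrite mem_words size_pre.
  rewrite big_seq [leRHS]big_seq; apply: lee_sum => u.
  by rewrite mem_words => /eqP ul; apply: le_content => y; rewrite /cyl /= ul.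
apply: content_sum_le lj _ _ => //; first exact: uniq_words.
by apply/allP => u; rewrite mem_words.
Qed.

(** Inside [cyl v], the content at the level of [v] is the minimum of the weight of [v] and the
    content one level deeper. Hence contents at level [j] in the cylinders control monotonically
    those at all coarser levels. *)
Lemma content_transfer i j E F : (i <= j)%N ->
  (forall u, size u = j -> content r j (E `&` cyl u) <= content r j (F `&` cyl u)) ->
  content r i E <= content r i F.
Proof.
have sum_case k E1 F1 :
    (forall u, size u = k -> content r k (E1 `&` cyl u) <= content r k (F1 `&` cyl u)) ->
    content r k E1 <= content r k F1.
  move=> H; rewrite (content_sum_words E1 (leqnn k)) (content_sum_words F1 (leqnn k)).
  rewrite big_seq [leRHS]big_seq; apply: lee_sum => u.
  by rewrite mem_words => /eqP /H.
elim: j => [|j IH] ij H; first by move: ij; rewrite leqn0 => /eqP ->; exact: sum_case.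
move: ij; rewrite leq_eqVlt => /orP[/eqP ->|]; first exact: sum_case.
rewrite ltnS => ij; apply: IH => // v vj.
have := @content_step R A r v (F `&` cyl v) (@subIsetr _ _ _).
rewrite vj; apply: le_trans; rewrite le_min; apply/andP; split.
  by have := @content_cyl R A r r0' j v (E `&` cyl v) (@subIsetr _ _ _); rewrite vj; apply.
apply: le_trans (content_level r _ (leqnSn j)) _.
apply: sum_case => u uj.
have [uv|uv] := eqVneq (take j u) v.
  have sub G : (G `&` cyl v) `&` cyl u = G `&` cyl u.
    apply/seteqP; split=> y [Gy yu]; split=> //; first by case: Gy.
    split=> //; rewrite /cyl /= vj -uv -[in RHS]yu uj take_pre//.
  by rewrite !sub; exact: H.
rewrite (_ : (E `&` cyl v) `&` cyl u = set0) ?content_set0 ?content_ge0//.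
rewrite -subset0 => y [[_ yv] yu]; move/eqP: uv; apply.
by rewrite -yv vj -yu uj take_pre.
Qed.

Lemma closed_pathsI K F : closed_paths K -> closed_paths F -> closed_paths (K `&` F).
Proof.
by move=> cK cF y H; split; [apply: cK|apply: cF] => m; have [y' [? ?] ?] := H m; exists y'.
Qed.

Lemma exists_small_power (e : R) n : (0 < e)%R -> exists2 l, (n <= l)%N & (r ^+ l <= e)%R.
Proof.
move=> e0; have : (r ^+ l @[l --> \oo] --> (0 : R))%R.
  by apply: cvg_expr; rewrite gtr0_norm.
move=> /cvgrPdist_le/(_ _ e0)[N _ HN].
exists (maxn n N); first exact: leq_maxl.
by have := HN (maxn n N) (leq_maxr _ _); rewrite sub0r normrN ger0_norm// exprn_ge0.
Qed.

(* Adding small cylinders one at a time, the content grows by small steps. *)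
Lemma content_ivt j K (a e : R) : closed_paths K -> (0 < e)%R -> (0 <= a)%R ->
  a%:E <= content r j K -> exists F, [/\ closed_paths F, F `<=` K,
    a%:E <= content r j F & content r j F <= (a + e)%:E].
Proof.
move=> cK e0 a0 aK.
have [l jl le_] := exists_small_power j e0.
pose s := words l; pose F i := K `&` [set y | pre l y \in take i s].
pose P i := a%:E <= content r j (F i).
have exP : exists i, P i.
  exists (size s); apply: le_trans aK _; apply: le_content => y Ky.
  by split=> //=; rewrite take_size mem_words size_pre.
case: (ex_minnP exP) => i Pi imin; exists (F i); split => //.
  by apply: closed_pathsI => //; exact: (@closed_cyl_pred _ l (fun u => u \in take i s)).
  exact: subIsetl.
case: i Pi imin => [|i] Pi imin.
  rewrite (_ : F 0%N = set0) ?content_set0 ?lee_fin ?addr_ge0// ?ltW//.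
  by rewrite -subset0 => y [_]; rewrite /= take0.
have Fi : content r j (F i) <= a%:E.
  by rewrite leNgt; apply/negP => /ltW /imin; rewrite ltnn.
have [si|si] := leqP (size s) i.
  have -> : F i.+1 = F i by rewrite /F !take_oversize// (leq_trans si).
  by apply: le_trans Fi _; rewrite lee_fin lerDl ltW.
apply: (@le_trans _ _ (content r j (F i `|` cyl (nth [::] s i)))).
  apply: le_content => y [Ky] /=; rewrite (take_nth [::])// mem_rcons inE => /orP[/eqP yi|yi].
    by right; rewrite /cyl /= -yi size_pre.
  by left; split.
apply: le_trans (contentU r0' _ _ _) _; rewrite EFinD; apply: leeD => //.
have sl : size (nth [::] s i) = l by apply/eqP; rewrite -mem_words mem_nth.
by apply: le_trans (content_cyl r0' (u := nth [::] s i) _ _) _; rewrite ?sl// lee_fin.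
Qed.

(** When the finer content exceeds the weight of [u], that weight is the minimum in [content_step];
    the set can be cut until the finer content barely exceeds it without lowering the coarse one. *)
Lemma trim_cylinder u K (e : R) : closed_paths K -> K `<=` cyl u -> (0 < e)%R ->
  exists F, [/\ closed_paths F, F `<=` K,
    content r (size u) K <= content r (size u) F &
    content r (size u).+1 F <= content r (size u) K + e%:E].
Proof.
move=> cK Ku e0; have sK := content_step r Ku; have Kw := content_cyl r0' Ku (leqnn _).
have [small|/ltW big] := leP (content r (size u).+1 K) (r ^+ size u)%:E.
  exists K; split=> //; apply: le_trans (leeDl _ _); last by rewrite lee_fin ltW.
  by move: sK; rewrite min_r.
have [|F [cF FK aF Fa]] := content_ivt cK e0 _ big; first by rewrite exprn_ge0.
exists F; split=> //.
  apply: le_trans Kw _; apply: le_trans (content_step r (subset_trans FK Ku)).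
  by rewrite min_l.
by apply: le_trans Fa _; rewrite EFinD leeD2r//; move: sK; rewrite min_l.
Qed.

Lemma trim_level j K (e : R) : closed_paths K -> (0 < e)%R ->
  exists F, [/\ closed_paths F, F `<=` K,
    forall i, (i <= j)%N -> content r i K <= content r i F &
    content r j.+1 F <= content r j K + e%:E].
Proof.
(* The error is shared among the words of length [j]; the successor avoids a zero denominator. *)
move=> cK e0; pose N : R := (size (words j)).+1%:R.
have N0 : (0 < N)%R by rewrite ltr0n.
have /choice[G GP] (u : seq A) : exists F, size u = j -> [/\ closed_paths F,
    F `<=` K `&` cyl u, content r j (K `&` cyl u) <= content r j F &
    content r j.+1 F <= content r j (K `&` cyl u) + (e / N)%:E].
  have [<-|uj] := pselect (size u = j); last by exists set0.
  have [|||F FP] := @trim_cylinder u (K `&` cyl u) (e / N).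
  - by apply: closed_pathsI => //; exact: (@closed_cyl_pred _ _ (fun v => v = u)).
  - exact: subIsetr.
  - by rewrite divr_gt0.
  - by exists F.
pose F := [set y | G (pre j y) y].
have Fu u : size u = j -> F `&` cyl u = G u.
  move=> uj; apply/seteqP; split=> y; rewrite /F /cyl /= uj; first by move=> [+ <-].
  by move=> Gy; have [_ /(_ _ Gy)[_ yu] _ _] := GP _ uj; rewrite -uj yu.
exists F; split.
- move=> y H; rewrite /F /=; have [cG _ _ _] := GP _ (size_pre j y).
  apply: cG => m; have [y' Fy' e'] := H (maxn m j); exists y'.
    by rewrite -(pre_eq_le (leq_maxr m j) e').
  exact: pre_eq_le (leq_maxl m j) e'.
- by move=> y; rewrite /F /= => Gy; have [_ /(_ _ Gy)[] ] := GP _ (size_pre j y).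
- move=> i ij; apply: content_transfer ij _ => u uj.
  by rewrite Fu//; have [] := GP _ uj.
- rewrite (content_sum_words F (leqnSn j)) (content_sum_words K (leqnn j)).
  apply: (@le_trans _ _ (\sum_(u <- words j) (content r j (K `&` cyl u) + (e / N)%:E))).
    rewrite big_seq [leRHS]big_seq; apply: lee_sum => u.
    by rewrite mem_words => /eqP uj; rewrite Fu//; have [] := GP _ uj.
  rewrite big_split /=; apply: leeD => //.
  rewrite sumEFin big_const_seq count_predT iter_addr_0 lee_fin -mulr_natr mulrAC.
  by rewrite ler_pdivrMr// ler_wpM2l ?ltW// ltr_nat.
Qed.

(** Trimming at level [j] keeps the contents of all levels up to [j], in particular level 0, and
    bounds the next one by the current one up to [e j]. Compactness carries non-nullity over to the
    intersection. *)
Lemma trim K : closed_paths K -> content r 0 K <> 0 -> exists F,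
  [/\ closed_paths F, F `<=` K, content r 0 F <> 0 & forall j, content r j F <= 3%:E].
Proof.
move=> cK K0.
pose e j : R := (2^-1 ^+ j)%R.
have e0 j : (0 < e j)%R by rewrite exprn_gt0// invr_gt0.
pose T := {K : set (nat -> A) | closed_paths K}.
have /choice[g gP] (p : nat * T) : exists F : T, [/\ sval F `<=` sval p.2,
    forall i, (i <= p.1)%N -> content r i (sval p.2) <= content r i (sval F) &
    content r p.1.+1 (sval F) <= content r p.1 (sval p.2) + (e p.1)%:E].
  case: p => j [K1 cK1]; have [F [cF F1 F2 F3]] := trim_level j cK1 (e0 j).
  by exists (exist _ F cF).
pose S := fix S j : T := if j is j'.+1 then g (j', S j') else exist _ K cK.
pose KK j := sval (S j).
have KKc j : closed_paths (KK j) by exact: svalP.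
have KKS j : KK j.+1 `<=` KK j by have [] := gP (j, S j).
have KKle i j : (i <= j)%N -> KK j `<=` KK i.
  elim: j => [|j IH]; first by rewrite leqn0 => /eqP ->.
  rewrite leq_eqVlt => /orP[/eqP ->//|/IH h]; exact: subset_trans (KKS j) h.
have KK0 j : content r 0 K <= content r 0 (KK j).
  elim: j => [//|j IH]; apply: le_trans IH _.
  by have [_ /(_ 0%N isT)] := gP (j, S j).
(* Level 0 costs at most the weight 1 of the empty word, and the errors [e i] for [i < j] sum to
   [2 - 2 * e j]; hence the bound 3. *)
have KKb j : content r j (KK j) <= (3 - 2 * e j)%:E.
  elim: j => [|j IH].
    have h : (1%R <= 3 - 2 * e 0%N :> R)%R by rewrite /e expr0; lra.
    by apply: le_trans (content_cyl r0' (u := [::]) _ _) _.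
  have [_ _ /le_trans] := gP (j, S j); apply.
  apply: le_trans (leeD IH (lexx _)) _; rewrite -EFinD lee_fin /= /e exprS; lra.
exists (\bigcap_j KK j); split.
- by move=> y H j _; apply: KKc => m; have [y' /(_ j I)] := H m; exists y'.
- by move=> y /(_ 0%N I).
- move=> F0.
  have [D [_ DF De]] : exists D, [/\ forall u, D u -> (0 <= size u)%N,
      covers D (\bigcap_j KK j) & \esum_(u in D) (r ^+ size u)%:E < content r 0 K].
    apply: content_lt; rewrite F0 lt_def content_ge0// andbT; exact/eqP.
  (* By compactness the trimmed sets are eventually covered as well. *)
  suff [j jD] : exists j, covers D (KK j).
    have := content_le r (j := 0) _ jD => /(_ (fun _ _ => isT)) H.
    by have := le_lt_trans (le_trans (KK0 j) H) De; rewrite ltxx.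
  apply: contrapT => H.
  have /choice[y yP] (j : nat) : exists y, KK j y /\ forall m, ~ D (pre m y).
    apply: contrapT => H'; apply: H; exists j => y Ky; apply: contrapT => H''.
    by apply: H'; exists y; split=> // m Dm; apply: H''; exists m.
  have [|z [_ zP]] := @konig _ y (fun=> enum A); first by move=> m i _; rewrite /= mem_enum.
  have [|m Dm] := DF z.
    move=> j _; apply: KKc => m; have [m' mm' ez] := zP m j.
    by exists (y m') => //; apply: (KKle _ _ mm'); case: (yP m').
  have [m' _ ez] := zP m 0%N; have [_ /(_ m)] := yP m'; apply.
  by rewrite ez.
- move=> j; apply: le_trans (le_content r j _) (le_trans (KKb j) _).
    by move=> y /(_ j I).
  by rewrite lee_fin; have := e0 j; lra.
Qed.

End Trimming.

(** * Lower bound by weighted coverings *)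

Lemma esum_pickle (R : realType) (I : countType) (h : I -> \bar R) :
  (forall i, 0 <= h i)%E ->
  (\esum_(i in [set: I]) h i = \sum_(k <oo) oapp h 0 (pickle_inv k))%E.
Proof.
move=> h0; rewrite nneseries_esumT; last by move=> k; case: (pickle_inv k).
rewrite (esumID (pickle @` [set: I]) [set: nat]); last by move=> k _; case: (pickle_inv k).
rewrite [X in (_ = _ + X)%E]esum1 ?adde0; last first.
  move=> k [_ /= Hk]; case E : (pickle_inv k) => [i|//].
  by exfalso; apply: Hk; exists i => //; have := @pickle_invK I k; rewrite E.
rewrite setTI esum_image; last by move=> i j _ _; exact: (pcan_inj pickleK_inv).
by apply: eq_esum => i _; rewrite pickleK_inv.
Qed.

Section LayerCake.
Context {R : realType} {A : finType}.
Variables (r : R) (a : seq A -> R) (c : R).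
Hypothesis r0 : 0 < r.
Hypothesis a0 : forall u, 0 <= a u.
Hypothesis c0 : 0 < c.
Local Open Scope ereal_scope.

(* Average over [th] in [[0, c[] the coverings by the words at which the weight
   accumulated along the path first exceeds [th]. *)
Let S (u : seq A) : R := (\sum_(i < size u) a (take i u))%R.

Let first_passage (th : R) : set (seq A) :=
  [set u | (S u <= th < S u + a u)%R].

Let first_passage_covers E th : (0 <= th < c)%R ->
  (forall y, E y -> exists n, (c <= \sum_(i < n) a (pre i y))%R) ->
  covers (first_passage th) E.
Proof.
move=> /andP[th0 thc] HE y /HE[n cn].
have exP : exists n, (th < \sum_(i < n) a (pre i y))%R by exists n; exact: lt_le_trans cn.
case: (ex_minnP exP) => -[|k]; first by rewrite big_ord0 ltNge th0.
rewrite big_ord_recr /= => thk kmin; exists k.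
have SE : S (pre k y) = (\sum_(i < k) a (pre i y))%R.
  rewrite /S size_pre; apply: eq_bigr => i _; rewrite take_pre// ltnW//.
by rewrite /first_passage /= SE thk andbT leNgt; apply/negP => /kmin; rewrite ltnn.
Qed.

Lemma layer_cake (E : set (nat -> A)) :
  (forall y, E y -> exists n, (c <= \sum_(i < n) a (pre i y))%R) ->
  c%:E * content r 0 E <= \esum_(u in [set: seq A]) ((r ^+ size u * a u)%:E).
Proof.
move=> HE; pose D : set R := `[0%R, c[%classic.
pose mu := @lebesgue_measure R.
have mD : measurable D by exact: measurable_itv.
have muD : mu D = c%:E.
  by rewrite /mu /D lebesgue_measure_itv /= lte_fin c0 -EFinB subr0.
pose J (u : seq A) : set R := `[S u, (S u + a u)%R[%classic.
pose g (u : seq A) (th : R) : \bar R := ((r ^+ size u)%:E * (\1_(J u) th)%:E).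
have g0 u th : 0 <= g u th by rewrite mule_ge0// lee_fin exprn_ge0// ltW.
have mg u : measurable_fun D (g u).
  apply: measurable_funeM; apply/measurable_EFinP; apply: measurable_indic.
  exact: measurable_itv.
have ge0pick k th : 0 <= oapp (fun u => g u th) 0 (pickle_inv k).
  by case: (pickle_inv k) => [u|] /=; [exact: g0|exact: lexx].
have mpick k : measurable_fun D (fun th : R => oapp (fun u => g u th) 0 (pickle_inv k)).
  by case: (pickle_inv k) => [u|] /=; [exact: mg|exact: measurable_cst].
have content_g th : D th -> content r 0 E <= \sum_(k <oo) oapp (fun u => g u th) 0 (pickle_inv k).
  rewrite /D /= in_itv /= => thc; rewrite -esum_pickle//.
  apply: le_trans (content_le r _ (first_passage_covers thc HE)) _ => //.
  rewrite esum_mkcond; apply: le_esum => u _; case: ifPn => [|_]; last exact: g0.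
  rewrite inE => Hu; have Ju : J u th by rewrite /J /= in_itv.
  by rewrite /g indicE mem_set// mule1.
(* The content is constant in [th], so its integral is a product, while a word [u] is used on an
   interval of length [a u]. *)
have -> : c%:E * content r 0 E = \int[mu]_(th in D) (cst (content r 0 E) th).
  by rewrite integral_cst// [X in _ = _ * X]muD muleC.
apply: (@le_trans _ _ (\int[mu]_(th in D) \sum_(k <oo) oapp (fun u => g u th) 0 (pickle_inv k))).
  apply: ge0_le_integral => //.
    by move=> th _; exact: content_ge0 (ltW r0) _ _.
  exact: (ge0_emeasurable_sum (P := xpredT) (fun k x _ _ => ge0pick k x) (fun k _ => mpick k)).
rewrite integral_nneseries//.
rewrite esum_pickle; last by move=> u; rewrite lee_fin mulr_ge0// exprn_ge0// ltW.
apply: lee_nneseries => [k _ _|k _]; first by apply: integral_ge0 => th _; exact: ge0pick.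
case: (pickle_inv k) => [u|] /=; last by rewrite integral0.
rewrite /g ge0_integralZl_EFin ?(exprn_ge0 _ (ltW r0))//; last first.
  apply/measurable_EFinP; apply: measurable_indic; exact: measurable_itv.
rewrite EFinM; apply: lee_wpmul2l; first by rewrite lee_fin exprn_ge0// ltW.
rewrite integral_indic//; last exact: measurable_itv.
apply: (@le_trans _ _ (mu (J u))).
  by apply: measureIl => //; exact: measurable_itv.
rewrite /mu /J lebesgue_measure_itv /=; case: ifP => _; last by rewrite lee_fin.
by rewrite -EFinB lee_fin addrC addKr.
Qed.

End LayerCake.

Section SliceContent.
Context {R : realType} {A B : finType}.
Variables (rho r : R).
Hypothesis rho0 : 0 < rho.
Hypothesis r0 : 0 < r.
Local Open Scope ereal_scope.

Definition slice (E : set (nat -> A * B)) (t : nat -> A) : set (nat -> B) :=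
  [set y | E (pairf t y)].

Lemma pre_unzip1 m (z : nat -> A * B) : unzip1 (pre m z) = pre m (fun i => (z i).1).
Proof. by rewrite /unzip1 /pre /mkseq -map_comp. Qed.

Lemma pre_unzip2 m (z : nat -> A * B) : unzip2 (pre m z) = pre m (fun i => (z i).2).
Proof. by rewrite /unzip2 /pre /mkseq -map_comp. Qed.

(** Summing the fibre weights of the words of [D] above [p] gives a weight [b p] on the base. Along
    the prefixes of a [t] in the set these add up to more than [c], so [layer_cake] acts as Markov's
    inequality for contents. *)
Let slice_content_gt E (c : R) : (0 < c)%R -> content (rho * r) 0 E = 0 ->
  content rho 0 [set t | c%:E < content r 0 (slice E t)] = 0.
Proof.
move=> c0 E0; apply/eqP; rewrite eq_le (content_ge0 (ltW rho0)) andbT.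
apply: fin_approx_le => e e0; rewrite add0e.
have [D [_ DE De]] : exists D, [/\ forall u, D u -> (0 <= size u)%N, covers D E &
    \esum_(u in D) ((rho * r) ^+ size u)%:E < (e * c)%:E].
  by apply: content_lt; rewrite E0 lte_fin mulr_gt0.
pose D1 (p : seq A) := D `&` [set u | unzip1 u = p].
pose b (p : seq A) := \esum_(u in D1 p) (r ^+ size u)%:E.
have w0 (s : R) n : (0 < s)%R -> 0 <= (s ^+ n)%:E :> \bar R.
  by move=> s0; rewrite lee_fin exprn_ge0// ltW.
have b0 p : 0 <= b p by apply: esum_ge0 => u _; exact: w0.
have Db : \esum_(p in [set: seq A]) ((rho ^+ size p)%:E * b p) < (e * c)%:E.
  apply: le_lt_trans De.
  rewrite -(esum_fibers unzip1); last by move=> u; apply: w0; rewrite mulr_gt0.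
  apply: le_esum => p _; rewrite /b -esumZl; last 2 first.
  - by rewrite exprn_ge0// ltW.
  - by move=> u; exact: w0.
  by apply: le_esum => u [_ /= <-]; rewrite size_map -EFinM exprMn.
have bfin p : b p \is a fin_num.
  rewrite ge0_fin_numE// ltey; apply/eqP => bp.
  have := le_lt_trans (esum_ge_term (fun p => (rho ^+ size p)%:E * b p)
    (i := p) (A := [set: seq A]) I) Db.
  by rewrite bp gt0_muley// lte_fin exprn_gt0.
pose a p : R := fine (b p).
have a0 p : (0 <= a p)%R by exact: fine_ge0.
have : c%:E * content rho 0 [set t | c%:E < content r 0 (slice E t)] <= (e * c)%:E.
  apply: le_trans (ltW Db).
  rewrite (_ : \esum_(p in _) _ = \esum_(u in [set: seq A]) ((rho ^+ size u * a u)%:E)).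
    apply: layer_cake => // t /= ct.
    have ca : c%:E < \sum_(i <oo) (a (pre i t))%:E.
      apply: lt_le_trans ct _.
      apply: (@le_trans _ _ (\esum_(v in unzip2 @` (\bigcup_i D1 (pre i t))) (r ^+ size v)%:E)).
        apply: content_le => // y /DE[m Dm]; exists m, (pre m (pairf t y)).
          by exists m => //; split=> //=; rewrite pre_unzip1.
        by rewrite pre_unzip2.
      (* Above a fixed [t] the second component determines the word, the first being the prefix of
         [t] of the same length. *)
      have inj2 : set_inj (\bigcup_i D1 (pre i t)) unzip2.
        move=> u v /[!inE] -[i _ [_ /= ui]] [j _ [_ /= vj]] uv.
        rewrite -[u]zip_unzip -[v]zip_unzip uv ui vj.
        have := congr1 size ui; have := congr1 size vj; have := congr1 size uv.
        by rewrite !size_pre !size_map => -> -> ->.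
      rewrite esum_image//; apply: le_trans (esum_bigcup_le _ _) _.
        by move=> u; exact: w0.
      apply: lee_nneseries => [i _ _|i _]; first by apply: esum_ge0 => u _; exact: w0.
      by rewrite /a fineK//; apply: le_esum => u _; rewrite size_map.
    (* The inequality is strict, so that a finite partial sum already reaches [c], as [layer_cake]
       requires. *)
    apply: contrapT => H; move: ca; apply/negP; rewrite -leNgt.
    apply: lime_le.
      by apply: is_cvg_nneseries => i _ _; rewrite lee_fin.
    apply: nearW => n; rewrite sumEFin lee_fin big_mkord leNgt; apply/negP => cn.
    by apply: H; exists n; exact: ltW.
  by apply: eq_esum => p _; rewrite EFinM /a fineK.
by rewrite EFinM muleC lee_pmul2r// lte_fin.
Qed.

Lemma slice_content E : content (rho * r) 0 E = 0 ->
  content rho 0 [set t | content r 0 (slice E t) <> 0] = 0.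
Proof.
move=> E0; apply/eqP; rewrite eq_le (content_ge0 (ltW rho0)) andbT.
apply: le_trans (@content_bigcup _ _ _ (ltW rho0) _ _
  (fun k => [set t | (k.+1%:R^-1)%:E < content r 0 (slice E t)]) _) _.
  move=> t /= /eqP st; have : 0 < content r 0 (slice E t).
    by rewrite lt_def st (content_ge0 (ltW r0)).
  case E1 : (content r 0 (slice E t)) => [x| |]//.
    rewrite lte_fin => x0; have [k kx] := ltr_add_invr x0.
    by exists k => //=; rewrite E1 lte_fin -[ltLHS]add0r.
  by exists 0%N => //=; rewrite E1 ltry.
by rewrite eseries0// => k _ _; apply: slice_content_gt.
Qed.

End SliceContent.

(** * Hausdorff measure and dimension *)

Section HausdorffFacts.
Context {R : realType} {T : Type}.
Variable d : T -> T -> R.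
Hypothesis d0 : forall x y, 0 <= d x y.
Local Open Scope ereal_scope.
Implicit Types (E F : set T) (s delta : R).

Lemma diam_le E (x : R) : (forall p q, E p -> E q -> (d p q <= x)%R) -> diam d E <= x%:E.
Proof.
by move=> H; apply: ge_ereal_sup => _ [[p q] [/= Ep Eq] <-]; rewrite lee_fin; apply: H.
Qed.

Lemma le_diam E p q : E p -> E q -> (d p q)%:E <= diam d E.
Proof. by move=> Ep Eq; apply: ereal_sup_ubound; exists (p, q). Qed.

Lemma fine_diam_le E (x : R) : (0 <= x)%R -> diam d E <= x%:E -> (fine (diam d E) <= x)%R.
Proof. by case: (diam d E) => [y| |]//=; rewrite lee_fin. Qed.

Lemma fine_diam_ge0 E : E !=set0 -> (0 <= fine (diam d E))%R.
Proof.
move=> [p Ep]; apply: fine_ge0; apply: le_trans (le_diam Ep Ep).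
by rewrite lee_fin.
Qed.

Lemma diam_set0 : diam d set0 = -oo.
Proof. by rewrite /diam set0X image_set0 ereal_sup0. Qed.

Lemma diam_pow_set0 s : diam_pow d s set0 = 0.
Proof. by rewrite /diam_pow asboolT. Qed.

Lemma diam_powE s E : E !=set0 -> diam_pow d s E = (fine (diam d E) `^ s)%:E.
Proof. by move=> [p Ep]; rewrite /diam_pow asboolF// => E0; rewrite E0 in Ep. Qed.

Lemma diam_pow_ge0 s E : 0 <= diam_pow d s E.
Proof. by rewrite /diam_pow; case: ifP => // _; rewrite lee_fin powR_ge0. Qed.

Lemma diam_pow_le s E (x : R) : (0 <= s)%R -> (0 <= x)%R -> diam d E <= x%:E ->
  diam_pow d s E <= (x `^ s)%:E.
Proof.
move=> s0 x0 Ex; have [->|/set0P EN] := eqVneq E set0.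
  by rewrite diam_pow_set0 lee_fin powR_ge0.
rewrite diam_powE// lee_fin; apply: ge0_ler_powR; rewrite ?nnegrE ?fine_diam_ge0//.
exact: fine_diam_le.
Qed.

Lemma premeasure_ge0 delta s E : 0 <= hausdorff_premeasure d delta s E.
Proof.
apply: le_ereal_inf_tmp => _ [F _ <-]; apply: nneseries_ge0 => i _ _.
exact: diam_pow_ge0.
Qed.

Lemma premeasure_le delta s E (F : nat -> set T) :
  (forall i, diam d (F i) <= delta%:E) -> E `<=` \bigcup_i F i ->
  hausdorff_premeasure d delta s E <= \sum_(i <oo) diam_pow d s (F i).
Proof. by move=> Fd EF; apply: ereal_inf_lbound; exists F. Qed.

Lemma premeasure_lt delta s E x : hausdorff_premeasure d delta s E < x ->
  exists F : nat -> set T, [/\ forall i, diam d (F i) <= delta%:E,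
    E `<=` \bigcup_i F i & \sum_(i <oo) diam_pow d s (F i) < x].
Proof. by move=> /ereal_inf_lt[_ [F [Fd EF] <-] Fx]; exists F. Qed.

Lemma le_premeasure delta s E F : E `<=` F ->
  hausdorff_premeasure d delta s E <= hausdorff_premeasure d delta s F.
Proof.
move=> EF; apply: le_ereal_inf_tmp => _ [G [Gd FG] <-].
by apply: premeasure_le => //; apply: subset_trans FG.
Qed.

Lemma premeasure_delta delta delta' s E : (delta <= delta')%R ->
  hausdorff_premeasure d delta' s E <= hausdorff_premeasure d delta s E.
Proof.
move=> dd; apply: le_ereal_inf_tmp => _ [G [Gd FG] <-].
by apply: premeasure_le => // i; apply: le_trans (Gd i) _; rewrite lee_fin.
Qed.

Lemma premeasure_bigcup delta s E (F : nat -> set T) : E `<=` \bigcup_i F i ->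
  hausdorff_premeasure d delta s E <= \sum_(i <oo) hausdorff_premeasure d delta s (F i).
Proof.
move=> EF; apply: fin_approx_le => e e0.
pose c i := hausdorff_premeasure d delta s (F i).
have c0 i : 0 <= c i by exact: premeasure_ge0.
have [[k koo]|H] := pselect (exists k, c k = +oo).
  rewrite (_ : \sum_(k <oo) _ = +oo) ?addye ?leey//.
  apply/eqP; rewrite -leye_eq -koo nneseries_esumT//.
  exact: (@esum_ge_term _ _ setT c k Logic.I).
apply: le_trans (epsilon_trick xpredT c0 (ltW e0)).
have /choice[G GP] (k : nat) : exists G : nat -> set T,
    [/\ forall i, diam d (G i) <= delta%:E, F k `<=` \bigcup_i G i &
      \sum_(i <oo) diam_pow d s (G i) < c k + (e / (2 ^ k.+1)%:R)%:E].
  apply: premeasure_lt; rewrite -/(c k) lteDl ?lte_fin ?divr_gt0 ?ltr0n ?expn_gt0//.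
  by rewrite ge0_fin_numE// ltey; apply/eqP => koo; apply: H; exists k.
pose g n := oapp (fun p : nat * nat => G p.1 p.2) set0 (pickle_inv n).
apply: (le_trans (@premeasure_le _ _ _ g _ _)).
- move=> n; rewrite /g; case: pickle_inv => [p|] /=; first by have [+ _ _] := GP p.1; apply.
  by rewrite diam_set0 leNye.
- move=> x /EF[k _ Fx]; have [_ /(_ _ Fx)[i _ Gx] _] := GP k.
  by exists (pickle (k, i)) => //; rewrite /g pickleK_inv.
rewrite (eq_eseriesr (g := fun n => oapp (fun p : nat * nat =>
    diam_pow d s (G p.1 p.2)) 0 (pickle_inv n))); last first.
  by move=> n _; rewrite /g; case: pickle_inv => //=; rewrite diam_pow_set0.
rewrite -esum_pickle; last by move=> p; exact: diam_pow_ge0.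
rewrite (_ : [set: nat * nat] = [set: nat] `*`` (fun=> [set: nat])); last first.
  by apply/seteqP; split.
rewrite -(esum_esum (a := fun i j => diam_pow d s (G i j))); last first.
  by move=> *; exact: diam_pow_ge0.
rewrite -nneseries_esumT; last by move=> i; apply: esum_ge0 => *; exact: diam_pow_ge0.
apply: lee_nneseries => [k _ _|k _]; first by apply: esum_ge0 => *; exact: diam_pow_ge0.
have [_ _ /ltW] := GP k; rewrite nneseries_esumT// => i; exact: diam_pow_ge0.
Qed.

Lemma hausdorff_measure_ge0 s E : 0 <= hausdorff_measure d s E.
Proof.
by apply: le_trans (premeasure_ge0 1 s E) _; apply: ereal_sup_ubound; exists 1%R => //=.
Qed.

Lemma premeasure_le_measure delta s E : (0 < delta)%R ->
  hausdorff_premeasure d delta s E <= hausdorff_measure d s E.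
Proof. by move=> d1; apply: ereal_sup_ubound; exists delta. Qed.

Lemma le_hausdorff_measure s E F : E `<=` F ->
  hausdorff_measure d s E <= hausdorff_measure d s F.
Proof.
move=> EF; apply: ge_ereal_sup => _ [delta d1 <-].
by apply: le_trans (le_premeasure _ _ EF) _; exact: premeasure_le_measure.
Qed.

Lemma measure_eq0P s E : hausdorff_measure d s E = 0 <->
  forall delta, (0 < delta)%R -> hausdorff_premeasure d delta s E = 0.
Proof.
split=> [E0 delta d1|H].
  by apply/eqP; rewrite eq_le premeasure_ge0 andbT -E0 premeasure_le_measure.
apply/eqP; rewrite eq_le hausdorff_measure_ge0 andbT.
by apply: ge_ereal_sup => _ [delta d1 <-]; rewrite H.
Qed.

Lemma measure_eq0_sub s E F : E `<=` F -> hausdorff_measure d s F = 0 ->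
  hausdorff_measure d s E = 0.
Proof.
move=> EF F0; apply/eqP; rewrite eq_le hausdorff_measure_ge0 andbT -F0.
exact: le_hausdorff_measure.
Qed.

Lemma measure_eq0_bigcup s E (F : nat -> set T) : E `<=` \bigcup_i F i ->
  (forall i, hausdorff_measure d s (F i) = 0) -> hausdorff_measure d s E = 0.
Proof.
move=> EF F0; apply/measure_eq0P => delta d1.
apply/eqP; rewrite eq_le premeasure_ge0 andbT.
apply: le_trans (premeasure_bigcup _ _ EF) _.
by rewrite eseries0// => i _ _; move/measure_eq0P: (F0 i); apply.
Qed.

Lemma hausdorff_measure_set0 s : hausdorff_measure d s set0 = 0.
Proof.
apply/measure_eq0P => delta d1; apply/eqP; rewrite eq_le premeasure_ge0 andbT.
apply: le_trans (premeasure_le _ (F := fun=> set0) _ _) _ => //.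
- by move=> i; rewrite diam_set0 leNye.
- by rewrite eseries0// => i _ _; rewrite diam_pow_set0.
Qed.

Lemma measure_eq0_bigcup_countable (I : countType) s E (F : I -> set T) :
  E `<=` \bigcup_i F i -> (forall i, hausdorff_measure d s (F i) = 0) ->
  hausdorff_measure d s E = 0.
Proof.
move=> EF F0; apply: (@measure_eq0_bigcup _ _ (fun n => oapp F set0 (pickle_inv n))).
  by move=> x /EF[i _ Fx]; exists (pickle i) => //; rewrite pickleK_inv.
by move=> n; case: pickle_inv => [i|] //=; exact: hausdorff_measure_set0.
Qed.

Lemma measure_eq0_exponent s s' E : (0 <= s)%R -> (s <= s')%R ->
  hausdorff_measure d s E = 0 -> hausdorff_measure d s' E = 0.
Proof.
move=> s0 ss /measure_eq0P E0; apply/measure_eq0P => delta d1.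
apply/eqP; rewrite eq_le premeasure_ge0 andbT.
(* Up to diameter 1 a larger exponent gives a smaller power. *)
have m0 : (0 < Num.min delta 1)%R by rewrite lt_min d1 ltr01.
have m1 : (Num.min delta 1 <= delta)%R by rewrite ge_min lexx.
apply: le_trans (premeasure_delta _ _ m1) _; rewrite -(E0 _ m0).
apply: le_ereal_inf_tmp => _ [G [Gd EG] <-].
apply: le_trans (premeasure_le _ Gd EG) _.
apply: lee_nneseries => [i _ _|i _]; first exact: diam_pow_ge0.
have [->|/set0P GN] := eqVneq (G i) set0; first by rewrite !diam_pow_set0.
rewrite !diam_powE// lee_fin.
have x0 := fine_diam_ge0 GN.
have x1 : (fine (diam d (G i)) <= 1)%R.
  apply: fine_diam_le => //; apply: le_trans (Gd i) _.
  by rewrite lee_fin ge_min lexx orbT.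
(* Diameter 0 is apart because [0 ^ 0] is 1: then [s' = 0] forces [s = 0]. *)
move: x0; rewrite le_eqVlt => /orP[/eqP <-|x0]; last by apply: ger_powR; rewrite ?x0.
have [s'0|s'0] := eqVneq s' 0%R; last by rewrite powR0// powR_ge0.
by have -> : s = s' by apply/eqP; rewrite eq_le ss s'0 s0.
Qed.

Lemma dim_le s E : (0 <= s)%R ->
  (forall s', (s < s')%R -> hausdorff_measure d s' E = 0) -> hausdorff_dim d E <= s%:E.
Proof.
move=> s0 H; apply: fin_approx_le => e e0; apply: ereal_inf_lbound.
exists (s + e)%R; last by rewrite EFinD.
by split; [rewrite addr_ge0// ltW|apply: H; rewrite ltrDl].
Qed.

Lemma dim_lt_eq0 s E : hausdorff_dim d E < s%:E -> hausdorff_measure d s E = 0.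
Proof.
move=> /ereal_inf_lt[_ [s' [s'0 E0] <-]]; rewrite lte_fin => /ltW ss.
exact: measure_eq0_exponent ss E0.
Qed.

Lemma dim_ge s E : hausdorff_measure d s E <> 0 -> s%:E <= hausdorff_dim d E.
Proof. by move=> H; rewrite leNgt; apply/negP => /dim_lt_eq0. Qed.

Lemma dim_ge0 E : 0 <= hausdorff_dim d E.
Proof. by apply: le_ereal_inf_tmp => _ [s [s0 _] <-]; rewrite lee_fin. Qed.

Lemma le_dim E F : E `<=` F -> hausdorff_dim d E <= hausdorff_dim d F.
Proof.
move=> EF; apply: le_ereal_inf_tmp => _ [s [s0 F0] <-]; apply: ereal_inf_lbound.
by exists s; split=> //; apply: measure_eq0_sub F0.
Qed.

End HausdorffFacts.

(** * Dyadic codings *)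

(** A word of length [m], seen as a cell of side [2^-m], weighs [ratio s ^+ m] in exponent [s]. Sums
    of exponents become products of ratios, which is how products of cells factor. *)
Definition ratio {R : realType} (s : R) : R := 2 `^ (- s).

Section Ratio.
Context {R : realType}.
Implicit Types s : R.

Lemma ratio_gt0 s : 0 < ratio s.
Proof. exact: powR_gt0. Qed.

Lemma ratio_lt1 s : 0 < s -> ratio s < 1.
Proof.
move=> s0; rewrite /ratio powRN invf_lt1 ?powR_gt0//.
have : (1 : R) `^ s < 2 `^ s by apply: gt0_ltr_powR; rewrite ?nnegrE ?ltr1n.
by rewrite powR1.
Qed.

Lemma ratioD s s' : ratio (s + s') = ratio s * ratio s'.
Proof. by rewrite /ratio opprD powRD// pnatr_eq0 implybT. Qed.

Lemma half_powR n s : (2^-1 ^+ n) `^ s = ratio s ^+ n.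
Proof.
rewrite exprVn -powR_invn// -powRrM /ratio -powR_mulrn ?powR_ge0// -powRrM.
by rewrite !mulNr mulrC.
Qed.

End Ratio.

Section Coding.
Context {R : realType} {A : finType} {S : topologicalType}.
Variables (d : S -> S -> R) (val : (nat -> A) -> S) (box : seq A -> set S).

Definition near_words (C : nat) (u v : seq A) := exists y y',
  [/\ pre (size u) y = u, pre (size v) y' = v &
     d (val y) (val y') <= C%:R * 2^-1 ^+ size u].

(* Points of [S] are addressed by paths; [box u] is the closed dyadic cell of side
   comparable to [2^-(size u)]. *)
Record coding := Coding {
  coding_ge0 : forall x y, 0 <= d x y;
  coding_sym : forall x y, d x y = d y x;
  coding_box : forall m y, box (pre m y) (val y);
  coding_diam : exists2 C, 0 < C & forall u x x', box u x -> box u x' ->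
    d x x' <= C * 2^-1 ^+ size u;
  coding_near : forall C, exists M, forall j (u : j.-tuple A),
    (#|[set v : j.-tuple A | `[< near_words C u v >]]%SET| <= M)%N;
  coding_closed : forall u, closed (box u);
  coding_nested : forall u a, box (rcons u a) `<=` box u;
  coding_sep : forall y x, (forall m, box (pre m y) x) -> x = val y;
  coding_open : forall U y, open U -> U (val y) -> exists m, box (pre m y) `<=` U }.

Hypothesis Cd : coding.

Lemma box_pre l m y : (l <= m)%N -> box (pre m y) `<=` box (pre l y).
Proof.
elim: m => [|m IH]; first by rewrite leqn0 => /eqP ->.
rewrite leq_eqVlt => /orP[/eqP ->//|/IH h]; rewrite preS.
by move=> x /(coding_nested Cd)/h.
Qed.

Lemma sigma_borel (T : topologicalType) : sigma_algebra setT (@borel T).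
Proof. exact: smallest_sigma_algebra. Qed.

Lemma borel_closed (T : topologicalType) (K : set T) : closed K -> borel K.
Proof.
move=> cK; have [_ bC _] := sigma_borel T.
rewrite -(setCK K) -setTD; apply: bC; apply: sub_sigma_algebra.
exact: closed_openC.
Qed.

Lemma borel_bigcup (T : topologicalType) (F : nat -> set T) :
  (forall i, borel (F i)) -> borel (\bigcup_i F i).
Proof. by move=> bF; have [_ _ bU] := sigma_borel T; apply: bU. Qed.

Lemma borel_setC (T : topologicalType) (E : set T) : borel E -> borel (~` E).
Proof. by move=> bE; have [_ bC _] := sigma_borel T; rewrite -setTD; apply: bC. Qed.

Lemma borel_bigcap (T : topologicalType) (F : nat -> set T) :
  (forall i, borel (F i)) -> borel (\bigcap_i F i).
Proof.
move=> bF; rewrite -(setCK (\bigcap_i F i)) setC_bigcap.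
exact: (borel_setC (borel_bigcup (fun i => borel_setC (bF i)))).
Qed.

Lemma borel_bigcup_countable (T : topologicalType) (I : countType) (F : I -> set T) :
  (forall i, borel (F i)) -> borel (\bigcup_i F i).
Proof.
move=> bF; have [b0 _ _] := sigma_borel T.
rewrite (_ : \bigcup_i F i = \bigcup_n oapp F set0 (pickle_inv n)).
  by apply: borel_bigcup => n; case: pickle_inv.
apply/seteqP; split=> [x [i _ Fx]|x [n _]].
  by exists (pickle i) => //; rewrite pickleK_inv.
by case: pickle_inv => // i Fx; exists i.
Qed.

(** Suslin sets are not stable under complement, so the induction over the sigma-algebra carries
    each set along with its complement. *)
Lemma suslin_preimage_borel (B : set S) : borel B -> suslin (val @^-1` B).
Proof.
pose G := [set B : set S | suslin (val @^-1` B) /\ suslin (val @^-1` (~` B))].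
move=> bB; suff sub : @borel S `<=` G by have [] := sub _ bB.
apply: smallest_sub.
  split.
  - split; rewrite ?setC0 ?preimage_set0 ?preimage_setT; apply: closed_suslin => //.
    by move=> y /(_ 0%N)[].
  - by move=> E [s1 s2]; rewrite /G /= setTD setCK.
  - move=> F FG; split; first by rewrite preimage_bigcup; apply: suslin_bigcup => i; case: (FG i).
    rewrite setC_bigcup preimage_bigcap; apply: suslin_bigcap => i.
    by case: (FG i).
move=> U oU; split.
  rewrite (_ : val @^-1` U = \bigcup_n oapp
    (fun u => [set y | cyl u `<=` val @^-1` U /\ pre (size u) y = u]) set0 (pickle_inv n)).
    apply: suslin_bigcup => n; apply: closed_suslin; case: pickle_inv => [u|] /= y Hy.
      by have [y' [uU yu] e] := Hy (size u); split=> //; rewrite -e.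
    by have [] := Hy 0%N.
  apply/seteqP; split=> [y Uy|y [n _]].
    have [m mU] := coding_open Cd oU Uy; exists (pickle (pre m y)) => //.
    rewrite pickleK_inv /= size_pre; split=> // y'; rewrite /cyl /= size_pre => e.
    by apply: mU; rewrite -e; apply: coding_box.
  by case: pickle_inv => [u [+ yu]|//]; apply.
apply: closed_suslin => y Hy /= Uy; have [m mU] := coding_open Cd oU Uy.
have [y' + e] := Hy m; apply; apply: mU.
by rewrite -e; apply: coding_box.
Qed.

(** A point lying at every level in a cell met by [K] is the value of an accumulation word, which
    closedness puts in [K]. So the image is a countable intersection of finite unions of closed
    cells. *)
Lemma borel_image_closed (K : set (nat -> A)) : closed_paths K -> borel (val @` K).
Proof.
move=> cK; rewrite (_ : val @` K = \bigcap_j \bigcup_(u : j.-tuple A)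
    (if `[< exists2 y, K y & pre j y = u >] then box u else set0)).
  apply: borel_bigcap => j; apply: borel_bigcup_countable => u.
  have [b0 _ _] := sigma_borel S.
  by case: ifP => _; [apply: borel_closed; exact: coding_closed|exact: b0].
apply/seteqP; split=> [_ [y Ky <-] j _|x Hx].
  have sy : size (pre j y) == j by rewrite size_pre.
  by exists (Tuple sy) => //; rewrite asboolT; [apply: (coding_box Cd)|exists y].
have /choice[y yP] (j : nat) : exists y, K y /\ box (pre j y) x.
  have [u _] := Hx j Logic.I; case: asboolP => // -[y Ky yu] bu.
  by exists y; rewrite yu.
have [|z [_ zP]] := @konig _ y (fun=> enum A); first by move=> m i _; rewrite /= mem_enum.
exists z.
  by apply: cK => m; have [m' _ e] := zP m 0%N; exists (y m') => //; case: (yP m').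
apply/esym/(coding_sep Cd) => m; have [m' mm' e] := zP m m.
by rewrite -e; apply: (box_pre mm'); case: (yP m').
Qed.

Local Open Scope ereal_scope.

Lemma premeasure_boxes : exists2 C : R, (0 < C)%R &
  forall s delta j (D : set (seq A)) E, (0 <= s)%R ->
  (C * 2^-1 ^+ j <= delta)%R -> (forall u, D u -> (j <= size u)%N) ->
  E `<=` \bigcup_(u in D) box u ->
  hausdorff_premeasure d delta s E <= (C `^ s)%:E * \esum_(u in D) (ratio s ^+ size u)%:E.
Proof.
have [C C0 CP] := coding_diam Cd; exists C => // s delta j D E s0 Cj Dj ED.
have h0 n : (0 <= 2^-1 ^+ n :> R)%R by rewrite exprn_ge0// invr_ge0.
have bd u : diam d (box u) <= (C * 2^-1 ^+ size u)%:E by apply: diam_le => p q; exact: CP.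
pose f u := if `[< D u >] then box u else set0.
pose g n := oapp f set0 (pickle_inv n).
apply: le_trans (premeasure_le s (F := g) _ _) _.
- move=> n; rewrite /g; case: pickle_inv => [u|] /=; last by rewrite diam_set0 leNye.
  rewrite /f; case: asboolP => [Du|_]; last by rewrite diam_set0 leNye.
  apply: le_trans (bd u) _; rewrite lee_fin; apply: le_trans Cj.
  rewrite ler_wpM2l ?(ltW C0)//; apply: ler_wiXn2l; rewrite ?invr_ge0//; last exact: Dj.
  by rewrite invf_le1// ler1n.
- move=> x /ED[u Du bx]; exists (pickle u) => //.
  by rewrite /g pickleK_inv /= /f asboolT.
rewrite (eq_eseriesr (g := fun n => oapp (fun u => diam_pow d s (f u)) 0 (pickle_inv n)));
  last by move=> n _; rewrite /g; case: pickle_inv => //=; rewrite diam_pow_set0.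
rewrite -esum_pickle; last by move=> u; exact: diam_pow_ge0.
rewrite -esumZl ?powR_ge0//; last first.
  by move=> u; rewrite lee_fin exprn_ge0// ltW// ratio_gt0.
rewrite [leRHS]esum_mkcond; apply: le_esum => u _; rewrite /f.
case: asboolP => Du; last by rewrite diam_pow_set0 memNset.
rewrite mem_set//; apply: le_trans (diam_pow_le (coding_ge0 Cd) s0 _ (bd u)) _.
  by rewrite mulr_ge0// ltW.
by rewrite powRM ?(ltW C0)// half_powR EFinM.
Qed.

Lemma measure_le_content : exists2 C : R, (0 < C)%R &
  forall s E (c : \bar R), (0 <= s)%R -> E `<=` range val ->
  (forall j, content (ratio s) j (val @^-1` E) <= c) ->
  hausdorff_measure d s E <= (C `^ s)%:E * c.
Proof.
have [C C0 CP] := premeasure_boxes; exists C => // s E c s0 Er Ec.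
apply: ge_ereal_sup => _ [delta /= d0 <-].
have [j _ jd] : exists2 j, (0 <= j)%N & (2^-1 ^+ j <= delta / C)%R.
  by apply: exists_small_power; rewrite ?divr_gt0 ?invr_gt0 ?invf_lt1 ?ltr1n.
have {}jd : (C * 2^-1 ^+ j <= delta)%R by rewrite mulrC -ler_pdivlMr.
apply: le_trans (_ : (C `^ s)%:E * content (ratio s) j (val @^-1` E) <= _); last first.
  by apply: lee_wpmul2l; rewrite ?lee_fin ?powR_ge0.
rewrite -lee_pdivrMl ?powR_gt0//; apply: le_ereal_inf_tmp => _ [D [Dj DE] <-].
rewrite lee_pdivrMl ?powR_gt0//; apply: CP jd Dj _ => // x Ex.
have [y _ yx] := Er _ Ex; rewrite -yx in Ex *.
by have [m Dm] := DE _ Ex; exists (pre m y) => //; apply: (coding_box Cd).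
Qed.

(** A single point has diameter 0, comparable to no dyadic scale; the additive [e] pays for a scale
    that is fine enough. *)
Lemma dyadic_scale (x s e : R) j : (0 < s)%R -> (0 < e)%R ->
  (0 <= x <= 2^-1 ^+ j)%R -> exists J, [/\ (j <= J)%N, (x <= 2^-1 ^+ J)%R &
    (ratio s ^+ J <= 2 `^ s * x `^ s + e)%R].
Proof.
move=> s0 e0 /andP[x0 xj].
have [J jJ Je] := exists_small_power (ratio_gt0 s) (ratio_lt1 s0) j e0.
have [xJ|Jx] := leP x (2^-1 ^+ J)%R.
  exists J; split=> //; apply: le_trans Je _.
  by rewrite lerDr mulr_ge0// powR_ge0.
have exP : exists k, (j <= k)%N && (2^-1 ^+ k < x)%R by exists J; rewrite jJ.
case: (ex_minnP exP) => -[|k] /andP[jk kx] kmin.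
  by move: jk xj; rewrite leqn0 => /eqP ->; rewrite leNgt kx.
have {}jk : (j <= k)%N.
  move: jk; rewrite leq_eqVlt => /orP[/eqP jk|//].
  by move: xj; rewrite jk leNgt kx.
have xk : (x <= 2^-1 ^+ k)%R.
  by rewrite leNgt; apply/negP => kx'; have := kmin k; rewrite jk kx' ltnn => /(_ isT).
exists k; split=> //; apply: ler_wpDr; first exact: (ltW e0).
have -> : (ratio s ^+ k = 2 `^ s * (2^-1 ^+ k.+1) `^ s)%R.
  rewrite half_powR exprS mulrA /ratio powRN mulfV ?mul1r//.
rewrite ler_wpM2l ?powR_ge0//; apply: ge0_ler_powR; rewrite ?nnegrE ?(ltW s0) ?(ltW kx)//.
Qed.

Lemma content_le_diam_pow : exists M : nat, forall s j E, (0 < s)%R ->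
  diam d E <= (2^-1 ^+ j)%:E ->
  content (ratio s) j (val @^-1` E) <= (M%:R * 2 `^ s)%:E * diam_pow d s E.
Proof.
have [M HM] := coding_near Cd 1; exists M => s j E s0 Ej.
have r0 := ltW (ratio_gt0 s).
have M0 : (0 <= M%:R :> R)%R by rewrite ler0n.
have p0 : (0 <= 2 `^ s :> R)%R by exact: powR_ge0.
have [E0|/set0P[y0 Ey0]] := eqVneq (val @^-1` E) set0.
  by rewrite E0 content_set0// mule_ge0 ?diam_pow_ge0// lee_fin mulr_ge0.
have EN : E !=set0 by exists (val y0).
have h0 n : (0 <= 2^-1 ^+ n :> R)%R by rewrite exprn_ge0// invr_ge0.
have x0 := fine_diam_ge0 (coding_ge0 Cd) EN.
have xj := fine_diam_le (h0 j) Ej.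
have Efin : diam d E = (fine (diam d E))%:E.
  rewrite fineK// fin_numE; apply/andP; split.
    rewrite gt_eqF//; apply: lt_le_trans (le_diam d Ey0 Ey0); exact: ltNyr.
  by rewrite lt_eqF//; apply: le_lt_trans Ej _; rewrite ltry.
rewrite diam_powE// -EFinM; set x := fine (diam d E).
apply: fin_approx_le => e e0.
have e'0 : (0 < e / (M%:R + 1))%R by rewrite divr_gt0// ltr_wpDl.
have [|J [jJ xJ rJ]] := @dyadic_scale x s _ j s0 e'0; first by rewrite x0 xj.
(* All cells of level [J] met by [E] are near the cell of the one path [y0], hence at most [M] in
   number. *)
pose u := [tuple y0 i | i < J].
have uE : pre J y0 = u.
  by rewrite /pre /mkseq /u /= -val_enum_ord -map_comp.
pose N := [set v : J.-tuple A | `[< near_words 1 u v >]]%SET.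
pose Nw : seq (seq A) := map (@tval J A) (enum N).
apply: (@le_trans _ _ (\esum_(v in [set` Nw]) (ratio s ^+ size v)%:E)).
  apply: content_le => [v /mapP[t _ ->]|y /= Ey]; first by rewrite size_tuple.
  exists J; have sy : size (pre J y) == J by rewrite size_pre.
  apply/mapP; exists (Tuple sy) => //; rewrite mem_enum inE; apply/asboolP.
  exists y0, y; split; rewrite ?size_tuple//.
  rewrite mul1r -lee_fin; apply: le_trans (le_diam d Ey0 Ey) _.
  by rewrite Efin lee_fin.
apply: le_trans (esum_seq_le _ _) _; first by move=> v; rewrite lee_fin exprn_ge0.
rewrite big_map (eq_bigr (fun=> (ratio s ^+ J)%:E)); last by move=> t _; rewrite size_tuple.
rewrite sumEFin big_const_seq count_predT -cardE iter_addr_0 -EFinD lee_fin.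
apply: (@le_trans _ _ (M%:R * ratio s ^+ J)%R).
  by rewrite -[leLHS]mulr_natl ler_wpM2r ?exprn_ge0// ler_nat; apply: HM.
apply: (@le_trans _ _ (M%:R * (2 `^ s * x `^ s + e / (M%:R + 1)))%R).
  by rewrite ler_wpM2l.
rewrite mulrDr mulrA lerD2l mulrCA ler_piMr ?(ltW e0)//.
by rewrite ler_pdivrMr ?ltr_wpDl// mul1r lerDl.
Qed.

Lemma content_le_premeasure : exists M : nat, forall s j E, (0 < s)%R ->
  content (ratio s) j (val @^-1` E) <=
    (M%:R * 2 `^ s)%:E * hausdorff_premeasure d (2^-1 ^+ j) s E.
Proof.
(* The successor makes the constant positive, so that it can be divided out. *)
have [M HM] := content_le_diam_pow; exists M.+1 => s j E s0.
have r0 := ltW (ratio_gt0 s).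
have M0 : (0 < M.+1%:R * 2 `^ s :> R)%R by rewrite mulr_gt0// powR_gt0.
rewrite -lee_pdivrMl//; apply: le_ereal_inf_tmp => _ [F [Fj EF] <-].
rewrite lee_pdivrMl//.
apply: (le_trans (@content_bigcup _ _ _ r0 j _ (fun i => val @^-1` F i) _)).
  by rewrite -preimage_bigcup; exact: preimage_subset.
rewrite -nneseriesZl; last by move=> i _; exact: diam_pow_ge0.
apply: lee_nneseries => [i _ _|i _]; first exact: content_ge0.
apply: le_trans (HM _ _ _ s0 (Fj i)) _; apply: lee_wpmul2r; first exact: diam_pow_ge0.
by rewrite lee_fin ler_wpM2r ?powR_ge0// ler_nat.
Qed.

Lemma content_le_measure : exists M : nat, forall s j E, (0 < s)%R ->
  content (ratio s) j (val @^-1` E) <= (M%:R * 2 `^ s)%:E * hausdorff_measure d s E.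
Proof.
have [M HM] := content_le_premeasure; exists M => s j E s0.
apply: le_trans (HM _ _ _ s0) _; apply: lee_wpmul2l.
  by rewrite lee_fin mulr_ge0// powR_ge0.
by apply: premeasure_le_measure; rewrite exprn_gt0// invr_gt0.
Qed.

Lemma measure_eq0_content s E : (0 < s)%R -> hausdorff_measure d s E = 0 ->
  content (ratio s) 0 (val @^-1` E) = 0.
Proof.
move=> s0 E0; have [M HM] := content_le_measure.
apply/eqP; rewrite eq_le (content_ge0 (ltW (ratio_gt0 s))) andbT.
by apply: le_trans (HM _ _ _ s0) _; rewrite E0 mule0.
Qed.

Lemma content_eq0_measure s E : (0 < s)%R -> E `<=` range val ->
  content (ratio s) 0 (val @^-1` E) = 0 -> hausdorff_measure d s E = 0.
Proof.
move=> s0 Er E0; have [C C0 HC] := measure_le_content.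
apply/eqP; rewrite eq_le (hausdorff_measure_ge0 d) andbT.
rewrite -(mule0 (C `^ s)%:E); apply: HC => //; first exact: ltW.
move=> j; rewrite content_null_level ?ratio_gt0 ?ratio_lt1//.
exact: ltW (ratio_gt0 s).
Qed.

End Coding.

(** * Dyadic cubes of Euclidean space and their products *)

Section EuclideanDistance.
Context {R : realType}.

Lemma eucl_dist_ge0 n (x y : 'rV[R]_n) : 0 <= eucl_dist x y.
Proof. exact: sqrtr_ge0. Qed.

Lemma eucl_dist_sym n (x y : 'rV[R]_n) : eucl_dist x y = eucl_dist y x.
Proof. by congr Num.sqrt; apply: eq_bigr => i _; rewrite -sqrrN opprB. Qed.

Lemma eucl_dist_coord n (x y : 'rV[R]_n) i : `|x 0 i - y 0 i| <= eucl_dist x y.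
Proof.
rewrite -sqrtr_sqr; apply: ler_wsqrtr; rewrite (bigD1 i)//= lerDl.
by apply: sumr_ge0 => j _; exact: sqr_ge0.
Qed.

Lemma eucl_dist_le n (x y : 'rV[R]_n) (c : R) : 0 <= c ->
  (forall i, `|x 0 i - y 0 i| <= c) -> eucl_dist x y <= n.+1%:R * c.
Proof.
move=> c0 H; rewrite -(@ger0_norm _ (n.+1%:R * c)) ?mulr_ge0// -sqrtr_sqr.
apply: ler_wsqrtr; apply: (@le_trans _ _ (\sum_(i < n) c ^+ 2)).
  apply: ler_sum => i _; rewrite -real_normK ?num_real//.
  by rewrite lerXn2r ?nnegrE.
rewrite sumr_const card_ord exprMn -[leLHS]mulr_natl ler_wpM2r ?sqr_ge0//.
by rewrite -natrX ler_nat -mulnn (leq_trans (leqnSn n))// leq_pmulr.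
Qed.

Context {k n : nat}.
Implicit Types p q : 'rV[R]_k * 'rV[R]_n.

Lemma eucl_dist_prod_ge0 p q : 0 <= eucl_dist_prod p q.
Proof. exact: sqrtr_ge0. Qed.

Lemma eucl_dist_prod_sym p q : eucl_dist_prod p q = eucl_dist_prod q p.
Proof. by rewrite /eucl_dist_prod eucl_dist_sym [eucl_dist p.2 _]eucl_dist_sym. Qed.

Lemma eucl_dist_fst p q : eucl_dist p.1 q.1 <= eucl_dist_prod p q.
Proof.
rewrite -[leLHS]ger0_norm ?eucl_dist_ge0// -sqrtr_sqr; apply: ler_wsqrtr.
by rewrite lerDl sqr_ge0.
Qed.

Lemma eucl_dist_snd p q : eucl_dist p.2 q.2 <= eucl_dist_prod p q.
Proof.
rewrite -[leLHS]ger0_norm ?eucl_dist_ge0// -sqrtr_sqr; apply: ler_wsqrtr.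
by rewrite lerDr sqr_ge0.
Qed.

Lemma eucl_dist_prod_le p q :
  eucl_dist_prod p q <= eucl_dist p.1 q.1 + eucl_dist p.2 q.2.
Proof.
have a0 := eucl_dist_ge0 p.1 q.1; have b0 := eucl_dist_ge0 p.2 q.2.
rewrite -(@ger0_norm _ (_ + _)) ?addr_ge0// -sqrtr_sqr; apply: ler_wsqrtr.
by have := mulr_ge0 a0 b0; rewrite sqrrD; lra.
Qed.

End EuclideanDistance.

Section DyadicBoxes.
Context {R : realType} {n : nat}.
Variable z : 'rV[R]_n.

Local Notation A := {ffun 'I_n -> bool}.

(* [idx c u] is the number with binary digits [u _ c], so that the cell of [u] has
   corner [z + 4 * idx / 2 ^ size u] and side [4 / 2 ^ size u]. *)
Definition idx (c : 'I_n) (u : seq A) : nat :=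
  foldl (fun m (a : A) => (m.*2 + a c)%N) 0%N u.

Definition corner (c : 'I_n) (u : seq A) : R := (idx c u)%:R * 2^-1 ^+ size u.

Definition dyadic_box (u : seq A) : set 'rV[R]_n :=
  [set x | forall c, z 0 c + 4 * corner c u <= x 0 c <=
                     z 0 c + 4 * (corner c u + 2^-1 ^+ size u)].

Definition dyadic_val (y : nat -> A) : 'rV[R]_n :=
  \row_c (z 0 c + 4 * sup [set corner c (pre m y) | m in [set: nat]]).

Lemma idx_rcons c u a : idx c (rcons u a) = ((idx c u).*2 + a c)%N.
Proof. by rewrite /idx foldl_rcons. Qed.

Let half_gt0 m : 0 < 2^-1 ^+ m :> R.
Proof. by rewrite exprn_gt0// invr_gt0. Qed.

Lemma corner_rcons c u a :
  corner c (rcons u a) = corner c u + (a c)%:R * 2^-1 ^+ (size u).+1.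
Proof.
rewrite /corner idx_rcons size_rcons natrD mulrDl -mul2n natrM exprS; congr (_ + _).
by field.
Qed.

Lemma idx_inj u v : size u = size v -> (forall c, idx c u = idx c v) -> u = v.
Proof.
elim/last_ind: u v => [|u a IH] v; first by move=> /esym/size0nil ->.
elim/last_ind: v => [|v b _]; first by rewrite size_rcons.
rewrite !size_rcons => -[suv] H.
have ab c : a c = b c /\ idx c u = idx c v.
  have := H c; rewrite !idx_rcons => E.
  have := congr1 odd E; rewrite !oddD !odd_double !oddb /= => ab; split=> //.
  by move/eqP: E; rewrite ab eqn_add2r => /eqP/double_inj.
rewrite (IH v suv); last by move=> c; case: (ab c).
by congr rcons; apply/ffunP => c; case: (ab c).
Qed.

Lemma corner_mono c l m y : (l <= m)%N ->
  corner c (pre l y) <= corner c (pre m y) /\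
  corner c (pre m y) + 2^-1 ^+ m <= corner c (pre l y) + 2^-1 ^+ l.
Proof.
elim: m => [|m IH]; first by rewrite leqn0 => /eqP ->.
rewrite leq_eqVlt => /orP[/eqP ->//|/IH[h1 h2]].
rewrite preS corner_rcons size_pre.
have h0 := half_gt0 m.+1; have e : (2^-1 ^+ m = 2^-1 ^+ m.+1 + 2^-1 ^+ m.+1 :> R).
  by rewrite exprS; field.
by move: h1 h2; case: (y m c) => /=; rewrite ?mul1r ?mul0r; lra.
Qed.

Lemma dyadic_box_val m y : dyadic_box (pre m y) (dyadic_val y).
Proof.
move=> c; rewrite mxE size_pre !lerD2l !ler_pM2l//.
set X := [set _ | _ in _].
have Xub : ubound X (corner c (pre m y) + 2^-1 ^+ m).
  move=> _ [l _ <-]; have [lm|/ltnW ml] := leqP l m.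
    have [h1 _] := corner_mono c y lm.
    by apply: le_trans h1 _; rewrite lerDl ltW.
  have [_ h2] := corner_mono c y ml; apply: le_trans h2.
  by rewrite lerDl ltW.
have X0 : X !=set0 by exists (corner c (pre m y)), m.
apply/andP; split.
  by apply: ub_le_sup; [exists (corner c (pre m y) + 2^-1 ^+ m)|exists m].
exact: ge_sup.
Qed.

Lemma dyadic_box_near (C : nat) u v : size u = size v ->
  near_words eucl_dist dyadic_val C u v -> forall c, (idx c u <= idx c v + C.+1)%N.
Proof.
move=> suv [y [y' [yu yv]]] H c; have h := half_gt0 (size u).
have := le_trans (eucl_dist_coord _ _ c) H.
have := dyadic_box_val (size u) y c; have := dyadic_box_val (size v) y' c.
rewrite yu yv /corner -suv => /andP[_ b2] /andP[a1 _]; rewrite ler_distl => /andP[_ ac].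
rewrite -(ler_nat R) -(ler_pM2r h) natrD mulrDl -(natr1 C) mulrDl mul1r.
have C0 : 0 <= C%:R * 2^-1 ^+ size u :> R by rewrite mulr_ge0// ltW.
(* One unit accounts for the position inside the cell and [C] for the distance, generously since
   cells have side [4 * 2^-(size u)]. *)
by move: b2; rewrite mulrDr; move: a1 ac C0; lra.
Qed.

Lemma near_words_sym (C : nat) u v : size u = size v ->
  near_words eucl_dist dyadic_val C u v -> near_words eucl_dist dyadic_val C v u.
Proof.
by move=> suv [y [y' [yu yv H]]]; exists y', y; split; rewrite // eucl_dist_sym -suv.
Qed.

Lemma dyadic_near_count (C : nat) : exists M, forall j (u : j.-tuple A),
  (#|[set v : j.-tuple A | `[< near_words eucl_dist dyadic_val C u v >]]%SET| <= M)%N.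
Proof.
(* Indices of near cells differ by at most [C.+1] in each coordinate, so the shifted differences
   take [(C.+1).*2.+1] values. *)
exists #|{ffun 'I_n -> 'I_((C.+1).*2.+1)}| => j u.
set N := [set v | _]%SET.
pose f (v : j.-tuple A) : {ffun 'I_n -> 'I_((C.+1).*2.+1)} :=
  [ffun c => inord (idx c v + C.+1 - idx c u)].
have NP v c : v \in N -> (idx c u <= idx c v + C.+1)%N /\ (idx c v <= idx c u + C.+1)%N.
  rewrite inE => /asboolP H; have suv : size u = size v by rewrite !size_tuple.
  split; first exact: dyadic_box_near.
  by apply: dyadic_box_near => //; apply: near_words_sym.
have finj : {in N &, injective f}.
  move=> v w vN wN /ffunP E; apply/val_inj/idx_inj; first by rewrite !size_tuple.
  move=> c; have [v1 v2] := NP v c vN; have [w1 w2] := NP w c wN.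
  have := congr1 val (E c); rewrite !ffunE /= !inordK; last 2 first.
  - by rewrite ltnS leq_subLR -addnn addnA leq_add2r.
  - by rewrite ltnS leq_subLR -addnn addnA leq_add2r.
  move=> /(congr1 (addn^~ (idx c u))); rewrite !subnK//.
  by move=> /eqP; rewrite eqn_add2r => /eqP.
by rewrite -(card_in_imset finj); exact: max_card.
Qed.

Lemma dyadic_box_nested u a : dyadic_box (rcons u a) `<=` dyadic_box u.
Proof.
move=> x H c; have := H c; rewrite corner_rcons size_rcons.
have h0 := half_gt0 (size u).+1.
have e : (2^-1 ^+ size u = 2^-1 ^+ (size u).+1 + 2^-1 ^+ (size u).+1 :> R).
  by rewrite exprS; field.
by case: (a c) => /=; rewrite ?mul1r ?mul0r e; lra.
Qed.

Lemma dyadic_box_dist u x x' : dyadic_box u x -> dyadic_box u x' ->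
  forall c, `|x 0 c - x' 0 c| <= 4 * 2^-1 ^+ size u.
Proof.
move=> H H' c; have /andP[a1 a2] := H c; have /andP[b1 b2] := H' c.
by rewrite ler_distl; move: a1 a2 b1 b2; rewrite !mulrDr => *; apply/andP; split; lra.
Qed.

Lemma dyadic_box_closed u : closed (dyadic_box u).
Proof.
have -> : dyadic_box u = \bigcap_(c in [set: 'I_n])
    ((fun x : 'rV[R]_n => x 0 c) @^-1` [set t | z 0 c + 4 * corner c u <= t] `&`
     (fun x : 'rV[R]_n => x 0 c) @^-1` [set t | t <= z 0 c + 4 * (corner c u + 2^-1 ^+ size u)]).
  apply/seteqP; split=> [x H c _|x H c]; first by have /andP[] := H c.
  by have [/= -> ->] := H c Logic.I.
have cc c := (continuous_closedP _).1 (@coord_continuous R 1 n 0 c).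
by apply: closed_bigI => c _; apply: closedI; apply: cc; [exact: closed_ge|exact: closed_le].
Qed.

Lemma exists_half_lt (e : R) : 0 < e -> exists m, 2^-1 ^+ m < e.
Proof.
move=> e0; have [|||m _ H] := @exists_small_power R 2^-1 _ _ (e / 2) 0%N.
- by rewrite invr_gt0.
- by rewrite invf_lt1 ?ltr1n.
- by rewrite divr_gt0.
by exists m; apply: le_lt_trans H _; rewrite ltr_pdivrMr// ltr_pMr// ltr1n.
Qed.

Lemma dyadic_box_sep y x : (forall m, dyadic_box (pre m y) x) -> x = dyadic_val y.
Proof.
move=> H; apply/rowP => c; apply/eqP; rewrite -subr_eq0 -normr_le0 leNgt.
apply/negP => xy; have [|m mlt] := exists_half_lt (e := `|x 0 c - dyadic_val y 0 c| / 4).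
  by rewrite divr_gt0.
have := dyadic_box_dist (H m) (dyadic_box_val m y) c.
by rewrite size_pre leNgt -ltr_pdivlMl// mulrC mlt.
Qed.

Lemma dyadic_box_open (U : set 'rV[R]_n) y : open U -> U (dyadic_val y) ->
  exists m, dyadic_box (pre m y) `<=` U.
Proof.
move=> oU Uy; have /nbhs_ballP[e /= e0 eU] : nbhs (dyadic_val y) U by exact: open_nbhs_nbhs.
have [|m mlt] := exists_half_lt (e := e / 4); first by rewrite divr_gt0.
exists m => x' Hx'; apply: eU; split=> // i j; rewrite ord1 /ball /=.
apply: le_lt_trans (dyadic_box_dist (dyadic_box_val m y) Hx' j) _.
by rewrite size_pre -ltr_pdivlMl// mulrC.
Qed.

Lemma dyadic_range x : dyadic_box [::] x -> range dyadic_val x.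
Proof.
move=> x0; have [|y yP] := @path_builder _ (fun u => dyadic_box u x) x0.
  (* Greedy binary digits: the right half is chosen from the midpoint on. *)
  move=> u ux; exists [ffun c => z 0 c + 4 * (corner c u + 2^-1 ^+ (size u).+1) <= x 0 c].
  move=> c; have := ux c; rewrite corner_rcons size_rcons ffunE.
  have e : (2^-1 ^+ size u = 2^-1 ^+ (size u).+1 + 2^-1 ^+ (size u).+1 :> R).
    by rewrite exprS; field.
  by rewrite e;
    case: (leP (z 0 c + 4 * (corner c u + 2^-1 ^+ (size u).+1)) (x 0 c)) => /=;
    rewrite ?mul1r ?mul0r; lra.
by exists y => //; apply/esym/dyadic_box_sep.
Qed.

Lemma dyadic_coding : coding eucl_dist dyadic_val dyadic_box.
Proof.
split.
- exact: eucl_dist_ge0.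
- exact: eucl_dist_sym.
- exact: dyadic_box_val.
- exists (n.+1%:R * 4); first by rewrite mulr_gt0.
  move=> u x x' ux ux'; rewrite -mulrA; apply: eucl_dist_le.
    by rewrite mulr_ge0// ltW.
  exact: dyadic_box_dist.
- exact: dyadic_near_count.
- exact: dyadic_box_closed.
- exact: dyadic_box_nested.
- exact: dyadic_box_sep.
- by move=> U y oU Uy; exact: dyadic_box_open.
Qed.

End DyadicBoxes.

Section ProductCoding.
Context {R : realType} {A B : finType} {S1 S2 : topologicalType}.
Variables (d1 : S1 -> S1 -> R) (val1 : (nat -> A) -> S1) (box1 : seq A -> set S1).
Variables (d2 : S2 -> S2 -> R) (val2 : (nat -> B) -> S2) (box2 : seq B -> set S2).
Variable d : S1 * S2 -> S1 * S2 -> R.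
Hypothesis C1 : coding d1 val1 box1.
Hypothesis C2 : coding d2 val2 box2.
Hypothesis d_ge0 : forall p q, 0 <= d p q.
Hypothesis d_sym : forall p q, d p q = d q p.
Hypothesis d_fst : forall p q, d1 p.1 q.1 <= d p q.
Hypothesis d_snd : forall p q, d2 p.2 q.2 <= d p q.
Hypothesis d_le : forall p q, d p q <= d1 p.1 q.1 + d2 p.2 q.2.

(** Letters are paired one by one, so that a finite word codes a product of two cells of the same
    side. *)
Definition prod_val (z : nat -> A * B) : S1 * S2 :=
  (val1 (fun i => (z i).1), val2 (fun i => (z i).2)).

Definition prod_box (u : seq (A * B)) : set (S1 * S2) :=
  box1 (unzip1 u) `*` box2 (unzip2 u).

Lemma prod_coding : coding d prod_val prod_box.
Proof.
split=> //.
- move=> m z; split; rewrite /= ?pre_unzip1 ?pre_unzip2.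
    exact: (coding_box C1).
  exact: (coding_box C2).
- have [c1 c10 H1] := coding_diam C1; have [c2 c20 H2] := coding_diam C2.
  exists (c1 + c2); first exact: addr_gt0.
  move=> u x x' [/= u1 u2] [/= u1' u2'].
  have := H1 _ _ _ u1 u1'; have := H2 _ _ _ u2 u2'; rewrite !size_map => h2 h1.
  by apply: le_trans (d_le _ _) _; rewrite mulrDl lerD.
- move=> C; have [M1 H1] := coding_near C1 C; have [M2 H2] := coding_near C2 C.
  exists (M1 * M2)%N => j u.
  pose f1 (v : j.-tuple (A * B)) : j.-tuple A := map_tuple fst v.
  pose f2 (v : j.-tuple (A * B)) : j.-tuple B := map_tuple snd v.
  pose f v := (f1 v, f2 v).
  have finj : injective f.
    move=> v w E; have /= e1 := congr1 (fun p => tval p.1) E.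
    have /= e2 := congr1 (fun p => tval p.2) E; apply: val_inj => /=.
    by rewrite -(zip_unzip v) -(zip_unzip w) /unzip1 /unzip2 e1 e2.
  rewrite -(card_imset _ finj); apply: leq_trans (leq_mul (H1 j (f1 u)) (H2 j (f2 u))).
  rewrite -cardsX; apply/subset_leq_card/fintype.subsetP => _ /imsetP[v + ->].
  rewrite inE => /asboolP[y [y' [yu yv H]]]; rewrite inE /=;
    apply/andP; split; rewrite inE; apply/asboolP.
    exists (fun i => (y i).1), (fun i => (y' i).1);
    rewrite !size_map -!pre_unzip1 yu yv; split=> //.
    exact: le_trans (d_fst _ _) H.
  exists (fun i => (y i).2), (fun i => (y' i).2); rewrite !size_map -!pre_unzip2 yu yv; split=> //.
  exact: le_trans (d_snd _ _) H.
- move=> u; have -> : prod_box u = fst @^-1` box1 (unzip1 u) `&` snd @^-1` box2 (unzip2 u) by [].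
  have cb1 : closed (box1 (unzip1 u)) := @coding_closed _ _ _ _ _ _ C1 _.
  have cb2 : closed (box2 (unzip2 u)) := @coding_closed _ _ _ _ _ _ C2 _.
  have cf : continuous (@fst S1 S2) by move=> p; exact: cvg_fst.
  have cs : continuous (@snd S1 S2) by move=> p; exact: cvg_snd.
  by apply: closedI; [exact: ((continuous_closedP _).1 cf _ cb1)|
    exact: ((continuous_closedP _).1 cs _ cb2)].
- move=> u a x [h1 h2]; move: h1 h2; rewrite /unzip1 /unzip2 !map_rcons => h1 h2.
  by split; [exact: (coding_nested C1 h1)|exact: (coding_nested C2 h2)].
- move=> y [x1 x2] H; congr pair.
    by apply: (coding_sep C1) => m; have [+ _] := H m; rewrite /= pre_unzip1.
  by apply: (coding_sep C2) => m; have [_ +] := H m; rewrite /= pre_unzip2.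
- move=> U z oU Uz; have : nbhs (prod_val z) U by exact: open_nbhs_nbhs.
  move=> [[P Q] /= [nP nQ] PQ].
  move: nP nQ; rewrite !nbhsE => -[P' [oP' zP'] PP'] [Q' [oQ' zQ'] QQ'].
  have [m1 H1] := coding_open C1 oP' zP'; have [m2 H2] := coding_open C2 oQ' zQ'.
  exists (maxn m1 m2) => -[x1 x2] [/=]; rewrite pre_unzip1 pre_unzip2 => h1 h2.
  apply: PQ; split=> /=.
    by apply/PP'/H1; apply: (box_pre C1 (leq_maxl m1 m2)).
  by apply/QQ'/H2; apply: (box_pre C2 (leq_maxr m1 m2)).
Qed.

End ProductCoding.

(** * Slices and dimension *)

Section Grid.
Context {R : realType} {n : nat}.

Definition grid (m : 'rV[int]_n) : 'rV[R]_n := \row_c (m 0 c)%:~R.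

(* Balls of radius at most 1 centred in [middle z] stay in the box of corner [z] and
   side 4. *)
Definition middle (z : 'rV[R]_n) : set 'rV[R]_n :=
  [set x | forall c, z 0 c + 1 <= x 0 c <= z 0 c + 3].

Lemma grid_middle (x : 'rV[R]_n) : exists m, middle (grid m) x.
Proof.
(* The shift by 1 leaves room for a unit ball below the point. *)
exists (\row_c (Num.floor (x 0 c) - 1)) => c; rewrite !mxE.
have := floor_le (x 0 c); have := floorD1_gt (x 0 c).
by rewrite !intrD /= => h1 h2; apply/andP; split; lra.
Qed.

Lemma middle_range z : middle z `<=` range (dyadic_val z).
Proof.
move=> x zx; apply: dyadic_range => c; have := zx c.
by rewrite /corner /= mul0r expr0; lra.
Qed.

End Grid.

Section SlicesLowerBound.
Context {R : realType} {k n : nat}.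
Implicit Types (B : set ('rV[R]_k * 'rV[R]_n)).

Definition cell_val (z : 'rV[R]_k) (w : 'rV[R]_n) := prod_val (dyadic_val z) (dyadic_val w).
Definition cell_box (z : 'rV[R]_k) (w : 'rV[R]_n) := prod_box (dyadic_box z) (dyadic_box w).

Lemma cell_coding z w : coding eucl_dist_prod (cell_val z w) (cell_box z w).
Proof.
apply: prod_coding (dyadic_coding z) (dyadic_coding w) _ _ _ _ _.
- exact: eucl_dist_prod_ge0.
- exact: eucl_dist_prod_sym.
- exact: eucl_dist_fst.
- exact: eucl_dist_snd.
- exact: eucl_dist_prod_le.
Qed.

Lemma cell_valE z w t y : cell_val z w (pairf t y) = (dyadic_val z t, dyadic_val w y).
Proof. by []. Qed.

Lemma cell_range p : exists m m', middle (grid m) p.1 /\ middle (grid m') p.2 /\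
  range (cell_val (grid m) (grid m')) p.
Proof.
have [m mp] := grid_middle p.1; have [m' mp'] := grid_middle p.2.
exists m, m'; split=> //; split=> //.
have [t _ tp] := middle_range mp; have [y _ yp] := middle_range mp'.
by exists (pairf t y) => //; rewrite cell_valE tp yp -surjective_pairing.
Qed.

(** Stated with contents rather than dimensions so as to include [q = 0], which gives the estimate
    for the projection. *)
Lemma slices_null B (s q : R) (A : set 'rV[R]_k) : 0 < s -> 0 <= q ->
  hausdorff_measure eucl_dist_prod (s + q) B = 0%E ->
  (forall t, A t -> exists m',
    content (ratio q) 0 (dyadic_val (grid m') @^-1` sliceRn B t) <> 0%E) ->
  hausdorff_measure eucl_dist s A = 0%E.
Proof.
move=> s0 q0 B0 AP.
pose F (p : 'rV[int]_k * 'rV[int]_n) := [set x | range (dyadic_val (grid p.1)) x /\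
  content (ratio q) 0 (dyadic_val (grid p.2) @^-1` sliceRn B x) <> 0%E].
apply: (@measure_eq0_bigcup_countable R _ eucl_dist _ s A F).
  move=> x Ax; have [m mx] := grid_middle x; have [m' m'x] := AP _ Ax.
  by exists (m, m') => //; split=> //; exact: middle_range mx.
move=> [m m']; apply: (content_eq0_measure (dyadic_coding (grid m))) => //; first by move=> x [].
have sq : 0 < s + q by rewrite ltr_wpDr.
have := measure_eq0_content (cell_coding (grid m) (grid m')) sq B0.
rewrite ratioD => /(slice_content (ratio_gt0 s) (ratio_gt0 q)) H.
apply/eqP; rewrite eq_le (content_ge0 (ltW (ratio_gt0 s))) andbT -H.
by apply: le_content => t [].
Qed.

(** In exponent 0 every word weighs 1, and at least one word is needed. *)
Lemma content_nonempty (A : finType) (E : set (nat -> A)) : E !=set0 ->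
  content (ratio (0 : R)) 0 E <> 0%E.
Proof.
move=> [y Ey] E0; have : (1 <= content (ratio (0 : R)) 0 E)%E.
  apply: le_ereal_inf_tmp => _ [D [_ DE] <-]; have [m Dm] := DE _ Ey.
  have -> : 1%E = (ratio (0 : R) ^+ size (pre m y))%:E by rewrite /ratio oppr0 powRr0 expr1n.
  exact: (esum_ge_term (fun u => (ratio (0 : R) ^+ size u)%:E)).
by rewrite E0 lee_fin ler10.
Qed.

Lemma measure_slices_null B (s q : R) (A : set 'rV[R]_k) : 0 < s -> 0 <= q ->
  hausdorff_measure eucl_dist_prod (s + q) B = 0%E ->
  (forall t, A t -> (q%:E < hausdorff_dim eucl_dist (sliceRn B t))%E) ->
  hausdorff_measure eucl_dist s A = 0%E.
Proof.
move=> s0 q0 B0 AP; apply: (slices_null s0 q0 B0) => t At; apply: contrapT => H.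
have {}H m' : content (ratio q) 0 (dyadic_val (grid m') @^-1` sliceRn B t) = 0%E.
  by apply: contrapT => H'; apply: H; exists m'.
(* Null content gives null measure in positive exponents only; for [q = 0] it is enough that a slice
   of positive dimension is non-empty. *)
move: q0; rewrite le_eqVlt => /orP[/eqP q0|q0].
  have [x Bx] : sliceRn B t !=set0.
    apply/set0P/eqP => E0; have := AP _ At; rewrite E0 -q0 ltNge => /negP; apply.
    by apply: dim_le => // s' _; exact: hausdorff_measure_set0.
  have [m' m'x] := grid_middle x; have [y _ yx] := middle_range m'x.
  apply: (@content_nonempty _ (dyadic_val (grid m') @^-1` sliceRn B t)); last by rewrite q0.
  by exists y; rewrite /= yx.
have := AP _ At; rewrite ltNge => /negP; apply; apply: dim_le; first exact: ltW.
move=> s' qs; apply: (measure_eq0_exponent (@eucl_dist_ge0 R n) (ltW q0) (ltW qs)).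
apply: (measure_eq0_bigcup_countable (F := fun m => sliceRn B t `&` middle (grid m))) => //.
  by move=> x Bx; have [m mx] := grid_middle x; exists m.
move=> m; apply: (content_eq0_measure (dyadic_coding (grid m))) => //.
  by move=> x [_ /middle_range].
apply/eqP; rewrite eq_le (content_ge0 (ltW (ratio_gt0 q))) andbT -(H m).
by apply: le_content => y [].
Qed.

Lemma measure_proj_null B (s : R) : 0 < s ->
  hausdorff_measure eucl_dist_prod s B = 0%E ->
  hausdorff_measure eucl_dist s (projRk B) = 0%E.
Proof.
move=> s0 B0; apply: (@slices_null B s 0 _ s0 (lexx 0)); first by rewrite addr0.
move=> _ [[t x] Bx <-] /=; have [m' m'x] := grid_middle x; exists m'.
have [y _ yx] := middle_range m'x; apply: content_nonempty.
by exists y; rewrite /= /sliceRn /= yx.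
Qed.

End SlicesLowerBound.

(** * Subsets of exact dimension *)

Section ExactDimension.
Context {R : realType} {A : finType} {S : topologicalType}.
Variables (d : S -> S -> R) (val : (nat -> A) -> S) (box : seq A -> set S).
Hypothesis Cd : coding d val box.
Local Open Scope ereal_scope.

(** Passing from [s] to [s'] gains the factor [ratio (s' - s) ^+ j] on words of length at least [j],
    so sums that merely stay bounded suffice. *)
Lemma measure_eq0_boxes (s s' c : R) E : (0 <= s)%R -> (s < s')%R ->
  (forall j, exists D, [/\ forall u, D u -> (j <= size u)%N,
     E `<=` \bigcup_(u in D) box u &
     \esum_(u in D) (ratio s ^+ size u)%:E <= c%:E]) ->
  hausdorff_measure d s' E = 0.
Proof.
move=> s0 ss H; have [C C0 HC] := premeasure_boxes Cd.
apply/measure_eq0P => delta d0.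
apply/eqP; rewrite eq_le premeasure_ge0 andbT; apply: fin_approx_le => e e0; rewrite add0e.
have ds : (0 < s' - s)%R by rewrite subr_gt0.
have s'0 : (0 <= s')%R by apply: le_trans s0 (ltW ss).
pose c1 := (`|c| + 1)%R; have c10 : (0 < c1)%R by rewrite ltr_wpDl.
have Cs : (0 < C `^ s')%R by exact: powR_gt0.
have [j1 _ j1d] : exists2 j, (0 <= j)%N & (2^-1 ^+ j <= delta / C)%R.
  by apply: exists_small_power; rewrite ?divr_gt0 ?invr_gt0 ?invf_lt1 ?ltr1n.
have [j jj1 je] := exists_small_power (ratio_gt0 _) (ratio_lt1 ds) j1
  (divr_gt0 e0 (mulr_gt0 Cs c10)).
have [D [Dj ED Dc]] := H j.
apply: le_trans (HC s' delta j1 D E s'0 _ _ ED) _.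
- by rewrite mulrC -ler_pdivlMr.
- by move=> u /Dj; exact: leq_trans.
apply: (@le_trans _ _ ((C `^ s')%:E * ((ratio (s' - s) ^+ j)%:E * c1%:E))).
  apply: lee_wpmul2l; first by rewrite lee_fin ltW.
  apply: (@le_trans _ _ ((ratio (s' - s) ^+ j)%:E * \esum_(u in D) (ratio s ^+ size u)%:E)).
    rewrite -esumZl; last 2 first.
    - by rewrite exprn_ge0// ltW// ratio_gt0.
    - by move=> u; rewrite lee_fin exprn_ge0// ltW// ratio_gt0.
    apply: le_esum => u /Dj ju; rewrite -EFinM lee_fin.
    have -> : ratio s' = (ratio (s' - s) * ratio s)%R by rewrite -ratioD subrK.
    rewrite exprMn ler_wpM2r ?(exprn_ge0 _ (ltW (ratio_gt0 _)))//.
    by apply: ler_wiXn2l ju; [exact: ltW (ratio_gt0 _)|exact: ltW (ratio_lt1 ds)].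
  apply: lee_wpmul2l; first by rewrite lee_fin exprn_ge0// ltW// ratio_gt0.
  by apply: le_trans Dc _; rewrite lee_fin /c1; have := ler_norm c; lra.
rewrite -!EFinM lee_fin mulrCA -ler_pdivlMr ?mulr_gt0//.
Qed.

(** A non-null compact subset is trimmed: its content stays non-zero, which keeps the [s]-measure
    positive, while contents bounded at all levels exclude any dimension above [s]. *)
Lemma exact_dim_closed s B : (0 < s)%R -> borel B ->
  content (ratio s) 0 (val @^-1` B) <> 0 ->
  exists B', [/\ B' `<=` B, borel B', hausdorff_measure d s B' <> 0 &
    hausdorff_dim d B' <= s%:E].
Proof.
move=> s0 bB cB.
have [K [cK KB K0]] := suslin_content (ratio_gt0 s) (ratio_lt1 s0)
  (suslin_preimage_borel Cd bB) cB.
have [F [cF FK F0 Fb]] := trim (ratio_gt0 s) (ratio_lt1 s0) cK K0.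
exists (val @` F); split.
- by move=> _ [y /FK/KB By <-].
- exact: (borel_image_closed Cd).
- move=> /(measure_eq0_content Cd s0) H; apply: F0.
  apply/eqP; rewrite eq_le (content_ge0 (ltW (ratio_gt0 s))) andbT -H.
  by apply: le_content => y Fy; exists y.
apply: dim_le; first exact: ltW.
(* Contents are at most 3, so coverings of cost below 4 exist at every level. *)
move=> s' ss; apply: (@measure_eq0_boxes s s' 4); [exact: ltW|exact: ss|].
move=> j; have [|D [Dj DF Dc]] := @content_lt R _ (ratio s) j F 4%:E.
  by apply: le_lt_trans (Fb j) _; rewrite lte_fin ltr_nat.
exists D; split=> //; last exact: ltW.
by move=> _ [y /DF[m Dm] <-]; exists (pre m y) => //; exact: (coding_box Cd).
Qed.

End ExactDimension.

Lemma exact_dim_subset (R : realType) (k n : nat) (B : set ('rV[R]_k * 'rV[R]_n)) (s : R) :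
  0 < s -> borel B -> (s%:E <= hausdorff_dim eucl_dist_prod B)%E ->
  exists B', [/\ B' `<=` B, borel B' & hausdorff_dim eucl_dist_prod B' = s%:E].
Proof.
move=> s0 bB sB.
(* If the [s]-measure vanishes, [B] itself already has dimension [s]. *)
have [B0|B0] := pselect (hausdorff_measure eucl_dist_prod s B = 0%E).
  exists B; split=> //; apply/eqP; rewrite eq_le sB andbT.
  apply: dim_le => [|s' ss]; first exact: ltW.
  exact: (measure_eq0_exponent (@eucl_dist_prod_ge0 R k n) (ltW s0) (ltW ss)).
have [[m m'] Hm] : exists p : 'rV[int]_k * 'rV[int]_n,
    content (ratio s) 0 (cell_val (grid p.1) (grid p.2) @^-1` B) <> 0%E.
  apply: contrapT => H; apply: B0.
  apply: (measure_eq0_bigcup_countable (F := fun p : 'rV[int]_k * 'rV[int]_n =>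
    B `&` range (cell_val (grid p.1) (grid p.2)))).
    by move=> x Bx; have [m [m' [_ [_ xr]]]] := cell_range x; exists (m, m').
  move=> [m m']; apply: (content_eq0_measure (cell_coding (grid m) (grid m')) s0).
    by move=> x [].
  have {}H : content (ratio s) 0 (cell_val (grid m) (grid m') @^-1` B) = 0%E.
    by apply: contrapT => H'; apply: H; exists (m, m').
  apply/eqP; rewrite eq_le (content_ge0 (ltW (ratio_gt0 s))) andbT -H.
  by apply: le_content => y [].
have [B' [B'B bB' B'0 B's]] := exact_dim_closed (cell_coding _ _) s0 bB Hm.
exists B'; split=> //; apply/eqP; rewrite eq_le B's /=.
exact: (dim_ge (@eucl_dist_prod_ge0 R k n)).
Qed.

(** * Net measure on a regular base *)

Section NetMeasure.
Context {R : realType} {A : finType}.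
Variables (a0 : A) (s : R) (T : set (nat -> A)).
Local Open Scope ereal_scope.

Let r0 : (0 <= ratio s)%R := ltW (ratio_gt0 s).

(* The base point [a0] only serves to make the type of paths pointed. *)
Definition pointed_paths (a : A) : Type := nat -> A.

HB.instance Definition _ := gen_eqMixin (pointed_paths a0).
HB.instance Definition _ := gen_choiceMixin (pointed_paths a0).
HB.instance Definition _ := isPointed.Build (pointed_paths a0) (fun=> a0).

(** The dyadic counterpart of the Hausdorff measure restricted to [T]: contents grow with the level,
    so the supremum is their limit. *)
Definition net_measure (E : set (pointed_paths a0)) : \bar R :=
  ereal_sup [set content (ratio s) j (T `&` E) | j in [set: nat]].

Lemma content_le_net j E : content (ratio s) j (T `&` E) <= net_measure E.
Proof. by apply: ereal_sup_ubound; exists j. Qed.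

Lemma net_measure_le (c : \bar R) E : (forall j, content (ratio s) j (T `&` E) <= c) ->
  net_measure E <= c.
Proof. by move=> H; apply: ge_ereal_sup => _ [j _ <-]. Qed.

Let net_measure0 : net_measure set0 = 0.
Proof.
apply/eqP; rewrite eq_le; apply/andP; split.
  by apply: net_measure_le => j; rewrite setI0 content_set0.
exact: le_trans (content_ge0 r0 0 _) (content_le_net 0 _).
Qed.

Let net_measure_ge0 E : 0 <= net_measure E.
Proof. exact: le_trans (content_ge0 r0 0 _) (content_le_net 0 _). Qed.

Let net_measure_subadditive E (F : nat -> set (pointed_paths a0)) :
  E `<=` \bigcup_i F i -> net_measure E <= \sum_(i <oo) net_measure (F i).
Proof.
move=> EF; apply: net_measure_le => j.
apply: (le_trans (@content_bigcup _ _ _ r0 j _ (fun i => T `&` F i) _)).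
  by move=> y [Ty /EF[i _ Fy]]; exists i.
apply: lee_nneseries => [i _ _|i _]; first exact: content_ge0.
exact: content_le_net.
Qed.

HB.instance Definition _ := isSubsetOuterMeasure.Build R (pointed_paths a0) net_measure
  net_measure0 net_measure_ge0 net_measure_subadditive.

Lemma net_measure_words l (P : set (seq A)) :
  caratheodory_measurable net_measure [set y | P (pre l y)].
Proof.
apply: le_caratheodory_measurable => X.
have le_net E E' : E `<=` E' -> net_measure E <= net_measure E'.
  exact: (le_outer_measure net_measure).
have [Xoo|Xfin] := eqVneq (net_measure X) +oo; first by rewrite [leRHS]Xoo leey.
have fin E : E `<=` X -> net_measure E \is a fin_num.
  move=> EX; rewrite ge0_fin_numE//; apply: le_lt_trans (le_net _ _ EX) _.
  by rewrite ltey.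
set X1 := X `&` _; set X2 := X `&` _.
rewrite -leeBrDr; last by apply: fin; exact: subIsetl.
apply: net_measure_le => i; rewrite leeBrDr; last by apply: fin; exact: subIsetl.
have cfin j E : E `<=` X -> content (ratio s) j (T `&` E) \is a fin_num.
  move=> /fin; rewrite !ge0_fin_numE ?content_ge0//.
  exact/le_lt_trans/content_le_net.
rewrite addeC -leeBrDr; last by apply: cfin; exact: subIsetl.
apply: net_measure_le => j; rewrite leeBrDr; last by apply: cfin; exact: subIsetl.
(* Beyond [l] the covering words decide the prefixes of length [l], so the content at level [m]
   splits and dominates those at levels [i] and [j]. *)
rewrite addeC; pose m := maxn l (maxn i j).
have im : (i <= m)%N by rewrite /m !leq_max leqnn !orbT.
have jm : (j <= m)%N by rewrite /m !leq_max leqnn !orbT.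
have lm : (l <= m)%N by rewrite /m leq_max leqnn.
apply: le_trans (content_le_net m X).
apply: le_trans (content_split r0 (T `&` X) P lm).
apply: leeD; [apply: le_trans (content_level _ _ im) _|apply: le_trans (content_level _ _ jm) _].
  by apply: le_content => y [? []].
by apply: le_content => y [? []].
Qed.

End NetMeasure.

Section NetUniformCover.
Context {R : realType} {A B : finType}.
Variables (a0 : A) (s : R) (T : set (nat -> A)).
Local Open Scope ereal_scope.
Local Notation nu := (@net_measure R A a0 s T).
Let om : {outer_measure set (pointed_paths a0) -> \bar R} := nu.
Local Notation X := (caratheodory_type om).
Local Notation mu := ((om : set X -> \bar R) : {measure set X -> \bar R}).

Let mpre (u : seq A) : measurable ([set t | pre (size u) (t : nat -> A) = u] : set X).
Proof. exact: (@net_measure_words R A a0 s T (size u) (fun v => v = u)). Qed.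

Lemma net_sum_words j : \sum_(t : j.-tuple A) nu (cyl t) = nu setT.
Proof.
apply: etrans (sum_measure_pre mpre mu j); apply: eq_bigr => t _.
by congr (om _); apply/seteqP; split=> y; rewrite /cyl /= size_tuple.
Qed.

Lemma net_uniform_cover (q : R) (E : set (nat -> A * B)) : (0 < q)%R ->
  nu setT < +oo -> suslin E ->
  nu [set t | content (ratio q) 0 (slice E t) <> 0] = 0 ->
  forall j (e : R), (0 < e)%R -> exists F : seq B -> set (nat -> A),
    [/\ forall u, (size u < j)%N -> F u = set0,
      forall t y, E (pairf t y) -> exists m, F (pre m y) t &
      \esum_(u in [set: seq B]) ((ratio q ^+ size u)%:E *
        \sum_(t : (size u).-tuple A) nu (F u `&` cyl t)) <= e%:E].
Proof.
move=> q0 nufin [C [cC CE]] E0 j e e0.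
have mufin : mu setT < +oo by [].
have neg b : mu.-negligible [set t : X | content (ratio q) 0
    (bounded_slice (fun t : X => t : nat -> A) C b t) <> 0].
  apply: (negligibleS (A := [set t : X | content (ratio q) 0 (slice E t) <> 0])).
    move=> t /= H H0; apply: H; apply/eqP.
    rewrite eq_le (content_ge0 (ltW (ratio_gt0 q))) andbT -H0.
    by apply: le_content => y [sg [_ Csg]]; rewrite /slice CE; exists sg.
  (* The exceptional set is null for the outer measure, hence Carathéodory measurable. *)
  apply/negligibleP => //; apply: le_caratheodory_measurable => Y.
  have le_nu D D' : D `<=` D' -> om D <= om D' by exact: (le_outer_measure om).
  apply: (@le_trans _ _ (0 + om Y)); last by rewrite add0e.
  by apply: leeD; [rewrite -[leRHS]E0|]; apply: le_nu => y [].
have H := fcontent_eq0 (ratio_gt0 q) (ratio_lt1 q0) mufin mpre cC j neg.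
have /fcontent_lt[F [[mF F0] FE Fe]] : fcontent mu (ratio q) j
    (fun x : X => [set y | exists sg, C (pairf (x : nat -> A) y) sg]) < e%:E.
  by rewrite H lte_fin.
exists F; split=> //.
- by move=> t y; rewrite CE => Ety; apply: FE.
- apply: le_trans (ltW Fe); apply: le_esum => u _.
  apply: lee_wpmul2l; first by rewrite lee_fin exprn_ge0// ltW// ratio_gt0.
  have mc (t : (size u).-tuple A) : measurable (F u `&` (cyl t : set X)).
    by apply: measurableI => //; exact: mpre.
  (* Additivity over the cylinders of length [size u] turns the cost into a sum over products of
     cells of equal side, the form in which cells are kept or discarded. *)
  rewrite [leRHS](_ : _ = mu (\bigcup_(t in [set: (size u).-tuple A]) (F u `&` (cyl t : set X)))).
    rewrite measure_fin_bigcup; [|exact: finite_finset| |by move=> t _; exact: mc].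
      rewrite [leLHS]bigfs ?index_enum_uniq ?set_true//.
      by move=> t _; rewrite mem_index_enum.
    move=> t t' _ _ [x [[_ xt] [_ xt']]]; apply: val_inj.
    by move: xt xt'; rewrite /cyl /= !size_tuple => -> ->.
  congr (mu _); apply/seteqP; split=> x; last by move=> [t _ []].
  have sx : size (pre (size u) (x : nat -> A)) == size u by rewrite size_pre.
  by move=> Fx; exists (Tuple sx) => //; split=> //; rewrite /cyl /= size_pre.
Qed.

Lemma net_bigcup_fin (I : finType) (F : I -> set (nat -> A)) (E : set (nat -> A)) :
  E `<=` \bigcup_i F i -> nu E <= \sum_i nu (F i).
Proof.
move=> EF; have nu0 D : 0 <= nu D by exact: (outer_measure_ge0 om).
pose G k := oapp F set0 (pickle_inv k).
apply: (@le_trans _ _ (nu (\bigcup_k G k))).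
  apply: (le_outer_measure om) => x /EF[i _ Fx].
  by exists (pickle i) => //; rewrite /G pickleK_inv.
apply: le_trans (outer_measure_sigma_subadditive om G) _.
rewrite (eq_eseriesr (g := fun k => oapp (fun i => nu (F i)) 0 (pickle_inv k))); last first.
  by move=> k _; rewrite /G; case: pickle_inv => //=; exact: (outer_measure0 om).
rewrite -esum_pickle//.
have -> : \sum_i nu (F i) = \sum_(i <- enum I) nu (F i) by rewrite big_enum.
by apply: esum_seq_in_le => // i _; rewrite mem_enum.
Qed.

Lemma net_geometric (kap c : R) m E (F : nat -> set (nat -> A)) :
  (0 < kap)%R -> (kap < 1)%R -> (0 <= c)%R -> E `<=` \bigcup_i F i ->
  (forall i, nu (F i) <= (c * kap ^+ (m + i))%:E) ->
  nu E <= (c / (1 - kap) * kap ^+ m)%:E.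
Proof.
move=> k0 k1 c0 EF HF.
apply: (@le_trans _ _ (nu (\bigcup_k F k))); first exact: (le_outer_measure om).
apply: le_trans (outer_measure_sigma_subadditive om F) _.
apply: (@le_trans _ _ (\sum_(i <oo) (c * kap ^+ (m + i))%:E)).
  by apply: lee_nneseries => [i _ _|i _]; [exact: (outer_measure_ge0 om)|exact: HF].
have t0 i : (0 <= c * kap ^+ (m + i))%R by rewrite mulr_ge0// exprn_ge0// ltW.
apply: lime_le; first by apply: is_cvg_nneseries => i _ _; rewrite lee_fin.
apply: nearW => N; rewrite sumEFin lee_fin big_mkord.
under eq_bigr do rewrite exprD mulrA.
rewrite -mulr_sumr [leRHS]mulrAC.
have km : (0 <= c * kap ^+ m)%R by rewrite mulr_ge0// exprn_ge0// ltW.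
have sum_le : (\sum_(i < N) kap ^+ i <= (1 - kap)^-1)%R.
  rewrite -[leRHS]mul1r ler_pdivlMr ?subr_gt0// mulrC.
  have -> : ((1 - kap) * \sum_(i < N) kap ^+ i = 1 - kap ^+ N)%R.
    by have := subrX1 kap N; lra.
  by rewrite gerBl exprn_ge0// ltW.
exact: ler_wpM2l.
Qed.

End NetUniformCover.

(** * Counting the cells of a regular set *)

Section RegularSet.
Context {R : realType} {k : nat}.
Variables (alpha : R) (T : set 'rV[R]_k) (z : 'rV[R]_k).
Hypothesis alpha0 : 0 < alpha.
Hypothesis regT : ahlfors_david_regular alpha T.
Local Notation A := {ffun 'I_k -> bool}.
Local Notation val := (dyadic_val z).
Local Notation T' := (val @^-1` T).
Local Notation nu := (@net_measure R A [ffun=> false] alpha T').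
Local Open Scope ereal_scope.

Let nu_ge0 (E : set (nat -> A)) : 0 <= nu E.
Proof. exact: (outer_measure_ge0 nu). Qed.

Lemma regular_net_finite : nu setT < +oo.
Proof.
have [_ [c [c' [c0 c'0 Tc]]]] := regT.
have [M HM] := content_le_measure (dyadic_coding z).
have [C C0 HC] := coding_diam (dyadic_coding z).
have r0 : (0 <= ratio alpha)%R := ltW (ratio_gt0 alpha).
(* At this level cells have diameter below 1, so the part of [T] in a cell lies in a unit ball
   centred on [T], whose mass regularity bounds. *)
have [l lC] : exists l, (2^-1 ^+ l < C^-1)%R by apply: exists_half_lt; rewrite invr_gt0.
pose K : R := (M%:R * 2 `^ alpha * c')%R.
have K0 : (0 <= K)%R by rewrite !mulr_ge0 ?powR_ge0 ?(ltW c'0).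
apply: (@le_lt_trans _ _ (\sum_(u <- @words A l) K%:E)); last by rewrite sumEFin ltry.
apply: net_measure_le => j; rewrite setIT.
apply: (le_trans (@content_le_sum R A (ratio alpha) (ratio_gt0 alpha) l j T' (@words A l) _)).
  by move=> y _; rewrite mem_words size_pre.
apply: lee_sum => u _.
have [->|/set0P[y0 [Ty0 y0u]]] := eqVneq (T' `&` [set y | pre l y = u]) set0.
  by rewrite content_set0// lee_fin.
apply: (@le_trans _ _ (content (ratio alpha) j (val @^-1` (T `&` eucl_ball (val y0) 1)))).
  apply: le_content => y [Ty yu]; split=> //; rewrite /eucl_ball /=.
  have := HC u (val y0) (val y); rewrite -{1}y0u -{1}yu => /(_ _ _)/le_lt_trans; apply.
  - exact: dyadic_box_val.
  - exact: dyadic_box_val.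
  - by rewrite -y0u size_pre mulrC -ltr_pdivlMr// mul1r.
apply: le_trans (HM _ _ _ alpha0) _.
have -> : K%:E = (M%:R * 2 `^ alpha)%:E * c'%:E by rewrite -EFinM.
apply: lee_wpmul2l.
  by rewrite lee_fin mulr_ge0// powR_ge0.
have /andP[_] := Tc (val y0) 1%R Ty0 (introT andP (conj ltr01 (lexx _))).
by rewrite powR1 mulr1.
Qed.

Definition meets_middle (u : seq A) := exists t,
  pre (size u) t = u /\ (T `&` middle z) (val t).

Lemma ball_middle_range x r : (r <= 1)%R -> middle z x -> eucl_ball x r `<=` range val.
Proof.
move=> r1 zx y xy; apply: dyadic_range => c.
have := le_lt_trans (eucl_dist_coord x y c) (lt_le_trans xy r1).
have /andP[h1 h2] := zx c; rewrite ltr_norml => /andP[h3 h4].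
by rewrite /corner /= mul0r expr0; apply/andP; split; lra.
Qed.

(** Around a point of [T] in a counted cell, lower regularity puts mass of order [2^-(j alpha)] into
    the neighbouring cells. A cell neighbours at most [M] others and the total mass is finite, so
    double counting applies. *)
Lemma regular_count : exists N : R, (0 <= N)%R /\ forall j,
  (#|[set u : j.-tuple A | `[< meets_middle u >]]%SET|%:R * ratio alpha ^+ j <= N)%R.
Proof.
have [_ [c [c' [c0 c'0 Tc]]]] := regT.
have [M HM] := coding_near (dyadic_coding z) 1.
have [C C0 HC] := measure_le_content (dyadic_coding z).
have r0 : (0 <= ratio alpha)%R := ltW (ratio_gt0 alpha).
have nfin : nu setT \is a fin_num by rewrite ge0_fin_numE// regular_net_finite.
exists (C `^ alpha * M%:R * fine (nu setT) / c)%R; split.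
  by rewrite !mulr_ge0 ?powR_ge0 ?invr_ge0 ?(ltW c0) ?fine_ge0.
move=> j; rewrite ler_pdivlMr// -[leLHS]mulrA [in leLHS](mulrC _ c).
set V := [set u : j.-tuple A | _]%SET.
pose N (u : j.-tuple A) := [set v : j.-tuple A | `[< near_words eucl_dist val 1 u v >]]%SET.
have NC (u v : j.-tuple A) : v \in N u -> u \in N v.
  rewrite !finset.in_set => /asboolP H; apply/asboolP; apply: near_words_sym => //.
  by rewrite !size_tuple.
have uV u : u \in V -> (c * ratio alpha ^+ j)%:E <= (C `^ alpha)%:E * \sum_(v in N u) nu (cyl v).
  rewrite finset.in_set => /asboolP[t [tu [Tt zt]]].
  have h1 : (0 < (2^-1 ^+ j : R) <= 1)%R.
    by rewrite exprn_gt0 ?invr_gt0//= exprn_ile1 ?invr_ge0// invf_le1// ler1n.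
  have /andP[+ _] := Tc _ _ Tt h1; rewrite half_powR => /le_trans; apply.
  apply: HC; first exact: ltW.
    by case/andP: h1 => _ h1 x [_ /(ball_middle_range h1 zt)].
  move=> i; pose s : seq (seq A) := map (@tval j A) (enum (N u)).
  apply: (le_trans (@content_le_sum R A (ratio alpha) (ratio_gt0 alpha) j i _ s _)).
    move=> y [Ty ty]; have sy : size (pre j y) == j by rewrite size_pre.
    apply/mapP; exists (Tuple sy) => //; rewrite mem_enum finset.in_set; apply/asboolP.
    exists t, y; split; rewrite ?size_tuple ?mul1r//; last exact: ltW.
    by move: tu; rewrite size_tuple.
  rewrite big_map big_enum /=; apply: lee_sum => v _.
  apply: (le_trans _ (@content_le_net R A [ffun=> false] alpha T' i (cyl v))).
  apply: le_content => y [[Ty _] yv].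
  by split=> //; rewrite /cyl /= size_tuple.
have key : \sum_(u in V) (c * ratio alpha ^+ j)%:E <=
    (C `^ alpha)%:E * (M%:R%:E * nu setT).
  apply: le_trans (lee_sum _ uV) _.
  rewrite -ge0_sume_distrr; last by move=> u _; apply: sume_ge0.
  apply: lee_wpmul2l; first by rewrite lee_fin powR_ge0.
  apply: (@le_trans _ _ (\sum_(u : j.-tuple A) \sum_(v in N u) nu (cyl v))).
    rewrite big_mkcond; apply: lee_sum => u _; case: ifP => // _.
    exact: sume_ge0.
  rewrite (exchange_big_dep xpredT)//= -(@net_sum_words R A [ffun=> false] alpha T' j).
  rewrite ge0_sume_distrr//; apply: lee_sum => v _.
  apply: (@le_trans _ _ (\sum_(u in N v) nu (cyl v))).
    rewrite big_mkcond [leRHS]big_mkcond /=; apply: lee_sum => u _.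
    case: ifPn => [/NC -> //|_]; case: ifP => // _.
  have vfin : nu (cyl v) \is a fin_num.
    rewrite ge0_fin_numE//; apply: le_lt_trans regular_net_finite.
    exact: (le_outer_measure nu).
  rewrite -(fineK vfin) sumEFin sumr_const -EFinM lee_fin -[leLHS]mulr_natl.
  by rewrite ler_wpM2r ?fine_ge0// ler_nat; apply: HM.
move: key; rewrite -(fineK nfin) sumEFin sumr_const -!EFinM lee_fin -[X in (X <= _)%R]mulr_natl.
by rewrite mulrA.
Qed.

End RegularSet.

(** * Removing a null set *)

Section NullCover.
Context {R : realType} {k n : nat}.
Variables (alpha : R) (T : set 'rV[R]_k) (z : 'rV[R]_k) (w : 'rV[R]_n).
Hypothesis alpha0 : 0 < alpha.
Hypothesis regT : ahlfors_david_regular alpha T.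
Local Notation A := {ffun 'I_k -> bool}.
Local Notation D := {ffun 'I_n -> bool}.
Local Notation val := (dyadic_val z).
Local Notation T' := (val @^-1` T).
Local Notation nu := (@net_measure R A [ffun=> false] alpha T').
Local Open Scope ereal_scope.

Let nu_ge0 (E : set (nat -> A)) : 0 <= nu E.
Proof. exact: (outer_measure_ge0 nu). Qed.

Variables (q eta : R).
Hypothesis q0 : (0 < q)%R.
Hypothesis eta0 : (0 < eta)%R.
Let th := (ratio eta * ratio alpha)%R.

Let th0 : (0 < th)%R.
Proof. by rewrite mulr_gt0// ratio_gt0. Qed.

Section Kept.
Variables (F : seq D -> set (nat -> A)) (m : nat).

(* The cells [P x Q] in which the part of [P] where [Q] is used has large measure. *)
Definition kept : set (seq (A * D)) :=
  [set u | (th ^+ size u)%:E <= nu (F (unzip2 u) `&` cyl (unzip1 u)) /\ (m <= size u)%N].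

(** Markov's inequality cell by cell: in a kept cell of level [j], [th ^+ j] is at most the measure,
    so the weight [(ratio q * th) ^+ j] is at most its share of the cost of [F]. *)
Lemma kept_sum :
  \esum_(u in [set: seq D]) ((ratio q ^+ size u)%:E *
    \sum_(t : (size u).-tuple A) nu (F u `&` cyl t)) <= 1 ->
  \esum_(u in kept) (ratio (alpha + q + eta) ^+ size u)%:E <= 1.
Proof.
move=> H; apply: le_trans H.
pose h (u : seq (A * D)) := (ratio q ^+ size u)%:E * nu (F (unzip2 u) `&` cyl (unzip1 u)).
have rq u : 0 <= (ratio q ^+ u)%:E :> \bar R.
  by rewrite lee_fin exprn_ge0// ltW// ratio_gt0.
have h0 u : 0 <= h u by rewrite mule_ge0.
apply: (@le_trans _ _ (\esum_(u in [set: seq (A * D)]) h u)).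
  apply: (@le_trans _ _ (\esum_(u in kept) h u)); last exact: esum_le_subset.
  apply: le_esum => u [ku _]; rewrite /h.
  have -> : ratio (alpha + q + eta) = (ratio q * th)%R by rewrite !ratioD /th; ring.
  by rewrite exprMn EFinM; apply: lee_wpmul2l.
rewrite -(esum_fibers (@unzip2 A D))//; apply: le_esum => v _.
pose s : seq (seq (A * D)) :=
    map (fun t : (size v).-tuple A => zip t v) (enum {: (size v).-tuple A}).
apply: le_trans (esum_seq_in_le (s := s) h0 _) _.
  move=> u [_ /= uv]; have su : size (unzip1 u) == size v by rewrite -uv !size_map.
  apply/mapP; exists (Tuple su); first by rewrite mem_enum.
  by rewrite /= -uv zip_unzip.
rewrite big_map big_enum /= ge0_sume_distrr//; apply: lee_sum => t _.
have st : size t = size v by rewrite size_tuple.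
rewrite /h unzip1_zip ?unzip2_zip ?st// size_zip st minnn.
by [].
Qed.

End Kept.

Section Discarded.
Variables (f : 'rV[R]_k -> 'rV[R]_n).
Hypothesis lipf : eucl_lipschitz f.

Definition graph_meets (P : seq A) (Q : seq D) := exists t y,
  [/\ pre (size P) t = P, pre (size Q) y = Q & dyadic_val w y = f (val t)].

(** Over a cell of level [j] a Lipschitz map varies by a multiple of [2^-j], so all cells [Q] met by
    the graph there are near a single one of them. *)
Lemma graph_count : exists M : nat, forall j (P : j.-tuple A),
  (#|[set Q : j.-tuple D | `[< graph_meets P Q >]]%SET| <= M)%N.
Proof.
have [L HL] := lipf; have [C C0 HC] := coding_diam (dyadic_coding z).
have [N HN] : exists N : nat, (`|L| * C <= N%:R)%R.
  exists (Num.bound (`|L| * C)); apply/ltW/archi_boundP.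
  by rewrite mulr_ge0// ltW.
have [M HM] := coding_near (dyadic_coding w) N; exists M => j P.
have [G0|/set0Pn[Q0]] := eqVneq [set Q : j.-tuple D | `[< graph_meets P Q >]]%SET finset.set0.
  by rewrite G0 cards0.
rewrite finset.in_set => /asboolP[t0 [y0 [t0P y0Q f0]]].
apply: leq_trans (HM j Q0); apply/subset_leq_card/fintype.subsetP => Q.
rewrite !finset.in_set => /asboolP[t [y [tP yQ ft]]]; apply/asboolP.
exists y0, y; split=> //; rewrite f0 ft size_tuple.
apply: le_trans (HL _ _) _; apply: le_trans (_ : `|L| * (C * 2^-1 ^+ j) <= _)%R; last first.
  by rewrite mulrA ler_wpM2r// exprn_ge0// invr_ge0.
apply: (@le_trans _ _ (`|L| * eucl_dist (val t0) (val t))%R).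
  by rewrite ler_wpM2r ?eucl_dist_ge0// ler_norm.
rewrite ler_wpM2l//; have := HC P (val t0) (val t); rewrite size_tuple; apply.
  by rewrite -t0P; exact: dyadic_box_val.
by rewrite -tP; exact: dyadic_box_val.
Qed.

Variable F : nat -> seq D -> set (nat -> A).

Definition discarded (m j : nat) (p : j.-tuple A * j.-tuple D) :=
  [/\ meets_middle T z p.1, graph_meets p.1 p.2 &
    nu (F m p.2 `&` cyl p.1) < (th ^+ j)%:E].

Definition discarded_set m j : set (nat -> A) :=
  \bigcup_(p : j.-tuple A * j.-tuple D)
    (if `[< discarded m p >] then F m p.2 `&` cyl p.1 else set0).

(** The growth [2^(j alpha)] of the number of base cells cancels the factor [ratio alpha ^+ j] of
    the threshold, and [ratio eta ^+ j] remains. *)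
Lemma discarded_measure : exists2 c : R, (0 <= c)%R & forall m j,
  nu (discarded_set m j) <= (c * ratio eta ^+ j)%:E.
Proof.
have [N [N0 HN]] := regular_count z alpha0 regT; have [M HM] := graph_count.
exists (N * M%:R)%R; first by rewrite mulr_ge0.
move=> m j; apply: le_trans (@net_bigcup_fin R A [ffun=> false] alpha T' _
  (fun p => if `[< discarded m p >] then F m p.2 `&` cyl p.1 else set0) _ (fun _ h => h)) _.
have thj : (0 <= th ^+ j)%R by rewrite exprn_ge0// ltW.
pose V := [set u : j.-tuple A | `[< meets_middle T z u >]]%SET.
pose G (P : j.-tuple A) := [set Q : j.-tuple D | `[< graph_meets P Q >]]%SET.
apply: (@le_trans _ _ (\sum_(p : j.-tuple A * j.-tuple D)
    (if (p.1 \in V) && (p.2 \in G p.1) then th ^+ j else 0)%R%:E)).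
  apply: lee_sum => p _; case: asboolP => [[pV pG /ltW pl]|_].
    have -> : p.1 \in V by rewrite finset.in_set; apply/asboolP.
    by have -> : p.2 \in G p.1 by rewrite finset.in_set; apply/asboolP.
  have -> : nu set0 = 0 by exact: (outer_measure0 nu).
  by rewrite lee_fin; case: ifP.
rewrite sumEFin lee_fin.
rewrite -(pair_bigA _ (fun P Q => if (P \in V) && (Q \in G P) then th ^+ j else 0)%R) /=.
apply: (@le_trans _ _ (\sum_(P in V) (M%:R * th ^+ j))%R).
  rewrite [leRHS]big_mkcond; apply: ler_sum => P _; case: ifP => PV /=; last by rewrite big1.
  rewrite -big_mkcond /= sumr_const -[leLHS]mulr_natl ler_wpM2r// ler_nat.
  exact: HM.
rewrite sumr_const -[leLHS]mulr_natl /th exprMn.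
have := HN j; rewrite -/V => HV.
have -> : (#|V|%:R * (M%:R * (ratio eta ^+ j * ratio alpha ^+ j)) =
  (#|V|%:R * ratio alpha ^+ j) * (M%:R * ratio eta ^+ j))%R by ring.
have Me : (0 <= M%:R * ratio eta ^+ j)%R by rewrite mulr_ge0// exprn_ge0// ltW// ratio_gt0.
by rewrite -[leRHS]mulrA ler_wpM2r.
Qed.

(** Borel-Cantelli in two steps: since [j >= m], summing over [j] and then over [m >= M] gives two
    geometric series, with a tail in [ratio eta ^+ M]. *)
Lemma discarded_null (W : set (nat -> A)) :
  (forall t m0, W t -> exists m j, [/\ (m0 <= m)%N, (m <= j)%N & discarded_set m j t]) ->
  nu W = 0.
Proof.
move=> HW; have [c c0 Hc] := discarded_measure.
have e1 := ratio_lt1 eta0; have e0 := ratio_gt0 eta.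
pose Wm m := \bigcup_i discarded_set m (m + i).
pose c1 := (c / (1 - ratio eta))%R; pose c2 := (c1 / (1 - ratio eta))%R.
have c10 : (0 <= c1)%R by rewrite mulr_ge0// invr_ge0 subr_ge0 ltW.
have c20 : (0 <= c2)%R by rewrite mulr_ge0// invr_ge0 subr_ge0 ltW.
have Wm_le m : nu (Wm m) <= (c1 * ratio eta ^+ m)%:E.
  exact: (net_geometric (F := fun i => discarded_set m (m + i)) e0 e1 c0).
apply/eqP; rewrite eq_le nu_ge0 andbT; apply: fin_approx_le => e epos; rewrite add0e.
have [|M _ HM] := exists_small_power e0 e1 0 (e := (e / (c2 + 1))%R).
  by rewrite divr_gt0// ltr_wpDl.
apply: (@le_trans _ _ (c2 * ratio eta ^+ M)%:E).
  apply: (net_geometric (F := fun i => Wm (M + i)%N) e0 e1 c10) => //.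
  move=> t Wt; have [m [j [Mm mj tj]]] := HW t M Wt.
  by exists (m - M)%N => //; exists (j - m)%N => //; rewrite !subnKC.
rewrite lee_fin; apply: (@le_trans _ _ (c2 * (e / (c2 + 1)))%R); first by rewrite ler_wpM2l.
by rewrite mulrCA ler_piMr ?(ltW epos)// ler_pdivrMr ?ltr_wpDl// mul1r lerDl.
Qed.

End Discarded.

End NullCover.

Section NullCoverPiece.
Context {R : realType} {k n : nat}.
Variables (alpha : R) (T : set 'rV[R]_k) (z : 'rV[R]_k) (w : 'rV[R]_n).
Hypothesis alpha0 : 0 < alpha.
Hypothesis regT : ahlfors_david_regular alpha T.
Local Notation A := {ffun 'I_k -> bool}.
Local Notation D := {ffun 'I_n -> bool}.
Local Notation val := (dyadic_val z).
Local Notation T' := (val @^-1` T).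
Local Notation nu := (@net_measure R A [ffun=> false] alpha T').
Local Open Scope ereal_scope.

Lemma slices_net_null (B : set ('rV[R]_k * 'rV[R]_n)) (q q' : R) :
  (0 <= q)%R -> (q < q')%R ->
  hausdorff_measure eucl_dist alpha
    [set t | q%:E < hausdorff_dim eucl_dist (sliceRn B t)] = 0 ->
  nu [set t | content (ratio q') 0 (slice (cell_val z w @^-1` B) t) <> 0] = 0.
Proof.
move=> q0 qq' HN; have q'0 : (0 < q')%R := le_lt_trans q0 qq'.
apply/eqP; rewrite eq_le (outer_measure_ge0 nu) andbT; apply: net_measure_le => j.
rewrite -[leRHS](@content_null_level R A (ratio alpha) (ltW (ratio_gt0 alpha)) j _ (ratio_gt0 alpha)
  (ratio_lt1 alpha0) (measure_eq0_content (dyadic_coding z) alpha0 HN)).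
apply: le_content => t [_ /= ct] /=; rewrite ltNge; apply/negP => dq; apply: ct.
have H0 : hausdorff_measure eucl_dist q' (sliceRn B (val t)) = 0.
  by apply: (dim_lt_eq0 (@eucl_dist_ge0 R n)); apply: le_lt_trans dq _; rewrite lte_fin.
exact: (measure_eq0_content (dyadic_coding w) q'0 H0).
Qed.

Lemma regular_null_cover (B : set ('rV[R]_k * 'rV[R]_n)) (q q' eta : R) :
  (0 <= q)%R -> (q < q')%R -> (0 < eta)%R -> borel B ->
  hausdorff_measure eucl_dist alpha
    [set t | q%:E < hausdorff_dim eucl_dist (sliceRn B t)] = 0 ->
  exists L, [/\ borel L,
    forall s, (alpha + q' + eta < s)%R -> hausdorff_measure eucl_dist_prod s L = 0 &
    forall f, eucl_lipschitz f -> hausdorff_measure eucl_dist alpha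
      [set x | [/\ T x, middle z x, middle w (f x), B (x, f x) & ~ L (x, f x)]] = 0].
Proof.
move=> q0 qq' eta0 bB HN; have q'0 : (0 < q')%R := le_lt_trans q0 qq'.
have Cd := cell_coding z w.
have sus := suslin_preimage_borel Cd bB.
have nul := slices_net_null q0 qq' HN.
have nufin := regular_net_finite z alpha0 regT.
have /choice[F FP] (m : nat) := net_uniform_cover q'0 nufin sus nul m ltr01.
pose K m := kept alpha T z eta (F m) m.
have K1 m : \esum_(u in K m) (ratio (alpha + q' + eta) ^+ size u)%:E <= 1.
  by apply: kept_sum; have [_ _] := FP m.
pose Lm m := \bigcup_(u : seq (A * D)) (if `[< K m u >] then cell_box z w u else set0).
(* A lower limit: each intersection is covered by the kept cells of every later [m], with sums at
   most 1, while a graph point of [B] outside [L] misses [Lm m] for infinitely many [m], each time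
   through a discarded cell. *)
pose L := \bigcup_m0 \bigcap_i Lm (m0 + i)%N.
have aqe : (0 <= alpha + q' + eta)%R by rewrite !addr_ge0// ltW.
exists L; split.
- apply: borel_bigcup => m0; apply: borel_bigcap => i; apply: borel_bigcup_countable => u.
  case: ifP => _; first by apply: borel_closed; exact: (@coding_closed _ _ _ _ _ _ Cd u).
  by have [b0 _ _] := sigma_borel ('rV[R]_k * 'rV[R]_n)%type.
- move=> s aqs.
  apply: (measure_eq0_bigcup (F := fun m0 => \bigcap_i Lm (m0 + i)%N)) => // m0.
  apply: (measure_eq0_boxes Cd (c := 1%R) aqe aqs) => j; exists (K (m0 + j)%N); split.
  + by move=> u [_]; apply: leq_trans; exact: leq_addl.
  + move=> x /(_ j Logic.I)[u _]; case: asboolP => // Ku bu; by exists u.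
  + exact: K1.
move=> f lipf; set W := [set x | _].
apply: (content_eq0_measure (dyadic_coding z) alpha0) => [x [_ /middle_range]//|].
apply/eqP; rewrite eq_le (content_ge0 (ltW (ratio_gt0 alpha))) andbT.
have Wnull : nu (val @^-1` W) = 0.
  apply: (discarded_null alpha0 regT (w := w) eta0 lipf (F := F)) => t m0 [Tt zt wft Bt Lt].
  have [y _ yft] := middle_range wft.
  have [m m0m Ly] : exists2 m, (m0 <= m)%N & ~ Lm m (val t, f (val t)).
    apply: contrapT => H; apply: Lt; exists m0 => // i _; apply: contrapT => H'.
    by apply: H; exists (m0 + i)%N => //; exact: leq_addr.
  have [F0 Fc _] := FP m.
  have [|j Fj] := Fc t y; first by rewrite /preimage /= cell_valE yft.
  have mj : (m <= j)%N.
    by rewrite leqNgt; apply/negP => jm; move: Fj; rewrite F0 ?size_pre.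
  have sP : size (pre j t) == j by rewrite size_pre.
  have sQ : size (pre j y) == j by rewrite size_pre.
  exists m, j; split=> //; exists (Tuple sP, Tuple sQ) => //.
  rewrite asboolT; first by split=> //; rewrite /cyl /= size_pre.
  split.
  + by exists t; rewrite /= size_pre.
  + by exists t, y; rewrite /= !size_pre.
  + rewrite ltNge; apply/negP => Hk; apply: Ly; exists (pre j (pairf t y)) => //.
    rewrite asboolT.
      by rewrite -yft -cell_valE; exact: (coding_box Cd).
    by rewrite /K /kept /= pre_unzip1 pre_unzip2 size_pre.
apply: (@le_trans _ _ (nu (val @^-1` W))); last by rewrite Wnull.
apply: le_trans (@content_le_net R A [ffun=> false] alpha T' 0 (val @^-1` W)).
by apply: le_content => t Wt; split=> //; case: Wt.
Qed.

End NullCoverPiece.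

(** * Essential supremum and the lower bound for the dimension *)

Section EssSup.
Context {R : realType} {k n : nat}.
Implicit Types (B : set ('rV[R]_k * 'rV[R]_n)).
Local Open Scope ereal_scope.

Lemma dim_fin_num B : hausdorff_dim eucl_dist_prod B \is a fin_num.
Proof.
(* There are [N ^ j] words of length [j], and [N <= 2 ^ N] makes the exponent [N] large enough. *)
pose N : nat := #|{: {ffun 'I_k -> bool} * {ffun 'I_n -> bool}}|.
have d0 := @eucl_dist_prod_ge0 R k n.
suff H : hausdorff_measure eucl_dist_prod N.+1%:R B = 0.
  rewrite ge0_fin_numE ?dim_ge0//; apply: (@le_lt_trans _ _ N.+1%:R%:E); last exact: ltry.
  apply: (dim_le (ler0n R N.+1)) => s ss.
  exact: (measure_eq0_exponent d0 (ler0n R N.+1) (ltW ss) H).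
apply: (measure_eq0_bigcup_countable (F := fun p : 'rV[int]_k * 'rV[int]_n =>
    B `&` range (cell_val (grid p.1) (grid p.2)))).
  by move=> x Bx; have [m [m' [_ [_ xr]]]] := cell_range x; exists (m, m').
move=> [m m']; rewrite /=.
have N1 : (N%:R < N.+1%:R :> R)%R by rewrite ltr_nat.
apply: (@measure_eq0_sub R _ _ _ _ (range (cell_val (grid m) (grid m')))) => [x []//|].
apply: (measure_eq0_boxes (cell_coding (grid m) (grid m')) (c := 1%R) _ N1) => // j.
exists [set` words j]; split.
- by move=> u /=; rewrite mem_words => /eqP ->.
- move=> _ [y _ <-]; exists (pre j y); last exact: (coding_box (cell_coding _ _)).
  by rewrite /= mem_words size_pre.
apply: le_trans (esum_seq_le _ _) _.
  by move=> u; rewrite lee_fin exprn_ge0// ltW// ratio_gt0.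
rewrite big_map big_enum /= (eq_bigr (fun=> (ratio N%:R ^+ j)%:E)); last first.
  by move=> t _; rewrite size_tuple.
rewrite sumEFin sumr_const lee_fin -[leLHS]mulr_natl card_tuple natrX -exprMn.
apply: exprn_ile1; first by rewrite mulr_ge0// ltW// ratio_gt0.
rewrite -/N /ratio powRN powR_mulrn// ler_pdivrMr ?exprn_gt0// mul1r -natrX ler_nat.
exact/ltnW/ltn_expl.
Qed.

Lemma ess_sup_dim_at_ge0 s B : 0 <= ess_sup_dim_at s B.
Proof. by rewrite /ess_sup_dim_at le_max lexx. Qed.

Lemma ess_sup_dim_at_le s B : (0 < s)%R ->
  hausdorff_measure eucl_dist s (projRk B) <> 0 ->
  s%:E + ess_sup_dim_at s B <= hausdorff_dim eucl_dist_prod B.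
Proof.
move=> s0 Bs; rewrite -leeBrDl//.
have dge t : hausdorff_measure eucl_dist_prod t B <> 0 -> t%:E <= hausdorff_dim eucl_dist_prod B.
  by apply: dim_ge; exact: eucl_dist_prod_ge0.
rewrite ge_max; apply/andP; split.
  rewrite leeBrDl// adde0; apply: dge => B0; apply: Bs.
  exact: measure_proj_null.
apply: ge_ereal_sup => _ [q [q0 Hq] <-].
rewrite leeBrDl// -EFinD; apply: dge => B0; move: Hq.
by rewrite (measure_slices_null s0 q0 B0) ?ltxx.
Qed.

Lemma ess_sup_dim_at_mono s s' B : (0 <= s)%R -> (s <= s')%R ->
  ess_sup_dim_at s' B <= ess_sup_dim_at s B.
Proof.
move=> s0 ss'; rewrite /ess_sup_dim_at ge_max le_max lexx /= le_max; apply/orP; right.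
apply: ereal_sup_le => _ [q [q0 Hq] <-]; exists q; last by [].
split; first exact: q0.
rewrite lt_def hausdorff_measure_ge0 andbT; apply/eqP => H.
by move: Hq; rewrite (measure_eq0_exponent (@eucl_dist_ge0 R k) s0 ss' H) ltxx.
Qed.

Lemma ess_sup_dim_bounds (alpha : R) B : (0 < alpha)%R ->
  hausdorff_dim eucl_dist (projRk B) = alpha%:E ->
  0 <= ess_sup_dim B /\ alpha%:E + ess_sup_dim B <= hausdorff_dim eucl_dist_prod B.
Proof.
move=> a0 dB; rewrite /ess_sup_dim dB /=; case: ifPn => [Bp|_].
  have Ba : hausdorff_measure eucl_dist alpha (projRk B) <> 0 by move=> H; rewrite H ltxx in Bp.
  by split; [exact: ess_sup_dim_at_ge0|exact: ess_sup_dim_at_le].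
pose g (e : R) := ess_sup_dim_at (alpha - e)%R B.
have ng : {in Interval (BRight 0%R) (BLeft alpha) &, nondecreasing_fun g}.
  move=> e e'; rewrite !in_itv /= => /andP[_ ea] /andP[_ e'a] ee'.
  by apply: ess_sup_dim_at_mono; [rewrite subr_ge0 ltW|rewrite lerB].
have a0' : (BRight 0%R < BLeft alpha)%O by rewrite bnd_simp.
(* The essential supremum decreases with the exponent, so the limit at [0+] is an infimum, bounded
   by any single term. *)
have /cvg_lim -> // := @nondecreasing_at_right_cvge R g 0%R (BLeft alpha) a0' ng.
have lge0 : 0 <= ereal_inf [set g x | x in [set` Interval (BRight 0%R) (BLeft alpha)]].
  by apply: le_ereal_inf_tmp => _ [e _ <-]; exact: ess_sup_dim_at_ge0.
split=> //; apply: fin_approx_le => e e0.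
(* At most [e], the error allowed in the end, and at most [alpha / 2], so that the exponent
   [alpha - e'] stays positive. *)
pose e' : R := Num.min e (alpha / 2)%R.
have e'0 : (0 < e')%R by rewrite lt_min e0 divr_gt0.
have e'a : (e' < alpha)%R.
  by rewrite gt_min ltr_pdivrMr// ltr_pMr// ltr1n orbT.
apply: (@le_trans _ _ (alpha%:E + g e')).
  apply: leeD => //; apply: ereal_inf_lbound; exists e' => //.
  by rewrite /= in_itv /= e'0.
have Be : hausdorff_measure eucl_dist (alpha - e')%R (projRk B) <> 0.
  move=> H; have : hausdorff_dim eucl_dist (projRk B) <= (alpha - e')%:E.
    apply: ereal_inf_lbound; exists (alpha - e')%R => //; split=> //.
    by rewrite subr_ge0 ltW.
  by rewrite dB lee_fin lerBrDr gerDl leNgt e'0.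
have ae : (0 < alpha - e')%R by rewrite subr_gt0.
have := leeD2l e'%:E (ess_sup_dim_at_le ae Be).
have E : (e' + (alpha - e') = alpha)%R by rewrite addrC subrK.
rewrite addeA -EFinD E -/(g e') => /le_trans; apply.
by rewrite addeC; apply: leeD => //; rewrite lee_fin ge_min lexx.
Qed.

End EssSup.

(** * Assembling the removed set *)

Lemma Gamma_null_sub (R : realType) (k n : nat) (alpha : R)
    (G G' : set ('rV[R]_k * 'rV[R]_n)) :
  G `<=` G' -> Gamma_null alpha G' -> Gamma_null alpha G.
Proof. by move=> GG' G0 f /G0; apply: measure_eq0_sub => t /GG'. Qed.

Lemma borel_setU (T : topologicalType) (E F : set T) :
  borel E -> borel F -> borel (E `|` F).
Proof.
move=> bE bF; rewrite (_ : E `|` F = \bigcup_(b : bool) (if b then E else F)).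
  by apply: borel_bigcup_countable => -[].
by apply/seteqP; split=> [x [?|?]|x [[] _ ?]]; [exists true|exists false|left|right].
Qed.

Lemma borel_setD (T : topologicalType) (E F : set T) :
  borel E -> borel F -> borel (E `\` F).
Proof.
move=> bE bF; rewrite setDE -(setCK (E `&` _)) setCI setCK.
exact: (borel_setC (borel_setU (borel_setC bE) bF)).
Qed.

(** Sparing [B'] as well as [C] keeps the removed set null by monotonicity, and lifts the dimension
    of the rest, to which [C] contributes at most [s], to exactly [s]. *)
Lemma Gamma_null_removal (R : realType) (k n : nat) (alpha s : R)
    (B C : set ('rV[R]_k * 'rV[R]_n)) : 0 < s -> borel B -> borel C ->
  (s%:E <= hausdorff_dim eucl_dist_prod B)%E ->
  (forall s', s < s' -> hausdorff_measure eucl_dist_prod s' C = 0%E) ->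
  Gamma_null alpha (B `\` C) ->
  exists G, [/\ Gamma_null alpha G, borel G, G `<=` B &
    hausdorff_dim eucl_dist_prod (B `\` G) = s%:E].
Proof.
move=> s0 bB bC sB C0 BC.
have [B' [B'B bB' dB']] := exact_dim_subset s0 bB sB.
exists (B `\` (C `|` B')); split.
- by apply: Gamma_null_sub BC => x [Bx CB']; split=> // Cx; apply: CB'; left.
- exact: (borel_setD bB (borel_setU bC bB')).
- exact: subDsetl.
apply/eqP; rewrite eq_le; apply/andP; split; last first.
  rewrite -[leLHS]dB'; apply: le_dim => x B'x; split; first exact: B'B.
  by move=> [_ H]; apply: H; right.
apply: dim_le; first exact: ltW.
move=> s' ss'; apply: (@measure_eq0_bigcup_countable R _ _ bool _ _ (fun b => if b then C else B')).
  move=> x [Bx H]; have [CBx|CBx] := pselect ((C `|` B') x); last by exfalso; apply: H.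
  by case: CBx => ?; [exists true|exists false].
case; first exact: C0.
apply: (dim_lt_eq0 (@eucl_dist_prod_ge0 R k n)).
by rewrite dB' lte_fin.
Qed.

Section NullComplement.
Context {R : realType} {k n : nat}.
Variables (alpha : R) (T : set 'rV[R]_k) (B : set ('rV[R]_k * 'rV[R]_n)) (q : R).
Hypothesis alpha0 : 0 < alpha.
Hypothesis regT : ahlfors_david_regular alpha T.
Hypothesis BT : B `<=` T `*` setT.
Hypothesis bB : borel B.
Hypothesis q0 : 0 <= q.
Hypothesis Hq : forall q', q < q' ->
  hausdorff_measure eucl_dist alpha
    [set t | (q'%:E < hausdorff_dim eucl_dist (sliceRn B t))%E] = 0%E.

(** The sets for all pairs of grid cells are united at precision [2^-i], then intersected over [i]:
    the dimension drops to [alpha + q], and on a graph the complement remains a countable union of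
    null sets. *)
Lemma regular_null_complement : exists C, [/\ borel C,
  forall s, alpha + q < s -> hausdorff_measure eucl_dist_prod s C = 0%E &
  Gamma_null alpha (B `\` C)].
Proof.
pose I := ('rV[int]_k * 'rV[int]_n)%type.
pose e (i : nat) : R := 2^-1 ^+ i.
have e0 i : 0 < e i by rewrite exprn_gt0// invr_gt0.
have /choice[L LP] (p : nat * I) : exists L, [/\ borel L,
    forall s, alpha + (q + 2 * e p.1) + e p.1 < s ->
      hausdorff_measure eucl_dist_prod s L = 0%E &
    forall f, eucl_lipschitz f -> hausdorff_measure eucl_dist alpha
      [set x | [/\ T x, middle (grid p.2.1) x, middle (grid p.2.2) (f x), B (x, f x) &
         ~ L (x, f x)]] = 0%E].
  have ep := e0 p.1.
  (* Nullity is known only above [q], hence [q + e]; the gap up to [q + 2 * e] and the loss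
     [eta = e] make a total excess of [3 * e], whence the division by 3 below. *)
  apply: (@regular_null_cover R k n alpha T _ _ alpha0 regT B (q + e p.1)) => //.
  - by rewrite addr_ge0// ltW.
  - by lra.
  - by apply: Hq; rewrite ltrDl.
pose C i := \bigcup_(p : I) L (i, p).
exists (\bigcap_i C i); split.
- by apply: borel_bigcap => i; apply: borel_bigcup_countable => p; case: (LP (i, p)).
- move=> s qs; have ds : 0 < (s - (alpha + q)) / 3 by rewrite divr_gt0// subr_gt0.
  have [i ilt] := exists_half_lt ds.
  apply: (@measure_eq0_sub _ _ _ _ _ (C i)) => [x /(_ i)|]; first exact.
  apply: (measure_eq0_bigcup_countable (F := fun p : I => L (i, p))) => // p.
  by have [_ H _] := LP (i, p); apply: H => /=; move: ilt; rewrite -/(e i); lra.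
move=> f lipf.
apply: (measure_eq0_bigcup_countable (F := fun p : nat * I =>
    [set x | [/\ T x, middle (grid p.2.1) x, middle (grid p.2.2) (f x), B (x, f x) &
         ~ L p (x, f x)]])); last by move=> p; have [_ _] := LP p; apply.
move=> x [Bx Cx].
have [i Ci] : exists i, ~ C i (x, f x).
  by apply: contrapT => H; apply: Cx => i _; apply: contrapT => H'; apply: H; exists i.
have [m mx] := grid_middle x; have [m' m'x] := grid_middle (f x).
exists (i, (m, m')) => //; split=> //; first by have [] := BT Bx.
by move=> Lx; apply: Ci; exists (m, m').
Qed.

End NullComplement.

Theorem theorem2p12 (R : realType) (n k : nat) (alpha : R)
    (T : set 'rV[R]_k) (B : set ('rV[R]_k * 'rV[R]_n)) :
  (0 < n)%N -> (0 < k)%N -> 0 < alpha <= k%:R ->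
  ahlfors_david_regular alpha T ->
  B `<=` T `*` setT -> borel B ->
  hausdorff_dim eucl_dist (projRk B) = alpha%:E ->
  exists G : set ('rV[R]_k * 'rV[R]_n),
    [/\ Gamma_null alpha G, borel G, G `<=` B &
      hausdorff_dim eucl_dist_prod (B `\` G) = (alpha%:E + ess_sup_dim B)%E].
Proof.
move=> _ _ /andP[alpha0 _] regT BT bB dB.
have [e0 eB] := ess_sup_dim_bounds alpha0 dB.
have efin : ess_sup_dim B \is a fin_num.
  rewrite ge0_fin_numE//; apply: (@le_lt_trans _ _ (hausdorff_dim eucl_dist_prod B)).
    by apply: le_trans eB; rewrite leeDr// lee_fin ltW.
  by rewrite -ge0_fin_numE ?dim_ge0// dim_fin_num.
have [q qE] : exists q : R, ess_sup_dim B = q%:E by exists (fine (ess_sup_dim B)); rewrite fineK.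
have q0 : 0 <= q by rewrite -lee_fin -qE.
rewrite qE -EFinD; rewrite qE -EFinD in eB.
have s0 : 0 < alpha + q by rewrite ltr_wpDr.
(* With an [alpha]-null projection all of [B] is null on graphs and [C] can be empty, so the limit
   form of the essential supremum enters only through the lower bound. *)
have [pB|pB] := pselect (hausdorff_measure eucl_dist alpha (projRk B) = 0%E).
  apply: (@Gamma_null_removal R k n alpha _ B set0) => //.
  - by have [] := sigma_borel ('rV[R]_k * 'rV[R]_n)%type.
  - by move=> s _; exact: hausdorff_measure_set0.
  move=> f _; apply: measure_eq0_sub pB => t [Bt _].
  by exists (t, f t).
have [C [bC C0 BC]] : exists C, [/\ borel C,
    forall s, alpha + q < s -> hausdorff_measure eucl_dist_prod s C = 0%E &
    Gamma_null alpha (B `\` C)].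
  apply: (regular_null_complement alpha0 regT BT bB q0) => q' qq'.
  apply: contrapT => H.
  have pos E : hausdorff_measure eucl_dist alpha E <> 0%E ->
      (0 < hausdorff_measure (@eucl_dist R k) alpha E)%E.
    by move=> /eqP E0; rewrite lt_def E0 hausdorff_measure_ge0.
  suff : (q'%:E <= ess_sup_dim B)%E by rewrite qE lee_fin leNgt qq'.
  rewrite /ess_sup_dim dB /= (pos _ pB) le_max; apply/orP; right.
  apply: ereal_sup_ubound; exists q'; last by [].
  by split; [exact: le_trans (ltW qq')|exact: pos].
exact: Gamma_null_removal s0 bB bC eB C0 BC.
Qed.
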